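(* Let $\Psi_\Lambda=\{\psi_\lambda(\cdot-u)\}_{u\in\mathbb{R}^d,\lambda\in\Lambda}$ be a semi-discrete frame of real-valued band-limited functions in $L^2(\mathbb{R}^d)$ that have good F-support overlap. For each $\lambda\in\Lambda$ let $X_\lambda=\{x_{\lambda,\mathbf n}\}_{\mathbf n\in\mathbb{Z}^d}=(M_\lambda^{T})^{-1}D[2\mathbf{s}_\lambda]^{-1}\mathbb{Z}^d$ be a sign-blind sampling set for $F_\lambda=\operatorname{supp}\widehat{\psi}_\lambda$. Furthermore, let $f\in L^2(\mathbb{R}^d)$ be real-valued and satisfy $\int_{\mathbb{R}^d}|f(x)|e^{\alpha|x|}\,dx<\infty$ for some $\alpha>0$. Then $f$ can be uniquely recovered, up to one global sign factor, from the unsigned samples $\{|f\ast\psi_\lambda|(X_\lambda)\}_{\lambda\in\Lambda}$. In fact, if any real-valued $h\in L^2(\mathbb{R}^d)$ satisfies $|f\ast\psi_\lambda|(X_\lambda)=|h\ast\psi_\lambda|(X_\lambda)$ for all $\lambda\in\Lambda$, then $h=\sigma f$ with an unknown sign factor $\sigma\in\{-1,1\}$.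
   Context: The Fourier transform is $\hat f(\xi)=\int_{\mathbb{R}^d}f(x)e^{-2\pi i x\cdot\xi}\,dx$. For a lattice $X_\lambda=\{x_{\lambda,\mathbf n}\}_{\mathbf n\in\mathbb{Z}^d}$, $|g|(X_\lambda)$ denotes the family of samples $(|g(x_{\lambda,\mathbf n})|)_{\mathbf n\in\mathbb{Z}^d}$. Semi-discrete frame: $\Lambda$ is a discrete index set and $\{\psi_\lambda\}_{\lambda\in\Lambda}\subset L^2(\mathbb{R}^d)$ is a collection of real-valued functions that are band-limited, i.e. each $F_\lambda:=\operatorname{supp}\widehat\psi_\lambda$ is compact. $\Psi_\Lambda=\{\psi_\lambda(\cdot-u)\}_{u\in\mathbb{R}^d,\lambda\in\Lambda}$ is a semi-discrete frame if there are constants $B\ge A>0$ with $A\|f\|_2^2\le\sum_{\lambda\in\Lambda}\|f\ast\psi_\lambda\|_2^2\le B\|f\|_2^2$ for all $f\in L^2(\mathbb{R}^d)$. Good F-support overlap (good Fourier-support overlap): for each $\lambda\in\Lambda$ there is a non-empty set $U_\lambda\subset F_\lambda$, open in $\mathbb{R}^d$, such that $\bigcup_{\lambda\in\Lambda}U_\lambda=\mathbb{R}^d$. Sign-blind sampling set: let $F\subset\mathbb{R}^d$ be compact and $M$ a non-singular real $d\times d$ matrix with $F\subseteq M[-\tfrac12,\tfrac12]^d$. A sign-blind sampling set for $F$ is any lattice of the form $X=(M^{T})^{-1}D[2\mathbf{s}]^{-1}\mathbb{Z}^d$, where $D[\mathbf{s}]=\operatorname{diag}(s_1,\dots,s_d)$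 with real $s_1,\dots,s_d\ge1$.
   Formalization: Added hypothesis: for each λ, the points near which ψ̂_λ is a.e. nonzero are dense in the interior of F_λ (automatic if ψ̂_λ is continuous or a.e. nonzero on F_λ); without it the claim fails, e.g. for ψ̂_λ indicators of a set that, like its complement, meets every ball in positive measure. *)

(* Defs.v *)
From HB Require Import structures.
From mathcomp Require Import all_boot all_order all_algebra.
From mathcomp Require Import all_classical all_reals all_analysis.
From mathcomp.real_closed Require Import complex.

Set Implicit Arguments.
Unset Strict Implicit.
Unset Printing Implicit Defensive.

Import Order.TTheory GRing.Theory Num.Theory.
Import numFieldNormedType.Exports.

Local Open Scope classical_set_scope.
Local Open Scope ring_scope.

(* Points of R^d are column vectors ['cV[R]_d], so that matrices act on the
   left. Their topology is the library's (product) topology. The sigma-algebra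
   is the one generated by the coordinate maps, i.e. the Borel one. *)
Definition measure_cV_display : measure_display -> measure_display.
Proof. exact. Qed.

Section measurable_cV.
Context {d} {T : measurableType d} (n : nat).

Definition cV_coord (i : 'I_n) (x : 'cV[T]_n) : T := x i ord0.

Let cV_set0 : g_sigma_preimage cV_coord set0.
Proof. exact: sigma_algebra0. Qed.

Let cV_setC A : g_sigma_preimage cV_coord A -> g_sigma_preimage cV_coord (~` A).
Proof. exact: sigma_algebraC. Qed.

Let cV_bigcup (F : _^nat) : (forall i, g_sigma_preimage cV_coord (F i)) ->
  g_sigma_preimage cV_coord (\bigcup_i (F i)).
Proof. exact: sigma_algebra_bigcup. Qed.

HB.instance Definition _ := @isMeasurable.Build (measure_cV_display d)
  'cV[T]_n (g_sigma_preimage cV_coord) cV_set0 cV_setC cV_bigcup.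

End measurable_cV.

Lemma measurable_cV_coord d (T : measurableType d) n (i : 'I_n) :
  measurable_fun [set: 'cV[T]_n] (fun x : 'cV[T]_n => x i ord0).
Proof.
move=> _ Y mY; rewrite setTI; apply: sub_sigma_algebra => /=.
rewrite -bigcup_seq/=; exists i => /=; first by rewrite mem_index_enum.
by exists Y => //; rewrite setTI.
Qed.

Lemma measurable_fun_cV d1 d2 (T1 : measurableType d1) (T2 : measurableType d2)
    n (f : T1 -> 'cV[T2]_n) :
  (forall i, measurable_fun [set: T1] (fun x => f x i ord0)) ->
  measurable_fun [set: T1] f.
Proof.
move=> mf _ A mA; rewrite setTI.
suff: g_sigma_preimage (@cV_coord _ T2 n) `<=` [set B | measurable (f @^-1` B)].
  exact.
apply: smallest_sub.
  split => /=; first by rewrite preimage_set0.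
  - by move=> B mB; rewrite setTD preimage_setC; exact: measurableC.
  - by move=> F mF; rewrite preimage_bigcup; exact: bigcup_measurable.
move=> B; rewrite -bigcup_seq/= => -[i _ [Y mY <-]] /=.
by have := mf i measurableT _ mY; rewrite !setTI.
Qed.

(* Lebesgue measure on R^n, by recursion on n: a point mass for n = 0, and the
   product measure transported along [R * R^n -> R^(n+1)] otherwise. *)
Section lebesgue_measure_cV.
Context {R : realType}.

Definition cV_cons n (p : measurableTypeR R * 'cV[R]_n) : 'cV[R]_n.+1 :=
  \col_i (if unlift ord0 i is Some j then p.2 j ord0 else p.1).

Definition cV_uncons n (v : 'cV[R]_n.+1) : measurableTypeR R * 'cV[R]_n :=
  (v ord0 ord0, \col_i v (lift ord0 i) ord0).

Lemma cV_consE0 n p : @cV_cons n p ord0 ord0 = p.1.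
Proof. by rewrite mxE unlift_none. Qed.

Lemma cV_consES n p i : @cV_cons n p (lift ord0 i) ord0 = p.2 i ord0.
Proof. by rewrite mxE liftK. Qed.

Lemma cV_consK n : cancel (@cV_cons n) (@cV_uncons n).
Proof.
move=> [x v]; rewrite /cV_uncons cV_consE0; congr pair.
by apply/matrixP => i j; rewrite mxE cV_consES (ord1 j).
Qed.

Lemma measurable_cV_cons n : measurable_fun setT (@cV_cons n).
Proof.
apply: measurable_fun_cV => i.
have [j ->|->] := unliftP ord0 i.
- under eq_fun do rewrite cV_consES.
  apply: (measurableT_comp (measurable_cV_coord j)); exact: measurable_snd.
- under eq_fun do rewrite cV_consE0.
  exact: measurable_fst.
Qed.

Lemma measurable_cV_uncons n : measurable_fun setT (@cV_uncons n).
Proof.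
apply/measurable_fun_pair; first exact: measurable_cV_coord.
apply: measurable_fun_cV => i.
under eq_fun do rewrite mxE.
exact: measurable_cV_coord.
Qed.

Section step.
Context n (mu : {sigma_finite_measure set 'cV[R]_n -> \bar R}).

Definition lebesgue_cV_step : set 'cV[R]_n.+1 -> \bar R :=
  pushforward (lebesgue_measure \x mu)%E (@cV_cons n).

Let step_measure : {measure set 'cV[R]_n.+1 -> \bar R} :=
  measure_function_pushforward__canonical__measure_function_Measure
    (lebesgue_measure \x mu)%E (@measurable_cV_cons n).

Let step0 : lebesgue_cV_step set0 = 0%E.
Proof. exact: (measure0 step_measure). Qed.

Let step_ge0 A : (0 <= lebesgue_cV_step A)%E.
Proof. exact: (measure_ge0 step_measure). Qed.

Let step_sigma_additive : semi_sigma_additive lebesgue_cV_step.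
Proof. exact: (@measure_semi_sigma_additive _ _ _ step_measure). Qed.

HB.instance Definition _ := isMeasure.Build _ _ _ lebesgue_cV_step
  step0 step_ge0 step_sigma_additive.

Lemma lebesgue_cV_step_sigma_finite : sigma_finite setT lebesgue_cV_step.
Proof.
have /sigma_finiteP[F [TF ndF Foo]] := sigma_finiteT (@lebesgue_measure R).
have /sigma_finiteP[G [TG ndG Goo]] := sigma_finiteT mu.
exists (fun k => @cV_uncons n @^-1` (F k `*` G k)).
  rewrite -preimage_bigcup -[LHS](preimage_setT (@cV_uncons n)).
  congr (_ @^-1` _); rewrite -setXTT TF TG predeqE => -[x y]; split.
    move=> [/= [i _ Fix] [j _ Gjy]]; exists (maxn i j) => //; split.
    - by move: x Fix; exact/subsetPset/ndF/leq_maxl.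
    - by move: y Gjy; exact/subsetPset/ndG/leq_maxr.
  by move=> [k _ []/= ? ?]; split; exists k.
move=> k; have [? ?] := Foo k; have [? ?] := Goo k; split.
  rewrite -[X in measurable X]setTI.
  by apply: measurable_cV_uncons => //; exact: measurableX.
rewrite /lebesgue_cV_step /pushforward -comp_preimage.
rewrite (_ : _ \o _ = id); last by apply/funext => x /=; rewrite cV_consK.
by rewrite preimage_id product_measure1E// lte_mul_pinfty// ge0_fin_numE.
Qed.

HB.instance Definition _ := Measure_isSigmaFinite.Build _ _ _ lebesgue_cV_step
  lebesgue_cV_step_sigma_finite.

End step.

Fixpoint lebesgue_cV n : {sigma_finite_measure set 'cV[R]_n -> \bar R} :=
  match n with
  | 0 => \d_(0 : 'cV[R]_0)
  | n'.+1 => lebesgue_cV_step (lebesgue_cV n')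
  end.

End lebesgue_measure_cV.

Section lebesgue_measure_cV_box.
Context {R : realType}.

Lemma lebesgue_cV_box n (a b : 'cV[R]_n) :
  (forall i, a i ord0 <= b i ord0) ->
  lebesgue_cV n [set x : 'cV[R]_n | forall i, x i ord0 \in `[a i ord0, b i ord0]] =
  (\prod_i (b i ord0 - a i ord0))%:E.
Proof.
elim: n a b => [|n ih] a b ab.
  by rewrite big_ord0 /= diracE mem_set//= => -[].
pose u (v : 'cV[R]_n.+1) : 'cV[R]_n := \col_i v (lift ord0 i) ord0.
set B := [set x | _].
have BE : @cV_cons R n @^-1` B = [set` `[a ord0 ord0, b ord0 ord0]] `*`
    [set x : 'cV[R]_n | forall i, x i ord0 \in `[u a i ord0, u b i ord0]].
  apply/seteqP; split=> [[x v] /= H|[x v] /= [Hx Hv] i].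
    split; first by have := H ord0; rewrite cV_consE0.
    by move=> i; have := H (lift ord0 i); rewrite cV_consES !mxE.
  have [j ->|->] := unliftP ord0 i; last by rewrite cV_consE0.
  by have := Hv j; rewrite cV_consES !mxE.
transitivity ((lebesgue_measure \x lebesgue_cV n)%E (@cV_cons R n @^-1` B)).
  by [].
rewrite BE product_measure1E//; last first.
  rewrite (_ : mkset _ = \bigcap_(i : 'I_n)
      ((fun x : 'cV[R]_n => x i ord0) @^-1` `[u a i ord0, u b i ord0])).
    apply: fin_bigcap_measurable => [|i _]; first exact: finite_finset.
    by rewrite -[X in measurable X]setTI; exact: measurable_cV_coord.
  by apply/seteqP; split=> x /= H i; [move=> _; exact: H|exact: H].
rewrite ih => [|i]; last by rewrite !mxE.
rewrite big_ord_recl EFinM; congr (_ * _)%E; last first.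
  by congr EFin; apply: eq_bigr => i _; rewrite !mxE.
etransitivity; first exact: (lebesgue_measure_itv `[a ord0 ord0, b ord0 ord0]).
rewrite /= lte_fin.
by have := ab ord0; rewrite le_eqVlt => /predU1P[->|->//]; rewrite ltxx subrr.
Qed.

End lebesgue_measure_cV_box.

Section fourier.
Context {R : realType} (n : nat).
Local Notation mu := (lebesgue_cV n).
Implicit Types (f : 'cV[R]_n -> R) (g : 'cV[R]_n -> R[i]).

Definition dot_cV (x y : 'cV[R]_n) : R := \sum_i x i ord0 * y i ord0.

(* The library norm on matrices is the sup norm. *)
Definition euclidean_norm (x : 'cV[R]_n) : R := Num.sqrt (dot_cV x x).

Definition convolution (f1 f2 : 'cV[R]_n -> R) (x : 'cV[R]_n) : R :=
  \int[mu]_y (f1 y * f2 (x - y)).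

(* The integral of [f x * e ^ (- 2 pi i x.xi)], split into real and imaginary
   parts; meaningful for integrable f. *)
Definition fourier f (xi : 'cV[R]_n) : R[i] :=
  Complex (\int[mu]_x (f x * cos (2 * pi * dot_cV x xi)))
          (- \int[mu]_x (f x * sin (2 * pi * dot_cV x xi))).

(* The Fourier-Plancherel transform of a square-integrable f, determined up to
   a null set: the L^2 limit of the transforms of the truncations of f, which
   are integrable. *)
Definition is_fourier f g : Prop :=
  [/\ (fun xi => complex.Re (g xi)) \in Lfun mu 2%:E,
      (fun xi => complex.Im (g xi)) \in Lfun mu 2%:E &
      (fun k : nat => Lnorm mu 2%:E (fun xi =>
         (ComplexField.Normc.normc (fourier (f \_ [set x | euclidean_norm x <= k%:R]) xi
                 - g xi))%:E))
        @ \oo --> 0%E].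

(* Closed support of a function known up to a null set. *)
Definition ess_support g : set 'cV[R]_n :=
  [set x | forall V, nbhs x V -> ~ {ae mu, forall y, V y -> g y = 0}].

Definition ess_nonvanishing g : set 'cV[R]_n :=
  [set x | exists2 V, nbhs x V & {ae mu, forall y, V y -> g y <> 0}].

(* The points near which g is almost everywhere nonzero are dense in the
   interior of the closed support. This is automatic when g is continuous (for
   instance the transform of an integrable function) and when g is almost
   everywhere nonzero on its support; it excludes the indicator of a set E such
   that both E and its complement meet every ball in positive measure. *)
Definition regular_support g : Prop :=
  (ess_support g)° `<=` closure (ess_nonvanishing g).

Lemma open_regular_support g : open [set x | g x <> 0] -> regular_support g.
Proof.
move=> og x /interior_subset sx V Vx.
apply: contrapT => nV; apply: (sx V Vx); apply/nearW => y Vy.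
apply: contrapT => gy; apply: nV; exists y; split => //.
exists [set z | g z <> 0]; first exact: open_nbhs_nbhs.
exact/nearW.
Qed.

End fourier.

Section frames.
Context {R : realType} (n : nat) (Lambda : choiceType).
Local Notation mu := (lebesgue_cV n).

Definition semi_discrete_frame (psi : Lambda -> 'cV[R]_n -> R) : Prop :=
  exists A B : R, [/\ 0 < A, A <= B &
    forall f : 'cV[R]_n -> R, f \in Lfun mu 2%:E ->
      (A%:E * 'N[mu]_2%:E[EFin \o f] ^+ 2 <=
         \esum_(l in [set: Lambda]) 'N[mu]_2%:E[EFin \o convolution f (psi l)] ^+ 2
       <= B%:E * 'N[mu]_2%:E[EFin \o f] ^+ 2)%E].

Definition good_support_overlap (F : Lambda -> set 'cV[R]_n) : Prop :=
  exists U : Lambda -> set 'cV[R]_n,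
    [/\ forall l, U l !=set0,
        forall l, open (U l),
        forall l, U l `<=` F l &
        \bigcup_l U l = setT].

End frames.

Section sampling.
Context {R : realType} (n : nat).

Definition centered_cube : set 'cV[R]_n :=
  [set x : 'cV[R]_n | forall i, - (2^-1) <= x i ord0 <= 2^-1].

(* The lattice comes with its parametrization by Z^n. *)
Definition sign_blind_sampling_set (F : set 'cV[R]_n)
    (X : 'cV[int]_n -> 'cV[R]_n) : Prop :=
  exists (M : 'M[R]_n) (s : 'rV[R]_n),
    [/\ compact F, M \in unitmx, F `<=` [set M *m x | x in centered_cube],
        forall i, 1 <= s ord0 i &
        forall k, X k = invmx M^T *m invmx (diag_mx (2 *: s)) *m map_mx intr k].

End sampling.

(* Main.v *)
Require Import Defs.
From mathcomp Require Import all_boot all_order all_algebra.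
From mathcomp Require Import all_classical all_reals all_analysis.
From mathcomp Require Import measurable_realfun.
From mathcomp.real_closed Require Import complex.
From mathcomp Require Import ring lra.

Set Implicit Arguments.
Unset Strict Implicit.
Unset Printing Implicit Defensive.

Import Order.TTheory GRing.Theory Num.Theory.
Import numFieldNormedType.Exports.

Local Open Scope classical_set_scope.
Local Open Scope ring_scope.

(* Write G = f * psi_l and H = h * psi_l. These are Fourier integrals of the
   compactly supported products of the transforms of f, h and psi_l, and G and H
   are real, so G^2 - H^2 is a trigonometric integral with frequencies in the
   sum set F_l + F_l. The sampling lattice is fine enough for this set: in lattice
   coordinates the frequencies lie in (-1/2, 1/2)^d up to a null set, and a
   trigonometric integral with such frequencies vanishes identically as soon as
   it vanishes on Z^d, by polynomial approximation in one variable at a time.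
   Hence G^2 = H^2, and since G - H and G + H are real-analytic, G = H or G = -H.
   The sets U_l where the first, respectively the second, alternative holds form
   two open sets covering R^d. If one of them is empty, f - h or f + h is
   annihilated by all channels and vanishes by the lower frame bound. Otherwise
   they meet, R^d being connected; the transform of f then vanishes on a
   nonempty open set, hence everywhere, because the exponential moment makes it
   real-analytic, so that f = 0 and, again by the frame bound, h = 0.

   Everything is kept real: a transform is a pair (hc, hs) standing for hc - i hs,
   and inversion and injectivity come from testing with e^{- e |xi|_1}, whose
   transform is a product of Poisson kernels. *)

(** * Integrable and square-integrable functions *)

(** The weight e^{- e |xi|_1} is used instead of a Gaussian because it is a product over the
    coordinates and everything about it is explicit: its transform comes from an elementary
    antiderivative, and Poisson integrals of intervals are differences of arctangents. Inversion
    holds only almost everywhere, but it is applied to psi_l inside the integral defining f * psi_l,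
    so the resulting formula holds at every point, in particular at the sampling points. In lattice
    coordinates the factor 2 in D[2s] sends F_l into the cube of half-side 1/4, so that sums of two
    frequencies have coordinates at most 1/2. The value 1/2 must be avoided: sin (2 pi n z) vanishes
    at z = 1/2 for every integer n. Each of f, h and psi_l has its own kind of transform: an
    absolutely convergent integral for f, an L^2 limit to be constructed for h, a given
    representative [psihat l] for psi_l; [plancherel_pair] is the property common to the three.
    Nonvanishing of [psihat l] is available only almost everywhere on open sets, and regularity of
    the supports lets two channels share such a set. *)

Lemma cvg_sqr_le (R : realType) (b a : nat -> R) (l : R) :
  b n @[n --> \oo] --> 0 -> (forall n, (a n - l) ^+ 2 <= b n) ->
  a n @[n --> \oo] --> l.
Proof.
move=> b0 ab; apply/cvgrPdist_lt => e e0.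
have /cvgr0_norm_lt/(_ (e ^+ 2)) := b0; rewrite exprn_gt0// => /(_ isT).
apply: filterS => n bn; rewrite distrC -(@ltr_pXn2r _ 2)// ?nnegrE//; last exact: ltW.
rewrite real_normK ?num_real//.
by apply: le_lt_trans (ab n) _; exact: le_lt_trans (ler_norm _) bn.
Qed.

Lemma geometric_cauchy (R : realType) (a : nat -> R) (c : R) :
  (forall n m, (n <= m)%N -> `|a m - a n| <= 2^-1 ^+ n * c) ->
  a n @[n --> \oo] --> limn a /\ forall n, `|a n - limn a| <= 2^-1 ^+ n * c.
Proof.
move=> ac.
have c2 : 2^-1 ^+ n * c @[n --> \oo] --> (0 : R).
  have := @cvg_geometric R c 2^-1; under eq_cvg do rewrite /= mulrC.
  by apply; rewrite ger0_norm; lra.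
have cva : cvgn a.
  apply/cauchy_cvgP/cauchy_exP => e e0.
  have /cvgr0_norm_lt/(_ _ e0)[N _ HN] := c2.
  exists (a N); exists N => // n /= Nn; rewrite /ball/= distrC.
  apply: le_lt_trans (ac _ _ Nn) _; apply: le_lt_trans (HN N (leqnn _)).
  exact: ler_norm.
split => // n.
apply: (@cvgr_to_le _ _ _ _ (fun m => `|a n - a m|) _ _ (cvg_norm (cvgB (@cvg_cst _ _ _ _ _) cva))).
by exists n => // m /= nm; rewrite distrC; exact: ac.
Qed.

Section L1.
Context d (T : measurableType d) (R : realType) (mu : {measure set T -> \bar R}).
Implicit Types f g b : T -> R.

Definition L1 f := mu.-integrable setT (EFin \o f).
(** Measurability is a separate clause because it does not follow from that of the square. [L2_Lfun]
    and [Lfun_L2] translate to and from the library's spaces. *)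
Definition L2 f := measurable_fun setT f /\ L1 (fun x => f x ^+ 2).

Lemma L1_measurable f : L1 f -> measurable_fun setT f.
Proof. by move=> /(measurable_int mu)/measurable_EFinP. Qed.

Lemma L1_le f g : measurable_fun setT f -> (forall x, `|f x| <= `|g x|) ->
  L1 g -> L1 f.
Proof.
move=> mf fg; apply: le_integrable => //; first exact/measurable_EFinP.
by move=> x _; rewrite /= lee_fin.
Qed.

Lemma eq_L1 f g : f =1 g -> L1 f -> L1 g.
Proof. by move=> /funext ->. Qed.

Lemma L1D f g : L1 f -> L1 g -> L1 (fun x => f x + g x).
Proof. exact: integrableD. Qed.

Lemma L1B f g : L1 f -> L1 g -> L1 (fun x => f x - g x).
Proof. exact: integrableB. Qed.

Lemma L1Z (c : R) f : L1 f -> L1 (fun x => c * f x).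
Proof. exact: integrableZl. Qed.

Lemma L1_0 : L1 (fun=> 0).
Proof. exact: integrable0. Qed.

Lemma L1_norm f : L1 f -> L1 (fun x => `|f x|).
Proof. exact: integrable_norm. Qed.

Lemma L1_bounded (C : R) f b : L1 f -> measurable_fun setT b ->
  (forall x, `|b x| <= C) -> L1 (fun x => f x * b x).
Proof.
move=> lf mb bC; apply: (@L1_le _ (fun x => C * f x)).
- by apply: measurable_funM => //; exact: L1_measurable.
- move=> x; rewrite !normrM mulrC ler_wpM2r//.
  by rewrite (le_trans (bC x))// ler_norm.
- exact: L1Z.
Qed.

Lemma L1_ae f g : measurable_fun setT g -> L1 f ->
  {ae mu, forall x, f x = g x} -> L1 g.
Proof.
move=> mg lf fg; apply/integrableP; split; first exact/measurable_EFinP.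
have /integrableP[_] := lf; congr (_ < _)%E.
apply: ae_eq_integral => //.
- by apply: measurableT_comp => //; exact: measurable_int lf.
- by apply: measurableT_comp => //; exact/measurable_EFinP.
- by apply: filterS fg => x /= -> _.
Qed.

Lemma ae_eq_Rintegral f g : measurable_fun setT f -> measurable_fun setT g ->
  {ae mu, forall x, f x = g x} -> \int[mu]_x f x = \int[mu]_x g x.
Proof.
move=> mf mg fg; congr fine; apply: ae_eq_integral => //.
- exact/measurable_EFinP.
- exact/measurable_EFinP.
- by apply: filterS fg => x /= -> _.
Qed.

Lemma EFin_Rintegral f : L1 f ->
  ((\int[mu]_x f x)%:E = \int[mu]_x (f x)%:E)%E.
Proof. by move=> lf; rewrite fineK//; exact: integrable_fin_num. Qed.

Lemma Rintegral_eq0_ae f : L1 f -> (forall x, 0 <= f x) ->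
  \int[mu]_x f x = 0 -> {ae mu, forall x, f x = 0}.
Proof.
move=> lf f0 i0.
have mf : measurable_fun setT (EFin \o f) by exact: measurable_int lf.
have : (\int[mu]_x `|(f x)%:E| = 0)%E.
  under eq_integral do rewrite gee0_abs ?lee_fin//.
  by rewrite -EFin_Rintegral// i0.
move=> /(ae_eq_integral_abs mu measurableT mf).
by apply: filterS => x /(_ I) [].
Qed.

Lemma le_Rintegral_norm f g : L1 g -> measurable_fun setT f ->
  (forall x, `|f x| <= g x) -> `|\int[mu]_x f x| <= \int[mu]_x g x.
Proof.
move=> lg mf fg.
have lf : L1 f by apply: L1_le lg => // x; exact: le_trans (fg x) (ler_norm _).
apply: le_trans (le_normr_Rintegral measurableT lf) _.
by apply: le_Rintegral => //; exact: L1_norm.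
Qed.

Lemma L2_mul f g : L2 f -> L2 g -> L1 (fun x => f x * g x).
Proof.
move=> [mf lf] [mg lg].
apply: (@L1_le _ (fun x => f x ^+ 2 + g x ^+ 2)); last exact: L1D.
  exact: measurable_funM.
move=> x; rewrite [leRHS]ger0_norm ?addr_ge0 ?sqr_ge0// normrM.
rewrite -(real_normK (num_real (f x))) -(real_normK (num_real (g x))).
by nra.
Qed.

Lemma L2Z c f : L2 f -> L2 (fun x => c * f x).
Proof.
move=> [mf lf]; split; first exact: measurable_funM.
by apply: eq_L1 (L1Z (c ^+ 2) lf) => x; rewrite exprMn.
Qed.

Lemma L2D f g : L2 f -> L2 g -> L2 (fun x => f x + g x).
Proof.
move=> lf lg; have lfg := L2_mul lf lg.
move: lf lg => [mf lf] [mg lg]; split; first exact: measurable_funD.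
by apply: eq_L1 (L1D (L1D lf lg) (L1Z 2 lfg)) => x; ring.
Qed.

Lemma L2N f : L2 f -> L2 (fun x => - f x).
Proof. by move=> /(L2Z (-1)); under eq_fun do rewrite mulN1r. Qed.

Lemma L2B f g : L2 f -> L2 g -> L2 (fun x => f x - g x).
Proof. by move=> lf /L2N; exact: L2D. Qed.

Lemma L2_0 : L2 (fun=> 0).
Proof. by split => //; apply: eq_L1 L1_0 => x; rewrite expr0n. Qed.

Lemma L2_le f g : measurable_fun setT f -> (forall x, `|f x| <= `|g x|) ->
  L2 g -> L2 f.
Proof.
move=> mf fg [mg lg]; split => //.
apply: L1_le lg; first exact: measurable_funX.
by move=> x; rewrite !normrX lerXn2r ?nnegrE.
Qed.

Lemma L2_bounded (C : R) f b : L2 f -> measurable_fun setT b ->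
  (forall x, `|b x| <= C) -> L2 (fun x => f x * b x).
Proof.
move=> lf mb bC; apply: (@L2_le _ (fun x => C * f x)); last exact: L2Z.
  by apply: measurable_funM => //; exact: lf.1.
move=> x; rewrite !normrM mulrC ler_wpM2r//.
by rewrite (le_trans (bC x))// ler_norm.
Qed.

Lemma L2_ae f g : measurable_fun setT g -> L2 f ->
  {ae mu, forall x, f x = g x} -> L2 g.
Proof.
move=> mg [mf lf] fg; split => //; apply: L1_ae lf _.
  exact: measurable_funX.
by apply: filterS fg => x ->.
Qed.

Lemma L1_bounded_L2 (C : R) f : L1 f -> (forall x, `|f x| <= C) -> L2 f.
Proof.
move=> lf fC; split; first exact: L1_measurable.
apply: eq_L1 (L1_bounded lf (L1_measurable lf) fC) => x; by rewrite expr2.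
Qed.

Lemma L2_sqr_ge0 f : 0 <= \int[mu]_x (f x ^+ 2).
Proof. by apply: Rintegral_ge0 => x _; exact: sqr_ge0. Qed.

(** The integral of (s f + t g)^2 is a nonnegative quadratic form in (s, t). The usual choice (- b,
    a) degenerates when a = 0; there (- (c + 1), b) forces b = 0. *)
Lemma cauchy_schwarz f g : L2 f -> L2 g ->
  (\int[mu]_x (f x * g x)) ^+ 2 <=
  (\int[mu]_x (f x ^+ 2)) * (\int[mu]_x (g x ^+ 2)).
Proof.
move=> lf lg; have lfg := L2_mul lf lg.
set a := \int[mu]_x (f x ^+ 2); set c := \int[mu]_x (g x ^+ 2).
set b := \int[mu]_x (f x * g x).
have a0 : 0 <= a by exact: L2_sqr_ge0.
have c0 : 0 <= c by exact: L2_sqr_ge0.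
have H (s t : R) : 0 <= s ^+ 2 * a + 2 * s * t * b + t ^+ 2 * c.
  have := L2_sqr_ge0 (fun x => s * f x + t * g x).
  rewrite (_ : \int[mu]_x _ = \int[mu]_x ((s ^+ 2 * f x ^+ 2 +
    2 * s * t * (f x * g x)) + t ^+ 2 * g x ^+ 2)); last first.
    by apply: eq_Rintegral => x _; ring.
  rewrite RintegralD//; last 2 first.
    - by apply: L1D; [apply: L1Z; case: lf|exact: L1Z].
    - by apply: L1Z; case: lg.
  rewrite RintegralD//; last 2 first.
    - by apply: L1Z; case: lf.
    - exact: L1Z.
  by rewrite (RintegralZl _ _ lf.2)// (RintegralZl _ _ lg.2)// (RintegralZl _ _ lfg).
have [a_gt0|a_le0] := ltP 0 a.
  have := H (- b) a.
  rewrite (_ : _ + _ = a * (a * c - b ^+ 2)); last by ring.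
  by rewrite pmulr_rge0// subr_ge0.
have a_eq0 : a = 0 by apply/eqP; rewrite eq_le a_le0.
move: H; rewrite a_eq0 => H.
rewrite mul0r.
have : 0 <= - (b ^+ 2 * (c + 2)).
  by have := H (- (c + 1)) b; rewrite (_ : _ + _ = - (b ^+ 2 * (c + 2)))//; ring.
rewrite oppr_ge0 pmulr_lle0//; lra.
Qed.


Lemma dominated_cvg_Rintegral (F : nat -> T -> R) f g :
  (forall n, measurable_fun setT (F n)) -> measurable_fun setT f ->
  {ae mu, forall x, F n x @[n --> \oo] --> f x} -> L1 g ->
  (forall n x, `|F n x| <= g x) ->
  \int[mu]_x F n x @[n --> \oo] --> \int[mu]_x f x.
Proof.
move=> mF mf Ff lg Fg.
have lF n : L1 (F n) by apply: L1_le lg => // x; exact: le_trans (Fg n x) (ler_norm _).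
have [|||||lf _ H] := @dominated_convergence _ _ _ mu setT measurableT
    (fun n => EFin \o F n) (EFin \o f) (EFin \o g).
- by move=> n; exact/measurable_EFinP.
- exact/measurable_EFinP.
- apply: filterS Ff => x Ffx _; exact/cvg_EFin/Ffx/nearW.
- exact: lg.
- by apply/nearW => x n _; rewrite lee_fin.
apply: fine_cvg; rewrite EFin_Rintegral//.
Qed.

Lemma L2_cvg_mul (F : nat -> T -> R) f g :
  (forall n, L2 (F n)) -> L2 f -> L2 g ->
  \int[mu]_x (F n x - f x) ^+ 2 @[n --> \oo] --> 0 ->
  \int[mu]_x (F n x * g x) @[n --> \oo] --> \int[mu]_x (f x * g x).
Proof.
move=> lF lf lg F0.
set c := \int[mu]_x (g x ^+ 2).
apply: (@cvg_sqr_le _ (fun n => \int[mu]_x (F n x - f x) ^+ 2 * c)).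
  by rewrite -(mul0r c); apply: cvgM => //; exact: cvg_cst.
move=> n; rewrite -RintegralB//; [|exact: L2_mul|exact: L2_mul].
under eq_Rintegral do rewrite -mulrBl.
by apply: cauchy_schwarz => //; exact: L2B.
Qed.

(** The weighted sum S of 4^(k+1) (u_(k+1) - u_k)^2 has integral at most the sum of the 2^-(k+1),
    hence is finite almost everywhere. Where it is finite, each increment is at most 2^-(k+1) sqrt
    S, so the sequence is Cauchy with rate 2^-n sqrt S, and the squared distance to the limit is at
    most 4^-n S, an integrable bound. *)
Lemma L2_complete_geometric (u : nat -> T -> R) :
  (forall n, L2 (u n)) ->
  (forall n, \int[mu]_x ((u n.+1 x - u n x) ^+ 2) <= 8^-1 ^+ n.+1) ->
  exists2 v, L2 v & \int[mu]_x (u n x - v x) ^+ 2 @[n --> \oo] --> 0.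
Proof.
move=> lu ule.
pose D k x := 4 ^+ k.+1 * (u k.+1 x - u k x) ^+ 2.
have D0 k x : 0 <= D k x by rewrite mulr_ge0// sqr_ge0.
have lD k : L1 (D k) by apply: L1Z; case: (L2B (lu k.+1) (lu k)).
have mD k : measurable_fun setT (EFin \o D k).
  exact/measurable_EFinP/L1_measurable.
pose S x := (\sum_(k <oo) (D k x)%:E)%E.
have S0 x : (0 <= S x)%E by apply: nneseries_ge0 => k _ _; rewrite lee_fin.
have mS : measurable_fun setT S.
  apply: (@ge0_emeasurable_sum _ _ _ _ (fun k x => (D k x)%:E) xpredT) => //.
  - by move=> k x _ _; rewrite lee_fin.
  - by move=> k _; exact: mD.
have lS : mu.-integrable setT S.
  apply/integrableP; split => //.
  under eq_integral do rewrite gee0_abs//.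
  rewrite integral_nneseries//; last by move=> k x _; rewrite lee_fin.
  apply: (@le_lt_trans _ _ 1%:E); last exact: ltry.
  apply: le_trans (@epsilon_trick0 R 1 xpredT ler01).
  apply: lee_nneseries => [k _ _|k _]; first by apply: integral_ge0 => x _; rewrite lee_fin.
  rewrite -EFin_Rintegral// lee_fin RintegralZl//; last by case: (L2B (lu k.+1) (lu k)).
  apply: le_trans (ler_wpM2l _ (ule k)) _; first exact: exprn_ge0.
  rewrite -exprMn natrX div1r -exprVn.
  by rewrite (_ : 4 * 8^-1 = 2^-1 :> R)//; field.
have Sfin := integrable_ae measurableT lS.
pose A := [set x | S x \is a fin_num].
have mA : measurable A by rewrite -[A]setTI; exact: emeasurable_fin_num.
pose s x := fine (S x).
have s0 x : 0 <= s x by exact: fine_ge0.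
have ls : L1 s.
  apply/integrableP; split.
    by apply/measurable_EFinP; exact: (measurableT_comp (fine_measurable measurableT)).
  have /integrableP[_] := lS; apply: le_lt_trans; apply: ge0_le_integral => //.
  - apply: measurableT_comp => //.
    by apply/measurable_EFinP; exact: (measurableT_comp (fine_measurable measurableT)).
  - exact: measurableT_comp.
  - by move=> x _; rewrite /= /s; case: (S x) => //=; rewrite ?leey.
(* Cutting off the null set where S is infinite makes the sequence converge everywhere, so that its
   limit is measurable. *)
pose U n x := u n x * \1_A x.
have mU n : measurable_fun setT (U n).
  by apply: measurable_funM => //; case: (lu n).
have Ucauchy x n m : (n <= m)%N -> `|U m x - U n x| <= 2^-1 ^+ n * Num.sqrt (s x).
  rewrite /U indicE; case: (boolP (x \in A)) => [|_ _]; last first.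
    by rewrite !mulr0 subrr normr0 mulr_ge0// ?exprn_ge0// sqrtr_ge0.
  rewrite inE /A/= => Sx; rewrite !mulr1 => nm.
  have step k : `|u k.+1 x - u k x| <= 2^-1 ^+ k.+1 * Num.sqrt (s x).
    have : D k x <= s x.
      rewrite -lee_fin /s fineK//.
      apply: le_trans (@nneseries_lim_ge R (fun k => (D k x)%:E) xpredT 0%N k.+1 _).
        rewrite big_nat_recr//= leeDr//.
        by apply: sume_ge0 => i _; rewrite lee_fin.
      by move=> i _ _; rewrite lee_fin.
    move=> Ds; rewrite -ler_sqr ?nnegrE ?mulr_ge0 ?exprn_ge0 ?sqrtr_ge0//.
    rewrite exprMn sqr_sqrtr// real_normK ?num_real// -exprM mulnC exprM.
    rewrite -(@ler_pM2l _ (4 ^+ k.+1)) ?exprn_gt0//.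
    apply: le_trans Ds _; rewrite mulrA -exprMn.
    by rewrite (_ : 4 * 2^-1 ^+ 2 = 1 :> R) ?expr1n ?mul1r//; field.
  have : `|u m x - u n x| <= (2^-1 ^+ n - 2^-1 ^+ m) * Num.sqrt (s x).
    elim: m nm => [|m ih].
      by rewrite leqn0 => /eqP ->; rewrite !subrr normr0 mul0r.
    rewrite leq_eqVlt => /predU1P[->|]; first by rewrite !subrr normr0 mul0r.
    rewrite ltnS => /ih {}ih.
    rewrite (_ : _ - _ = (u m.+1 x - u m x) + (u m x - u n x)); last by ring.
    apply: le_trans (ler_normD _ _) _; apply: le_trans (lerD (step m) ih) _.
    by rewrite -mulrDl ler_wpM2r ?sqrtr_ge0// exprS; lra.
  move=> /le_trans; apply; rewrite ler_wpM2r ?sqrtr_ge0// gerBl.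
  exact: exprn_ge0.
have {}Ucauchy x := @geometric_cauchy _ (U ^~ x) _ (Ucauchy x).
pose v x := limn (U ^~ x).
have Uv x : U ^~ x @ \oo --> v x by case: (Ucauchy x).
have Uvle n x : `|U n x - v x| <= 2^-1 ^+ n * Num.sqrt (s x) by case: (Ucauchy x).
have mv : measurable_fun setT v by apply: (measurable_fun_cvg mU) => x _; exact: Uv.
have Uvsq n x : (U n x - v x) ^+ 2 <= 4^-1 ^+ n * s x.
  rewrite -real_normK ?num_real//.
  have := Uvle n x; rewrite -ler_sqr ?nnegrE ?mulr_ge0 ?exprn_ge0 ?sqrtr_ge0//.
  rewrite exprMn sqr_sqrtr// -exprM mulnC exprM.
  by rewrite (_ : 2^-1 ^+ 2 = 4^-1 :> R)//; field.
have uU n : {ae mu, forall x, u n x = U n x}.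
  apply: filterS Sfin => x /(_ I) Sx.
  by rewrite /U indicE mem_set// mulr1.
have lU n : L2 (U n) by apply: L2_ae (lu n) (uU n).
have lUv n : L2 (fun x => U n x - v x).
  split; first exact: measurable_funB.
  apply: (@L1_le _ (fun x => 4^-1 ^+ n * s x)); last exact: L1Z.
    by apply: measurable_funX; exact: measurable_funB.
  by move=> x; rewrite !ger0_norm ?sqr_ge0// mulr_ge0// exprn_ge0.
have lv : L2 v.
  have := L2B (lU 0%N) (lUv 0%N).
  by under eq_fun do rewrite opprB addrCA subrr addr0.
exists v => //.
apply: (@squeeze_cvgr _ _ _ _ (fun=> 0) (fun n => geometric (\int[mu]_x s x) 4^-1 n)).
- apply/nearW => n; rewrite L2_sqr_ge0/=.
  rewrite (@ae_eq_Rintegral _ (fun x => (U n x - v x) ^+ 2)).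
  + rewrite mulrC -RintegralZl//; apply: le_Rintegral => //.
      by case: (lUv n).
    exact: L1Z.
  + by apply: measurable_funX; apply: measurable_funB => //; case: (lu n).
  + by apply: measurable_funX; exact: measurable_funB.
  + by apply: filterS (uU n) => x ->.
- exact: cvg_cst.
- by apply: cvg_geometric; rewrite ger0_norm; lra.
Qed.

Lemma L2_sqrD f g : L2 f -> L2 g ->
  \int[mu]_x (f x + g x) ^+ 2 <=
  2 * \int[mu]_x (f x ^+ 2) + 2 * \int[mu]_x (g x ^+ 2).
Proof.
move=> lf lg; rewrite -!RintegralZl//; [|by case: lg|by case: lf].
have lf2 := L1Z 2 lf.2; have lg2 := L1Z 2 lg.2.
rewrite -RintegralD//; apply: le_Rintegral => //; first by case: (L2D lf lg).
  exact: L1D.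
by move=> x _; have := sqr_ge0 (f x - g x); rewrite sqrrB sqrrD; lra.
Qed.

Lemma L2_complete (u : nat -> T -> R) (e : nat -> R) :
  (forall n, L2 (u n)) -> e n @[n --> \oo] --> 0 ->
  (forall n m, (n <= m)%N -> \int[mu]_x ((u m x - u n x) ^+ 2) <= e n) ->
  exists2 v, L2 v & \int[mu]_x (u n x - v x) ^+ 2 @[n --> \oo] --> 0.
Proof.
move=> lu e0 ule.
have /choice[N HN] : forall k, exists N, forall n, (N <= n)%N -> e n <= 8^-1 ^+ k.+1.
  move=> k; have /cvgr0_norm_lt/(_ (8^-1 ^+ k.+1)) := e0.
  have p0 : (0 : R) < 8^-1 ^+ k.+1 by rewrite exprn_gt0// invr_gt0.
  move=> /(_ p0)[N _ H]; exists N => n Nn.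
  by apply/ltW; apply: le_lt_trans (H n Nn); exact: ler_norm.
(* The sum makes [phi] nondecreasing and at least [N k]; the extra [k] gives k <= phi k, which
   compares [u n] with [u (phi n)]. *)
pose phi k := (\sum_(i < k.+1) N i + k)%N.
have [|n|v lv v0] := @L2_complete_geometric (fun n => u (phi n)).
- by move=> n; exact: lu.
- apply: le_trans (ule (phi n) (phi n.+1) _) _.
    by rewrite /phi [in leqRHS]big_ord_recr/= -addnA leq_add2l (leq_trans (leqnSn _))// leq_addl.
  by apply: HN; rewrite /phi big_ord_recr/= -addnA addnCA leq_addr.
exists v => //.
apply: (@squeeze_cvgr _ _ _ _ (fun=> 0)
  (fun n => 2 * e n + 2 * \int[mu]_x (u (phi n) x - v x) ^+ 2)).
- apply: nearW => n; rewrite L2_sqr_ge0/=.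
  have -> : \int[mu]_x (u n x - v x) ^+ 2 =
      \int[mu]_x (- (u (phi n) x - u n x) + (u (phi n) x - v x)) ^+ 2.
    by apply: eq_Rintegral => x _; congr (_ ^+ 2); ring.
  apply: le_trans (L2_sqrD (L2N (L2B (lu _) (lu _))) (L2B (lu _) lv)) _.
  rewrite lerD2r ler_wpM2l//; under eq_Rintegral do rewrite sqrrN.
  by apply: ule; rewrite /phi leq_addl.
- exact: cvg_cst.
- rewrite [X in _ --> X](_ : 0 = 2 * 0 + 2 * 0); last by rewrite mulr0 addr0.
  by apply: cvgD; apply: cvgM => //; exact: cvg_cst.
Qed.

End L1.

(** * Fubini's theorem for real-valued integrals *)

Section Fubini.
Context d1 d2 (T1 : measurableType d1) (T2 : measurableType d2) (R : realType).
Variables (m1 : {sigma_finite_measure set T1 -> \bar R})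
          (m2 : {sigma_finite_measure set T2 -> \bar R}).
Implicit Types F : T1 * T2 -> R.

Lemma L1_prod (f : T1 -> R) (g : T2 -> R) : L1 m1 f -> L1 m2 g ->
  L1 (m1 \x m2)%E (fun z => f z.1 * g z.2).
Proof.
move=> lf lg.
have mf := L1_measurable lf; have mg := L1_measurable lg.
apply/integrable12ltyP => /=.
  apply/measurable_EFinP; apply: measurable_funM.
    by apply: measurableT_comp => //; exact: measurable_fst.
  by apply: measurableT_comp => //; exact: measurable_snd.
rewrite (_ : (fun x => _) = fun x => ((\int[m2]_y `|g y|)%:E * `|f x|%:E)%E); last first.
  apply/funext => x; rewrite EFin_Rintegral; last exact: L1_norm.
  rewrite muleC -ge0_integralZl//; last first.
    by apply/measurable_EFinP; exact: measurableT_comp.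
  by apply: eq_integral => y _; rewrite normrM EFinM.
rewrite ge0_integralZl//; last 2 first.
  by apply/measurable_EFinP; exact: measurableT_comp.
  by rewrite lee_fin; apply: Rintegral_ge0.
by rewrite -EFin_Rintegral; [rewrite -EFinM ltry|exact: L1_norm].
Qed.

(** On slices whose integral is infinite, [\int] takes the default value 0, which can only decrease
    the absolute value. *)
Lemma L1_fubini1 F : L1 (m1 \x m2)%E F -> L1 m1 (fun x => \int[m2]_y F (x, y)).
Proof.
move=> lF; have H := integrable_fubini_F lF.
have mF := measurable_int _ H.
have mG : measurable_fun setT (fun x => \int[m2]_y F (x, y)).
  exact: (measurableT_comp (fine_measurable measurableT) mF).
apply/integrableP; split; first exact/measurable_EFinP.
have /integrableP[_] := H; apply: le_lt_trans; apply: ge0_le_integral => //.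
- by apply: measurableT_comp => //; exact/measurable_EFinP.
- exact: measurableT_comp.
- by move=> x _ /=; rewrite /Rintegral /fubini_F; case: integral => //= ; rewrite ?normr0 ?leey.
Qed.

(** The real and the extended inner integrals differ only at the slices where the latter is
    infinite, and these form a null set. *)
Lemma Rintegral_fubini1 F : L1 (m1 \x m2)%E F ->
  \int[(m1 \x m2)%E]_z F z = \int[m1]_x \int[m2]_y F (x, y).
Proof.
move=> lF; congr fine; rewrite -(integral12_prod_meas1 lF).
have H := integrable_fubini_F lF.
apply: ae_eq_integral => //.
- exact: measurable_int H.
- exact/measurable_EFinP/L1_measurable/L1_fubini1.
- have := integrable_ae measurableT H; apply: filterS => x /(_ I) Hx _.
  by rewrite /Rintegral fineK.
Qed.

Lemma L1_swap F : L1 (m1 \x m2)%E F -> L1 (m2 \x m1)%E (fun z => F (z.2, z.1)).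
Proof.
move=> lF; have mF := L1_measurable lF.
apply/integrable12ltyP => /=.
  apply/measurable_EFinP; apply: (measurableT_comp mF); exact: measurable_swap.
have mF' : measurable_fun setT (EFin \o F) by exact/measurable_EFinP.
exact: ((@integrable21ltyP _ _ _ _ _ m1 m2 _ mF').1 lF).
Qed.

End Fubini.

Section Fubini2.
Context d1 d2 (T1 : measurableType d1) (T2 : measurableType d2) (R : realType).
Variables (m1 : {sigma_finite_measure set T1 -> \bar R})
          (m2 : {sigma_finite_measure set T2 -> \bar R}).
Implicit Types F : T1 * T2 -> R.

Lemma L1_fubini2 F : L1 (m1 \x m2)%E F -> L1 m2 (fun y => \int[m1]_x F (x, y)).
Proof. by move=> /L1_swap; exact: L1_fubini1. Qed.

Lemma Rintegral_fubini2 F : L1 (m1 \x m2)%E F ->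
  \int[(m1 \x m2)%E]_z F z = \int[m2]_y \int[m1]_x F (x, y).
Proof.
move=> lF; congr fine; rewrite -(integral21_prod_meas1 lF).
have H := integrable_fubini_F (L1_swap lF).
apply: ae_eq_integral => //.
- exact: measurable_int H.
- exact/measurable_EFinP/L1_measurable/L1_fubini2.
- have := integrable_ae measurableT H; apply: filterS => x /(_ I) Hx _.
  by rewrite /Rintegral fineK.
Qed.

Lemma Rintegral_fubini F : L1 (m1 \x m2)%E F ->
  \int[m1]_x \int[m2]_y F (x, y) = \int[m2]_y \int[m1]_x F (x, y).
Proof. by move=> lF; rewrite -Rintegral_fubini1// Rintegral_fubini2. Qed.

Lemma Rintegral_prod (f : T1 -> R) (g : T2 -> R) : L1 m1 f -> L1 m2 g ->
  \int[(m1 \x m2)%E]_z (f z.1 * g z.2) = (\int[m1]_x f x) * (\int[m2]_y g y).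
Proof.
move=> lf lg; rewrite Rintegral_fubini1/=; last exact: L1_prod.
rewrite -RintegralZr//.
by apply: eq_Rintegral => x _; rewrite RintegralZl.
Qed.

End Fubini2.

(** * The Poisson kernel on the line *)

Section one_dim.
Context {R : realType}.
Local Notation lam := (@lebesgue_measure R).
Implicit Types f F : R -> R.

Lemma itv_NN_cover : \bigcup_n `[- n%:R, n%:R]%classic = [set: R].
Proof.
apply/seteqP; split => // x _; exists (Num.truncn `|x|).+1 => //=.
rewrite in_itv/= -ler_norml; apply/ltW/truncnS_gt.
Qed.

Lemma oppn_le_natr n : - n%:R <= n%:R :> R.
Proof. by rewrite (@le_trans _ _ 0)// oppr_le0. Qed.

(** Monotone convergence along the intervals [-n, n]; [I n] is meant to be the value given there by
    an antiderivative. *)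
Lemma L1_ge0_limit f (I : nat -> R) (l : R) :
  measurable_fun setT f -> (forall x, 0 <= f x) ->
  (forall n, \int[lam]_(x in `[- n%:R, n%:R]) f x <= I n) ->
  (forall n, lam.-integrable `[- n%:R, n%:R] (EFin \o f)) ->
  (forall n, I n <= l) -> L1 lam f.
Proof.
move=> mf f0 fI lf Il; apply/integrableP; split; first exact/measurable_EFinP.
under eq_integral do rewrite /= ger0_norm//.
rewrite -itv_NN_cover.
pose S (i : nat) : set R := `[- i%:R, i%:R]%classic.
have H : (\int[lam]_(x in S i) (f x)%:E @[i --> \oo] -->
    \int[lam]_(x in \bigcup_i S i) (f x)%:E)%E.
  apply: ge0_nondecreasing_set_cvg_integral => //.
  - apply/nondecreasing_seqP => n; apply/subsetPset => x /=.
    rewrite /S /= !in_itv/= => /andP[nx xn]; rewrite (le_trans _ nx) ?lerN2 ?(le_trans xn)//;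
    by rewrite ler_nat.
  - by move=> i; exact: measurable_itv.
  - by move=> i; apply/measurable_EFinP; exact: measurable_funTS.
  - by move=> i x _; rewrite lee_fin.
apply: (@le_lt_trans _ _ l%:E); last exact: ltry.
have -> := esym (cvg_lim (@ereal_hausdorff _) H).
apply: lime_le; first by apply/cvg_ex; eexists; exact: H.
apply: nearW => n.
have /fineK <- : (\int[lam]_(x in S n) (f x)%:E)%E \is a fin_num.
  by apply: integrable_fin_num (lf n); exact: measurable_itv.
by rewrite lee_fin (le_trans (fI n)).
Qed.

Lemma Rintegral_limit f : L1 lam f ->
  \int[lam]_(x in `[- n%:R, n%:R]) f x @[n --> \oo] --> \int[lam]_x f x.
Proof.
move=> lf; have mf := L1_measurable lf.
under eq_fun do rewrite Rintegral_mkcond.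
apply: (@dominated_cvg_Rintegral _ _ _ lam (fun n : nat => f \_ `[- (n%:R : R), n%:R]) f (fun x => `|f x|)).
- move=> n; apply/(measurable_restrictT f) => //; exact: (@measurable_funTS _ _ (measurableTypeR R) R).
- exact: L1_measurable lf.
- apply/nearW => x; apply: cvg_near_cst.
  exists (Num.truncn `|x|).+1 => // n/= xn; rewrite patchE mem_set//= in_itv/= -ler_norml.
  by apply/ltW/(lt_le_trans (truncnS_gt _)); rewrite ler_nat.
- exact: L1_norm.
- by move=> n x; rewrite patchE; case: ifP; rewrite ?normr0.
Qed.

Lemma is_derive_continuous f (f' : R -> R) :
  (forall x : R, is_derive x 1 f (f' x)) -> continuous f.
Proof.
move=> df x; apply/differentiable_continuous/derivable1_diffP.
by have [] := df x.
Qed.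

Lemma continuous_integrable_itv f a b : continuous f ->
  lam.-integrable `[a, b] (EFin \o f).
Proof.
move=> cf; apply: continuous_compact_integrable; first exact: segment_compact.
exact: continuous_subspaceT.
Qed.

Lemma FTC_itv f F a b : a <= b -> continuous f ->
  (forall x : R, is_derive x 1 F (f x)) ->
  \int[lam]_(x in `[a, b]) f x = F b - F a.
Proof.
rewrite le_eqVlt => /predU1P[->|ab] cf dF.
  by rewrite set_itv1 Rintegral_set1 subrr.
have cF := is_derive_continuous dF.
rewrite /Rintegral (continuous_FTC2 (F := F) ab)//.
- exact: continuous_subspaceT.
- split; first by move=> x _; have [] := dF x.
    by apply: cvg_at_right_filter; exact: cF.
  by apply: cvg_at_left_filter; exact: cF.
- by move=> x _; rewrite derive1E; have [_ ->] := dF x.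
Qed.

(** A weight with the decay of the Poisson kernel. Being bounded and integrable, it makes integrable
    any product with an L^1 or L^2 function, and it serves as a majorant when e tends to 0. *)
Definition invsqr (x : R) := (1 + x ^+ 2)^-1.

Lemma invsqr_gt0 x : 0 < invsqr x.
Proof. by rewrite invr_gt0 ltr_wpDr// sqr_ge0. Qed.

Lemma continuous_invsqr : continuous invsqr.
Proof. exact: continuous_oneDsqrV. Qed.

Lemma L1_invsqr : L1 lam invsqr.
Proof.
apply: (@L1_ge0_limit _ (fun=> pi) pi) => //.
- exact: (continuous_measurable_fun continuous_invsqr).
- by move=> x; exact/ltW/invsqr_gt0.
- move=> n; rewrite (FTC_itv (F := atan) (oppn_le_natr n)).
  + by rewrite atanN; have := atan_ltpi2 (n%:R : R); lra.
  + exact: continuous_invsqr.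
- by move=> n; exact/continuous_integrable_itv/continuous_invsqr.
Qed.

Lemma bounded_invsqr x : `|invsqr x| <= 1.
Proof. by rewrite ger0_norm ?(ltW (invsqr_gt0 x))// invf_le1 ?lerDl ?sqr_ge0// ltr_wpDr// sqr_ge0. Qed.

(** The real part of e^{(s + i c) x + i t} / (s + i c), an antiderivative of e^{s x} cos (c x +
    t). *)
Definition expcos_prim (s c t x : R) :=
  expR (s * x) * (s * cos (c * x + t) + c * sin (c * x + t)) / (s ^+ 2 + c ^+ 2).

Lemma is_derive_expcos_prim (s c t x : R) : s != 0 ->
  is_derive x 1 (expcos_prim s c t) (expR (s * x) * cos (c * x + t)).
Proof.
move=> s0.
have d0 : s ^+ 2 + c ^+ 2 != 0.
  by rewrite gt_eqF// ltr_wpDr ?sqr_ge0// exprn_even_gt0.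
have -> : expcos_prim s c t = (s ^+ 2 + c ^+ 2)^-1 \*:
  ((fun x => expR (s * x)) \* (s \*: (fun x => cos (c * x + t)) \+
                               c \*: (fun x => sin (c * x + t)))).
  by apply/funext => y; rewrite /expcos_prim /= /GRing.scale/= mulrC.
have dlin (a b : R) : is_derive x 1 (fun x => a * x + b) a.
  have -> : (fun x => a * x + b) = a \*: id \+ cst b by apply/funext.
  by apply: is_derive_eq; rewrite addr0 /GRing.scale/= mulr1.
have dlin0 (a : R) : is_derive x 1 (fun x => a * x) a.
  have -> : (fun x => a * x) = a \*: id by apply/funext.
  by apply: is_derive_eq; rewrite /GRing.scale/= mulr1.
have de : is_derive x 1 (fun x => expR (s * x)) (expR (s * x) * s).
  exact: (@is_derive1_comp _ expR (fun x => s * x)).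
have dc : is_derive x 1 (fun x => cos (c * x + t)) (- sin (c * x + t) * c).
  exact: (@is_derive1_comp _ cos (fun x => c * x + t)).
have ds : is_derive x 1 (fun x => sin (c * x + t)) (cos (c * x + t) * c).
  exact: (@is_derive1_comp _ sin (fun x => c * x + t)).
apply: is_derive_eq; rewrite /GRing.scale/= /GRing.scale/=; field.
exact: d0.
Qed.

Lemma continuous_expcos (s c t : R) :
  continuous (fun x : R => expR (s * x) * cos (c * x + t)).
Proof.
move=> x; apply: cvgM.
  apply: continuous_comp; last exact: continuous_expR.
  by apply: cvgM; [exact: cvg_cst|exact: cvg_id].
apply: continuous_comp; last exact: continuous_cos.
by apply: cvgD; [apply: cvgM; [exact: cvg_cst|exact: cvg_id]|exact: cvg_cst].
Qed.

Lemma Rintegral_expcos (s c t a b : R) : s != 0 -> a <= b ->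
  \int[lam]_(x in `[a, b]) (expR (s * x) * cos (c * x + t)) =
  expcos_prim s c t b - expcos_prim s c t a.
Proof.
move=> s0 ab; apply: FTC_itv => //; first exact: continuous_expcos.
by move=> x; exact: is_derive_expcos_prim.
Qed.

Definition expabs (e x : R) := expR (- (e * `|x|)).

Lemma expabs_ge0 e x : 0 <= expabs e x. Proof. exact: expR_ge0. Qed.

Lemma expabs_le1 e x : 0 < e -> expabs e x <= 1.
Proof. by move=> e0; rewrite -expR0 ler_expR oppr_le0 mulr_ge0// ltW. Qed.

Lemma continuous_expabs e : continuous (expabs e).
Proof.
move=> x; apply: continuous_comp; last exact: continuous_expR.
by apply: cvgN; apply: cvgM; [exact: cvg_cst|exact: cvg_norm].
Qed.

Lemma continuous_expabs_cos (e c t : R) :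
  continuous (fun x => expabs e x * cos (c * x + t)).
Proof.
move=> x; apply: cvgM; first exact: continuous_expabs.
apply: continuous_comp; last exact: continuous_cos.
by apply: cvgD; [apply: cvgM; [exact: cvg_cst|exact: cvg_id]|exact: cvg_cst].
Qed.

Lemma Rintegral_expabs_cos_itv (e c t : R) (n : nat) : 0 < e ->
  \int[lam]_(x in `[- n%:R, n%:R]) (expabs e x * cos (c * x + t)) =
  (expcos_prim e c t 0 - expcos_prim e c t (- n%:R)) +
  (expcos_prim (- e) c t n%:R - expcos_prim (- e) c t 0).
Proof.
move=> e0.
have ci a b := continuous_integrable_itv a b (@continuous_expabs_cos e c t).
have n0 : 0 <= n%:R :> R by [].
have Nn0 : - n%:R <= 0 :> R by rewrite oppr_le0.
have /= := @Rintegral_itvB R _ (BLeft (- n%:R)) (BRight n%:R) 0 (ci _ _).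
rewrite !bnd_simp => /(_ Nn0 n0) /eqP.
rewrite Rintegral_itv_obnd_cbnd; last first.
  by apply: integrableS (ci 0 n%:R) => //; apply: subset_itvr; rewrite bnd_simp.
rewrite subr_eq addrC => /eqP ->.
have e1 : e != 0 by exact: lt0r_neq0.
have e2 : - e != 0 by rewrite oppr_eq0.
rewrite -(Rintegral_expcos c t e1 Nn0) -(Rintegral_expcos c t e2 n0); congr (_ + _).
- apply: eq_Rintegral => x; rewrite inE/= in_itv/= => /andP[_ x0].
  by rewrite /expabs ler0_norm// mulrN opprK.
- apply: eq_Rintegral => x; rewrite inE/= in_itv/= => /andP[x0 _].
  by rewrite /expabs ger0_norm// mulNr.
Qed.

Lemma cvg_expRN (e : R) : 0 < e -> expR (- (e * n%:R)) @[n --> \oo] --> (0 : R).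
Proof.
move=> e0; have : (expR (- e)) ^+ n @[n --> \oo] --> (0 : R).
  by apply: cvg_expr; rewrite ger0_norm ?expR_ge0// -expR0 ltr_expR oppr_lt0.
by under eq_cvg do rewrite -expRM_natr mulNr.
Qed.

Lemma cvg_expcos_prim (s c t : R) (x : nat -> R) : s != 0 ->
  expR (s * x n) @[n --> \oo] --> (0 : R) ->
  expcos_prim s c t (x n) @[n --> \oo] --> (0 : R).
Proof.
move=> s0 ex; apply/norm_cvg0P.
apply: (@squeeze_cvgr _ _ _ _ (fun=> 0)
  (fun n => expR (s * x n) * ((`|s| + `|c|) / (s ^+ 2 + c ^+ 2)))).
- apply: nearW => n; rewrite normr_ge0/= /expcos_prim !normrM -!mulrA.
  rewrite ger0_norm ?expR_ge0// ler_wpM2l ?expR_ge0// normfV.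
  rewrite [`|s ^+ 2 + _|]ger0_norm ?addr_ge0 ?sqr_ge0// ler_wpM2r ?invr_ge0 ?addr_ge0 ?sqr_ge0//.
  apply: le_trans (ler_normD _ _) _; rewrite !normrM.
  by apply: lerD; rewrite ler_piMr// ?cos_max ?sin_max.
- exact: cvg_cst.
- by rewrite -(mul0r ((`|s| + `|c|) / (s ^+ 2 + c ^+ 2))); apply: cvgM => //; exact: cvg_cst.
Qed.

Lemma L1_expabs (e : R) : 0 < e -> L1 lam (expabs e).
Proof.
move=> e0; apply: (@L1_ge0_limit _ (fun n => (expcos_prim e 0 0 0 - expcos_prim e 0 0 (- n%:R)) +
  (expcos_prim (- e) 0 0 n%:R - expcos_prim (- e) 0 0 0)) (2 / e)) => //.
- exact: (continuous_measurable_fun (@continuous_expabs e)).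
- by move=> x; exact: expabs_ge0.
- move=> n.
  have -> : \int[lam]_(x in `[- n%:R, n%:R]) expabs e x =
      \int[lam]_(x in `[- n%:R, n%:R]) (expabs e x * cos (0 * x + 0)).
    by apply: eq_Rintegral => x _; rewrite mul0r addr0 cos0 mulr1.
  by rewrite Rintegral_expabs_cos_itv.
- by move=> n; exact: (continuous_integrable_itv _ _ (@continuous_expabs e)).
- move=> n; rewrite /expcos_prim !mul0r !addr0 cos0 !mulr0 expR0 !mulr1 expr0n/= !addr0.
  rewrite !mul1r !mulrN !mulNr sqrrN.
  have := expR_ge0 (- (e * n%:R)); set E := expR _ => E0.
  have -> : e / e ^+ 2 = e^-1 by field; rewrite gt_eqF.
  have -> : E * e / e ^+ 2 = E / e by field; rewrite gt_eqF.
  have : 0 <= E / e by rewrite divr_ge0// ltW.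
  by lra.
Qed.

(** The transform of [expabs e], that is, the Poisson kernel of the half-plane at height e / (2
    pi). *)
Definition poisson (e x : R) := 2 * e / (e ^+ 2 + (2 * pi * x) ^+ 2).

(** The boundary terms at n and - n decay, and only the values at 0 of the antiderivatives of rates
    e and - e remain; there the terms in sin t cancel. The free phase t covers cosine and sine
    transforms at once. *)
Lemma Rintegral_expabs_cos (e c t : R) : 0 < e ->
  \int[lam]_x (expabs e x * cos (c * x + t)) = cos t * (2 * e / (e ^+ 2 + c ^+ 2)).
Proof.
move=> e0.
have mc : measurable_fun [set: R] (fun x => cos (c * x + t)).
  apply: continuous_measurable_fun => x; apply: continuous_comp; last exact: continuous_cos.
  by apply: cvgD; [apply: cvgM; [exact: cvg_cst|exact: cvg_id]|exact: cvg_cst].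
have li : L1 lam (fun x => expabs e x * cos (c * x + t)).
  apply: (L1_bounded (C := 1) (L1_expabs e0)) => // x; exact: cos_max.
have /cvg_lim <- // := Rintegral_limit li.
apply/cvg_lim => //.
under eq_cvg do rewrite Rintegral_expabs_cos_itv//.
have h1 : expcos_prim e c t (- n%:R) @[n --> \oo] --> (0 : R).
  apply: (@cvg_expcos_prim _ _ _ (fun n => - n%:R)); first by rewrite gt_eqF.
  by under eq_cvg do rewrite mulrN; exact: cvg_expRN.
have h2 : expcos_prim (- e) c t n%:R @[n --> \oo] --> (0 : R).
  apply: (@cvg_expcos_prim _ _ _ (fun n => n%:R)); first by rewrite oppr_eq0 gt_eqF.
  by under eq_cvg do rewrite mulNr; exact: cvg_expRN.
rewrite (_ : cos t * _ = (expcos_prim e c t 0 - 0) + (0 - expcos_prim (- e) c t 0)).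
  by apply: cvgD; apply: cvgB => //; exact: cvg_cst.
rewrite /expcos_prim !mulr0 !add0r expR0; field.
by rewrite sqrrN gt_eqF// ltr_wpDr ?sqr_ge0// exprn_gt0.
Qed.

Lemma poisson_ge0 e x : 0 < e -> 0 <= poisson e x.
Proof.
by move=> e0; rewrite divr_ge0 ?mulr_ge0 ?addr_ge0 ?sqr_ge0// ltW.
Qed.

Lemma poisson_transform (e x t : R) : 0 < e ->
  \int[lam]_s (expabs e s * cos (2 * pi * x * s + t)) = cos t * poisson e x.
Proof. exact: Rintegral_expabs_cos. Qed.

Lemma is_derive_poisson (e x : R) : 0 < e ->
  is_derive x 1 (fun x => atan (2 * pi / e * x) / pi) (poisson e x).
Proof.
move=> e0.
have -> : (fun x => atan (2 * pi / e * x) / pi) =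
    pi^-1 \*: (fun x : R => atan (2 * pi / e * x)).
  by apply/funext => y; rewrite /GRing.scale/= mulrC.
have dlin0 (a : R) : is_derive x 1 (fun x => a * x) a.
  have -> : (fun x => a * x) = a \*: id by apply/funext.
  by apply: is_derive_eq; rewrite /GRing.scale/= mulr1.
have da := @is_derive1_comp _ atan (fun x => 2 * pi / e * x) x _ _ (is_derive1_atan _) (dlin0 _).
apply: is_derive_eq; rewrite /GRing.scale/= /poisson.
move: (@pi_gt0 R); generalize (@pi R) => p p0; field.
have h : e ^+ 2 + (2 * p * x) ^+ 2 != 0.
  by rewrite gt_eqF// ltr_wpDr ?sqr_ge0// exprn_gt0.
by rewrite h !gt_eqF.
Qed.

Lemma continuous_poisson (e : R) : 0 < e -> continuous (poisson e).
Proof.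
move=> e0 x; apply: cvgM; first exact: cvg_cst.
apply: cvgV; first by rewrite gt_eqF// ltr_wpDr ?sqr_ge0// exprn_gt0.
apply: cvgD; first exact: cvg_cst.
by apply: cvgM; (apply: cvgM; [exact: cvg_cst|exact: cvg_id]).
Qed.

Lemma continuous_poisson_sub (e x : R) : 0 < e ->
  continuous (fun y : R => poisson e (x - y)).
Proof.
move=> e0 y.
apply: (@continuous_comp _ _ _ (fun y : R => x - y) (poisson e)).
  by apply: cvgB; [exact: cvg_cst|exact: cvg_id].
exact: continuous_poisson.
Qed.

Lemma L1_poisson (e : R) : 0 < e -> L1 lam (poisson e).
Proof.
move=> e0; have cp := continuous_poisson e0.
apply: (@L1_ge0_limit _ (fun=> 1) 1) => //.
- exact: (continuous_measurable_fun cp).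
- by move=> x; exact: poisson_ge0.
- move=> n; rewrite (FTC_itv (oppn_le_natr n) cp (fun x => is_derive_poisson x e0)).
  rewrite mulrN atanN mulNr opprK -mulrDl ler_pdivrMr ?pi_gt0// mul1r.
  by have := atan_ltpi2 (2 * pi / e * n%:R); lra.
- by move=> n; exact: continuous_integrable_itv.
Qed.

Lemma cvgy_scale (c : R) : 0 < c -> c * n%:R @[n --> \oo] --> +oo.
Proof.
move=> c0; apply/cvgryPge => A; exists (Num.truncn `|A / c|).+1 => // n/= An.
rewrite mulrC -ler_pdivrMr//; apply/ltW/(le_lt_trans (ler_norm _)).
by apply: lt_le_trans (truncnS_gt _) _; rewrite ler_nat.
Qed.

Lemma cvg_atan_scale (c : R) : 0 < c -> atan (c * n%:R) @[n --> \oo] --> (pi / 2 : R).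
Proof. by move=> c0; apply: (cvg_comp _ _ (cvgy_scale c0)); exact: cvgy_atan. Qed.

Lemma Rintegral_poisson (e : R) : 0 < e -> \int[lam]_x poisson e x = 1.
Proof.
move=> e0; have cp := continuous_poisson e0.
have /cvg_lim <- // := Rintegral_limit (L1_poisson e0).
apply/cvg_lim => //.
rewrite [X in _ --> X](_ : 1 = (pi / 2 + pi / 2) / pi); last first.
  by move: (@pi_gt0 R); generalize (@pi R) => p p0; field; rewrite gt_eqF.
have H := @cvg_atan_scale (2 * pi / e).
under eq_cvg do rewrite (FTC_itv (oppn_le_natr _) cp (fun x => is_derive_poisson x e0))
  mulrN atanN mulNr opprK -mulrDl.
apply: cvgM; last exact: cvg_cst.
by apply: cvgD; apply: H; rewrite divr_gt0 ?mulr_gt0 ?pi_gt0.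
Qed.

(** The Poisson integral of the indicator of [a, b]: the angle, divided by pi, under which the
    interval is seen from height e / (2 pi) above x. *)
Definition poisson_itv (e a b x : R) :=
  (atan (2 * pi / e * (x - a)) - atan (2 * pi / e * (x - b))) / pi.

Lemma poisson_itvE (e a b x : R) : 0 < e -> a <= b ->
  \int[lam]_(y in `[a, b]) poisson e (x - y) = poisson_itv e a b x.
Proof.
move=> e0 ab; have cp := @continuous_poisson_sub e x e0.
transitivity (- (atan (2 * pi / e * (x - b)) / pi) -
              - (atan (2 * pi / e * (x - a)) / pi)); last first.
  by rewrite /poisson_itv; ring.
apply: (@FTC_itv (fun y => poisson e (x - y)) (fun y => - (atan (2 * pi / e * (x - y)) / pi))) => //.
move=> y.
  have dl : is_derive y 1 (fun y : R => x - y) (-1).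
    have -> : (fun y : R => x - y) = cst x \- id by apply/funext.
    by apply: is_derive_eq; rewrite sub0r.
  have := @is_derive1_comp _ (fun x => atan (2 * pi / e * x) / pi) (fun y => x - y)
    y _ _ (is_derive_poisson (x - y) e0) dl.
  move=> /is_deriveN; rewrite mulrN1 opprK; exact.
Qed.

Lemma poisson_itv_ge0 e a b x : 0 < e -> a <= b -> 0 <= poisson_itv e a b x.
Proof.
move=> e0 ab; rewrite -poisson_itvE//.
by apply: Rintegral_ge0 => y _; exact: poisson_ge0.
Qed.

Lemma poisson_itv_le1 e a b x : poisson_itv e a b x <= 1.
Proof.
rewrite /poisson_itv ler_pdivrMr ?pi_gt0// mul1r.
have := atan_ltpi2 (2 * pi / e * (x - a)).
by have := atan_gtNpi2 (2 * pi / e * (x - b)); lra.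
Qed.

(** For y in [a, b], 1 + x^2 is at most 2 (1 + m^2) (1 + (x - y)^2), and for e <= 1 the kernel times
    (x - y)^2 is at most 1; integrating over y gives the bound. Its uniformity in e is what
    dominated convergence requires. *)
Lemma poisson_itv_le (e a b x : R) : 0 < e <= 1 -> a <= b ->
  poisson_itv e a b x <=
  2 * (1 + (`|a| + `|b|) ^+ 2) * (1 + (b - a)) * invsqr x.
Proof.
move=> /andP[e0 e1] ab; pose m : R := `|a| + `|b|; rewrite -/m.
have x1 : 0 < 1 + x ^+ 2 by rewrite ltr_wpDr ?sqr_ge0.
rewrite /invsqr ler_pdivlMr//.
have cp := @continuous_poisson_sub e x e0.
have lp := continuous_integrable_itv a b cp.
have m0 : 0 <= m by rewrite addr_ge0.
have p1 := poisson_itv_le1 e a b x.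
apply: (@le_trans _ _ (2 * (1 + m ^+ 2) * (poisson_itv e a b x + (b - a)))); last first.
  by rewrite ler_wpM2l ?lerD2r// mulr_ge0// addr_ge0// sqr_ge0.
have -> : b - a = \int[lam]_(y in `[a, b]) 1.
  by apply/esym; apply: (@FTC_itv (fun=> 1) id) => // y; exact: cvg_cst.
have l1 : lam.-integrable `[a, b] (EFin \o (fun=> 1)).
  by apply: continuous_integrable_itv => y; exact: cvg_cst.
have mab : measurable (`[a, b]%classic : set (measurableTypeR R)) by exact: measurable_itv.
have lD := integrableD mab lp l1.
rewrite -poisson_itvE// -RintegralD// -RintegralZl// -RintegralZr//.
apply: le_Rintegral => //.
- exact: (integrableZr mab (1 + x ^+ 2) lp).
- exact: (integrableZl mab (2 * (1 + m ^+ 2)) lD).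
move=> y /=; rewrite in_itv/= => /andP[ay yb].
set P := poisson e (x - y).
have P0 : 0 <= P by exact: poisson_ge0.
have Px : (x - y) ^+ 2 * P <= 1.
  rewrite /P /poisson mulrA ler_pdivrMr ?ltr_wpDr ?sqr_ge0 ?exprn_gt0// mul1r.
  have : (x - y) ^+ 2 <= (pi * (x - y)) ^+ 2.
    rewrite exprMn ler_peMl ?sqr_ge0// exprn_ege1// (le_trans _ (pi_ge2 R))//; lra.
  have := sqr_ge0 (x - y); rewrite -mulrA [(2 * _) ^+ 2]exprMn.
  by set A := (x - y) ^+ 2; set B := (pi * _) ^+ 2; nra.
have ym : y ^+ 2 <= m ^+ 2.
  rewrite -(real_normK (num_real y)) ler_pXn2r ?nnegrE// /m ler_norml; apply/andP; split.
    by have := normr_ge0 b; have := ler_norm (- a); rewrite normrN; lra.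
  by have := normr_ge0 a; have := ler_norm b; lra.
have xy : 1 + x ^+ 2 <= 2 * (1 + y ^+ 2) * (1 + (x - y) ^+ 2).
  have -> : x ^+ 2 = ((x - y) + y) ^+ 2 by rewrite subrK.
  set u := x - y; nra.
apply: (@le_trans _ _ (P * (2 * (1 + m ^+ 2) * (1 + (x - y) ^+ 2)))).
  rewrite ler_wpM2l// (le_trans xy)// ler_wpM2r ?addr_ge0 ?sqr_ge0//.
  by rewrite ler_wpM2l// lerD2l.
rewrite mulrCA ler_wpM2l ?mulr_ge0 ?addr_ge0 ?sqr_ge0//.
by rewrite mulrDr mulr1 lerD2l mulrC.
Qed.

(** The inequalities are strict because at an endpoint of a nondegenerate interval the limit is
    1/2. *)
Lemma cvg_poisson_itv_in (a b x : R) : a < x < b ->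
  poisson_itv n.+1%:R^-1 a b x @[n --> \oo] --> (1 : R).
Proof.
move=> /andP[ax xb].
rewrite [X in _ --> X](_ : 1 = (pi / 2 - (- (pi / 2))) / pi :> R); last first.
  by move: (@pi_gt0 R); generalize (@pi R) => p p0; field; rewrite gt_eqF.
apply: cvgM; last exact: cvg_cst.
have H c : 0 < c -> atan (c * n.+1%:R) @[n --> \oo] --> (pi / 2 : R).
  by move=> c0; have := cvg_atan_scale c0; rewrite -(cvg_shiftS (fun n => atan (c * n%:R))).
apply: cvgB.
  under eq_cvg do rewrite invrK mulrAC.
  by apply: H; rewrite !mulr_gt0 ?pi_gt0// subr_gt0.
under eq_cvg do rewrite -[x - b]opprB mulrN atanN invrK mulrAC.
by apply: cvgN; apply: H; rewrite !mulr_gt0 ?pi_gt0// subr_gt0.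
Qed.

Lemma cvg_poisson_itv_out (a b x : R) : a <= b -> x < a \/ b < x ->
  poisson_itv n.+1%:R^-1 a b x @[n --> \oo] --> (0 : R).
Proof.
move=> ab xab.
have H c : 0 < c -> atan (c * n.+1%:R) @[n --> \oo] --> (pi / 2 : R).
  by move=> c0; have := cvg_atan_scale c0; rewrite -(cvg_shiftS (fun n => atan (c * n%:R))).
case: xab => [xa|bx].
  rewrite [X in _ --> X](_ : 0 = (- (pi / 2) - (- (pi / 2))) / pi :> R); last by rewrite subrr mul0r.
  apply: cvgM; last exact: cvg_cst.
  apply: cvgB.
    under eq_cvg do rewrite -[x - a]opprB mulrN atanN invrK mulrAC.
    by apply: cvgN; apply: H; rewrite !mulr_gt0 ?pi_gt0// subr_gt0.
  under eq_cvg do rewrite -[x - b]opprB mulrN atanN invrK mulrAC.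
  by apply: cvgN; apply: H; rewrite !mulr_gt0 ?pi_gt0// subr_gt0 (lt_le_trans xa).
rewrite [X in _ --> X](_ : 0 = (pi / 2 - pi / 2) / pi :> R); last by rewrite subrr mul0r.
apply: cvgM; last exact: cvg_cst.
apply: cvgB.
  under eq_cvg do rewrite invrK mulrAC.
  by apply: H; rewrite !mulr_gt0 ?pi_gt0// subr_gt0 (le_lt_trans ab).
under eq_cvg do rewrite invrK mulrAC.
by apply: H; rewrite !mulr_gt0 ?pi_gt0// subr_gt0.
Qed.

End one_dim.

(** * Integration on R^n *)

Section cV_integral.
Context {R : realType}.
Local Notation lam := (@lebesgue_measure R).
Local Notation mu := (@lebesgue_cV R).
Implicit Types n : nat.

Lemma ge0_integral_cV_cons n (f : 'cV[R]_n.+1 -> \bar R) :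
  measurable_fun setT f -> (forall x, (0 <= f x)%E) ->
  (\int[mu n.+1]_x f x = \int[lam \x mu n]_z f (cV_cons z))%E.
Proof.
move=> mf f0.
exact: (@ge0_integral_pushforward _ _ _ _ _ _ (@measurable_cV_cons R n) _ setT f).
Qed.

Lemma L1_cV_cons n (f : 'cV[R]_n.+1 -> R) : L1 (mu n.+1) f ->
  L1 (lam \x mu n)%E (f \o @cV_cons R n).
Proof.
move=> lf; have mf := L1_measurable lf; apply/integrableP; split.
  by apply/measurable_EFinP; exact: measurableT_comp mf (@measurable_cV_cons R n).
have /integrableP[_] := lf; rewrite ge0_integral_cV_cons//.
by apply: measurableT_comp => //; exact/measurable_EFinP.
Qed.

Lemma cV_cons_L1 n (f : 'cV[R]_n.+1 -> R) : measurable_fun setT f ->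
  L1 (lam \x mu n)%E (f \o @cV_cons R n) -> L1 (mu n.+1) f.
Proof.
move=> mf /integrableP[_ lf]; apply/integrableP; split; first exact/measurable_EFinP.
rewrite ge0_integral_cV_cons//.
by apply: measurableT_comp => //; exact/measurable_EFinP.
Qed.

Lemma Rintegral_cV_cons n (f : 'cV[R]_n.+1 -> R) : L1 (mu n.+1) f ->
  \int[mu n.+1]_x f x = \int[(lam \x mu n)%E]_z f (cV_cons z).
Proof.
move=> lf; congr fine.
apply: (@integral_pushforward _ _ _ _ _ _ (@measurable_cV_cons R n) _ setT (EFin \o f)) => //.
  by apply/measurable_EFinP; exact: L1_measurable lf.
exact: L1_cV_cons.
Qed.

Lemma L1_cV0 (f : 'cV[R]_0 -> R) : measurable_fun setT f -> L1 (mu 0) f.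
Proof.
move=> mf; apply/integrableP; split; first exact/measurable_EFinP.
rewrite integral_dirac//; last by apply: measurableT_comp => //; exact/measurable_EFinP.
by rewrite diracT mul1e ltry.
Qed.

Lemma Rintegral_cV0 (f : 'cV[R]_0 -> R) : measurable_fun setT f ->
  \int[mu 0]_x f x = f 0.
Proof.
move=> mf; rewrite /Rintegral integral_dirac//; last exact/measurable_EFinP.
by rewrite diracT mul1e.
Qed.

Lemma Rintegral_cV_fubini n (f : 'cV[R]_n.+1 -> R) : L1 (mu n.+1) f ->
  \int[mu n.+1]_x f x = \int[lam]_t \int[mu n]_x f (cV_cons (t, x)).
Proof.
move=> lf; rewrite Rintegral_cV_cons// Rintegral_fubini1//.
exact: L1_cV_cons.
Qed.

Definition tensor n (f : 'I_n -> R -> R) (x : 'cV[R]_n) : R :=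
  \prod_i f i (x i ord0).

Lemma tensor_cons n (f : 'I_n.+1 -> R -> R) z :
  tensor f (cV_cons z) = f ord0 z.1 * tensor (fun i => f (lift ord0 i)) z.2.
Proof.
rewrite /tensor big_ord_recl cV_consE0; congr (_ * _).
by apply: eq_bigr => i _; rewrite cV_consES.
Qed.

Lemma measurable_tensor n (f : 'I_n -> R -> R) :
  (forall i, measurable_fun setT (f i)) -> measurable_fun setT (tensor f).
Proof.
move=> mf; rewrite /tensor; apply: measurable_prod => i _.
exact: (measurableT_comp (mf i) (measurable_cV_coord i)).
Qed.

Lemma L1_tensor n (f : 'I_n -> R -> R) :
  (forall i, L1 lam (f i)) -> L1 (mu n) (tensor f).
Proof.
elim: n f => [|n ih] f lf.
  by apply: L1_cV0; apply: measurable_tensor => -[].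
apply: cV_cons_L1; first by apply: measurable_tensor => i; exact: (L1_measurable (lf i)).
apply: (eq_L1 _ (L1_prod (lf ord0) (ih _ (fun i => lf (lift ord0 i))))) => z.
by rewrite /= tensor_cons.
Qed.

Lemma Rintegral_tensor n (f : 'I_n -> R -> R) : (forall i, L1 lam (f i)) ->
  \int[mu n]_x tensor f x = \prod_i \int[lam]_t f i t.
Proof.
elim: n f => [|n ih] f lf.
  rewrite Rintegral_cV0 ?/tensor ?big_ord0//.
  by apply: measurable_tensor => -[].
rewrite Rintegral_cV_cons; last exact: L1_tensor.
under eq_Rintegral do rewrite tensor_cons.
rewrite Rintegral_prod ?big_ord_recl ?ih//.
by apply: L1_tensor => i; exact: lf.
Qed.

Lemma tensor_ge0 n (f : 'I_n -> R -> R) x :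
  (forall i t, 0 <= f i t) -> 0 <= tensor f x.
Proof. by move=> f0; apply: prodr_ge0 => i _. Qed.

Lemma tensor_le1 n (f : 'I_n -> R -> R) x :
  (forall i t, 0 <= f i t <= 1) -> tensor f x <= 1.
Proof.
move=> fg; have : tensor f x <= \prod_(i < n) 1 by apply: ler_prod => i _; exact: fg.
by rewrite big1.
Qed.

Lemma tensorM n (f g : 'I_n -> R -> R) x :
  tensor (fun i t => f i t * g i t) x = tensor f x * tensor g x.
Proof. by rewrite /tensor big_split. Qed.

End cV_integral.

Section dot.
Context {R : realType}.
Implicit Types n : nat.
Local Notation mu := (@lebesgue_cV R).
Local Notation lam := (@lebesgue_measure R).

Lemma dot_cV_cons n (s t : R) (x y : 'cV[R]_n) :
  dot_cV (cV_cons (s, x)) (cV_cons (t, y)) = s * t + dot_cV x y.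
Proof.
rewrite /dot_cV big_ord_recl !cV_consE0; congr (_ + _).
by apply: eq_bigr => i _; rewrite !cV_consES.
Qed.

Lemma dot_cVC n (x y : 'cV[R]_n) : dot_cV x y = dot_cV y x.
Proof. by apply: eq_bigr => i _; rewrite mulrC. Qed.

Lemma dot_cVDl n (x y z : 'cV[R]_n) : dot_cV (x + y) z = dot_cV x z + dot_cV y z.
Proof. by rewrite /dot_cV -big_split/=; apply: eq_bigr => i _; rewrite mxE mulrDl. Qed.

Lemma dot_cVDr n (x y z : 'cV[R]_n) : dot_cV z (x + y) = dot_cV z x + dot_cV z y.
Proof. by rewrite dot_cVC dot_cVDl !(dot_cVC z). Qed.

Lemma dot_cVNl n (x z : 'cV[R]_n) : dot_cV (- x) z = - dot_cV x z.
Proof. by rewrite /dot_cV -sumrN; apply: eq_bigr => i _; rewrite mxE mulNr. Qed.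

Lemma dot_cVBl n (x y z : 'cV[R]_n) : dot_cV (x - y) z = dot_cV x z - dot_cV y z.
Proof. by rewrite dot_cVDl dot_cVNl. Qed.

Lemma dot_cVZl n (c : R) (x z : 'cV[R]_n) : dot_cV (c *: x) z = c * dot_cV x z.
Proof. by rewrite /dot_cV mulr_sumr; apply: eq_bigr => i _; rewrite mxE mulrA. Qed.

Lemma measurable_dot n d (T : measurableType d) (f g : T -> 'cV[R]_n) :
  measurable_fun setT f -> measurable_fun setT g ->
  measurable_fun setT (fun x => dot_cV (f x) (g x)).
Proof.
move=> mf mg; apply: measurable_sum => i; apply: measurable_funM.
  exact: (measurableT_comp (measurable_cV_coord i) mf).
exact: (measurableT_comp (measurable_cV_coord i) mg).
Qed.

Lemma measurable_cVD n d (T : measurableType d) (f g : T -> 'cV[R]_n) :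
  measurable_fun setT f -> measurable_fun setT g ->
  measurable_fun setT (fun x => f x + g x).
Proof.
move=> mf mg; apply: measurable_fun_cV => i.
under eq_fun do rewrite mxE.
apply: measurable_funD.
  exact: (measurableT_comp (measurable_cV_coord i) mf).
exact: (measurableT_comp (measurable_cV_coord i) mg).
Qed.

Lemma measurable_cVN n d (T : measurableType d) (f : T -> 'cV[R]_n) :
  measurable_fun setT f -> measurable_fun setT (fun x => - f x).
Proof.
move=> mf; apply: measurable_fun_cV => i.
under eq_fun do rewrite mxE.
apply: measurableT_comp => //.
exact: (measurableT_comp (measurable_cV_coord i) mf).
Qed.

Lemma measurable_cVB n d (T : measurableType d) (f g : T -> 'cV[R]_n) :
  measurable_fun setT f -> measurable_fun setT g ->
  measurable_fun setT (fun x => f x - g x).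
Proof. by move=> mf mg; apply: measurable_cVD => //; exact: measurable_cVN. Qed.

Lemma measurable_cos_comp d (T : measurableType d) (f : T -> R) :
  measurable_fun setT f -> measurable_fun setT (fun x => cos (f x)).
Proof.
move=> mf; apply: (measurableT_comp _ mf).
exact: (continuous_measurable_fun (@continuous_cos R)).
Qed.

Lemma measurable_sin_comp d (T : measurableType d) (f : T -> R) :
  measurable_fun setT f -> measurable_fun setT (fun x => sin (f x)).
Proof.
move=> mf; apply: (measurableT_comp _ mf).
exact: (continuous_measurable_fun (@continuous_sin R)).
Qed.

Definition expabs_cV n (e : R) (x : 'cV[R]_n) := tensor (fun=> expabs e) x.
Definition poisson_cV n (e : R) (x : 'cV[R]_n) := tensor (fun=> poisson e) x.

Lemma L1_expabs_cV n (e : R) : 0 < e -> L1 (mu n) (expabs_cV e).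
Proof. by move=> e0; apply: L1_tensor => i; exact: L1_expabs. Qed.

Lemma expabs_cV_ge0 n e (x : 'cV[R]_n) : 0 <= expabs_cV e x.
Proof. by apply: tensor_ge0 => i t; exact: expabs_ge0. Qed.

Lemma expabs_cV_le1 n e (x : 'cV[R]_n) : 0 < e -> expabs_cV e x <= 1.
Proof. by move=> e0; apply: tensor_le1 => i t; rewrite expabs_ge0 expabs_le1. Qed.

Lemma L1_poisson_cV n (e : R) : 0 < e -> L1 (mu n) (poisson_cV e).
Proof. by move=> e0; apply: L1_tensor => i; exact: L1_poisson. Qed.

Lemma poisson_cV_ge0 n e (x : 'cV[R]_n) : 0 < e -> 0 <= poisson_cV e x.
Proof. by move=> e0; apply: tensor_ge0 => i t; exact: poisson_ge0. Qed.

Lemma Rintegral_poisson_cV n (e : R) : 0 < e -> \int[mu n]_x poisson_cV e x = 1.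
Proof.
move=> e0; rewrite Rintegral_tensor; last by move=> i; exact: L1_poisson.
by rewrite big1// => i _; exact: Rintegral_poisson.
Qed.

(** Induction on the dimension. The phase t is general because integrating over all but one
    coordinate leaves the contribution of that coordinate inside the phase. *)
Lemma poisson_cV_transform n (e t : R) (x : 'cV[R]_n) : 0 < e ->
  \int[mu n]_s (expabs_cV e s * cos (2 * pi * dot_cV x s + t)) =
  cos t * poisson_cV e x.
Proof.
move=> e0; elim: n t x => [|n ih] t x.
  rewrite Rintegral_cV0; last first.
    apply: measurable_funM; first exact: (L1_measurable (@L1_expabs_cV 0 e e0)).
    apply: measurable_cos_comp; apply: measurable_funD => //; apply: measurable_funM => //.
    exact: measurable_dot.
  by rewrite /expabs_cV /poisson_cV /tensor /dot_cV !big_ord0 mulr0 add0r mul1r mulr1.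
have -> : x = cV_cons (cV_uncons x).
  apply/matrixP => i j; rewrite (ord1 j); have [k ->|->] := unliftP ord0 i.
    by rewrite cV_consES mxE.
  by rewrite cV_consE0.
rewrite Rintegral_cV_fubini; last first.
  apply: (L1_bounded (C := 1)); first exact: L1_expabs_cV.
    apply: measurable_cos_comp; apply: measurable_funD => //; apply: measurable_funM => //.
    exact: measurable_dot.
  by move=> y; exact: cos_max.
set u := cV_uncons x; rewrite (surjective_pairing u).
transitivity (\int[lam]_s (poisson_cV e u.2 * (expabs e s * cos (2 * pi * u.1 * s + t)))).
  apply: eq_Rintegral => s _.
  transitivity (expabs e s * \int[mu n]_y (expabs_cV e y *
      cos (2 * pi * dot_cV u.2 y + (2 * pi * u.1 * s + t)))).
    rewrite -RintegralZl//; last first.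
      apply: (L1_bounded (C := 1)); first exact: L1_expabs_cV.
        apply: measurable_cos_comp; apply: measurable_funD => //; apply: measurable_funM => //.
        exact: measurable_dot.
      by move=> y; exact: cos_max.
    apply: eq_Rintegral => y _; rewrite /expabs_cV tensor_cons dot_cV_cons/= mulrA.
    by congr (_ * cos _); ring.
  by rewrite ih; ring.
rewrite RintegralZl//; last first.
  apply: (L1_bounded (C := 1)); first exact: L1_expabs.
    by apply: measurable_cos_comp; apply: measurable_funD => //; apply: measurable_funM.
  by move=> y; exact: cos_max.
rewrite poisson_transform//= /poisson_cV tensor_cons/= -/u.
by ring.
Qed.

End dot.

(** * Invariance of the measure under y -> x - y *)

Section invariance.
Context {R : realType}.
Local Notation lam := (@lebesgue_measure R).
Local Notation mu := (@lebesgue_cV R).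

Lemma measurable_subl (c : R) :
  measurable_fun [set: measurableTypeR R] (fun s : measurableTypeR R => c - s : measurableTypeR R).
Proof. by apply: measurable_funB. Qed.

(** The image of the measure under s -> c - s agrees with it on half-open intervals, and these
    determine it. *)
Lemma ge0_integral_subl (c : R) (f : R -> \bar R) :
  measurable_fun [set: R] f -> (forall x, (0 <= f x)%E) ->
  (\int[lam]_s f (c - s)%R = \int[lam]_s f s)%E.
Proof.
move=> mf f0.
have mphi := measurable_subl c.
pose phi := fun s : measurableTypeR R => c - s : measurableTypeR R.
transitivity (\int[pushforward lam phi]_s f s)%E.
  by rewrite ge0_integral_pushforward.
pose m := measure_function_pushforward__canonical__measure_function_Measure lam mphi.
apply: (@eq_measure_integral _ _ _ _ lam m) => A mA _.
apply/esym/(@lebesgue_measure_unique _ m) => //= _ [[a b]] _ <-.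
rewrite /pushforward (_ : _ @^-1` _ = `[c - b, c - a[%classic).
  rewrite !lebesgue_measure_itv/= !lte_fin.
  by rewrite ltrD2l ltrN2; case: ifP => // _; rewrite -!EFinD; congr EFin; ring.
apply/seteqP; split => x /=; rewrite !in_itv/= => /andP[h1 h2]; apply/andP; split; lra.
Qed.

Lemma measurable_cV_subl n (x : 'cV[R]_n) :
  measurable_fun setT (fun y : 'cV[R]_n => x - y).
Proof. exact: measurable_cVB. Qed.

(** One coordinate at a time, by Tonelli. Translation and reflection are treated together because
    convolutions involve y -> x - y. *)
Lemma ge0_integral_cV_subl n (x : 'cV[R]_n) (f : 'cV[R]_n -> \bar R) :
  measurable_fun setT f -> (forall x, (0 <= f x)%E) ->
  (\int[mu n]_y f (x - y)%R = \int[mu n]_y f y)%E.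
Proof.
elim: n x f => [|n ih] x f mf f0.
  rewrite !integral_dirac//; last exact: (measurableT_comp mf (measurable_cV_subl x)).
  by congr (_ * f _)%E; apply/matrixP => -[].
have mfx : measurable_fun setT (fun y : 'cV[R]_n.+1 => f (x - y)).
  exact: (measurableT_comp mf (measurable_cV_subl x)).
have mfc : measurable_fun setT (fun z => f (cV_cons z)).
  exact: (measurableT_comp mf (@measurable_cV_cons R n)).
have mfxc : measurable_fun setT (fun z => f (x - cV_cons z)).
  exact: (measurableT_comp mfx (@measurable_cV_cons R n)).
rewrite (ge0_integral_cV_cons mfx); last by move=> y; exact: f0.
rewrite (ge0_integral_cV_cons mf f0).
rewrite (fubini_tonelli1 _ mfc); last by move=> z; exact: f0.
rewrite (fubini_tonelli1 _ mfxc); last by move=> z; exact: f0.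
pose F t := (\int[mu n]_y f (cV_cons (t, y)))%E.
transitivity (\int[lam]_s F (x ord0 ord0 - s)%R)%E; last first.
  rewrite ge0_integral_subl//; last by move=> t; exact: integral_ge0.
  by apply: (@measurable_fun_fubini_tonelli_F _ _ _ _ _ (mu n) (fun z => f (cV_cons z))).
apply: eq_integral => s _; rewrite /F /fubini_F.
rewrite -(ih (cV_uncons x).2); last 2 first.
  by apply: (measurableT_comp mfc); exact: measurable_pair1.
  by [].
apply: eq_integral => y _; congr f; apply/matrixP => i j; rewrite (ord1 j) !mxE.
by have [k ->|->] := unliftP ord0 i; rewrite //= !mxE.
Qed.

Lemma L1_cV_subl n (x : 'cV[R]_n) (f : 'cV[R]_n -> R) :
  L1 (mu n) f -> L1 (mu n) (fun y => f (x - y)).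
Proof.
move=> lf; have mf := L1_measurable lf.
apply/integrableP; split.
  by apply/measurable_EFinP; exact: (measurableT_comp mf (measurable_cV_subl x)).
have /integrableP[_] := lf; rewrite -(ge0_integral_cV_subl x)//.
by apply: measurableT_comp => //; exact/measurable_EFinP.
Qed.

Lemma L2_cV_subl n (x : 'cV[R]_n) (f : 'cV[R]_n -> R) :
  L2 (mu n) f -> L2 (mu n) (fun y => f (x - y)).
Proof.
move=> [mf lf]; split; first exact: (measurableT_comp mf (measurable_cV_subl x)).
exact: L1_cV_subl lf.
Qed.

Lemma Rintegral_cV_subl n (x : 'cV[R]_n) (f : 'cV[R]_n -> R) :
  measurable_fun setT f -> (forall y, 0 <= f y) ->
  \int[mu n]_y f (x - y) = \int[mu n]_y f y.
Proof.
move=> mf f0; congr fine.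
rewrite -(ge0_integral_cV_subl x (f := fun y => (f y)%:E))//.
exact/measurable_EFinP.
Qed.

Lemma ae_cV_subl n (x : 'cV[R]_n) (P : 'cV[R]_n -> Prop) :
  {ae mu n, forall y, P y} -> {ae mu n, forall y, P (x - y)}.
Proof.
move=> [N [mN N0 PN]].
have mN' : measurable ((fun y => x - y) @^-1` N).
  by rewrite -[X in measurable X]setTI; exact: measurable_cV_subl.
exists ((fun y => x - y) @^-1` N); split => //; last by move=> y /= /PN.
transitivity (\int[mu n]_y (\1_N (x - y)%R)%:E)%E.
  by rewrite -[X in mu n X]setIT -integral_indic.
rewrite (ge0_integral_cV_subl x (f := fun y => (\1_N y)%:E)).
- by rewrite integral_indic// setIT.
- exact/measurable_EFinP.
- by move=> y; rewrite lee_fin.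
Qed.

End invariance.

(** * Functions determined by their integrals over boxes *)

Section boxes.
Context {R : realType}.
Local Notation lam := (@lebesgue_measure R).
Local Notation mu := (@lebesgue_cV R).

(** Half-open, as the intervals that generate the Borel sets of the line; an intersection of two
    such boxes is again one, possibly empty. *)
Definition boxoc n (a b : 'cV[R]_n) : set 'cV[R]_n :=
  [set x | forall i, x i ord0 \in `]a i ord0, b i ord0]].

Definition boxes n : set (set 'cV[R]_n) := [set boxoc z.1 z.2 | z in [set: 'cV[R]_n * 'cV[R]_n]].

Lemma measurable_boxoc n (a b : 'cV[R]_n) : measurable (boxoc a b).
Proof.
rewrite (_ : boxoc a b = \bigcap_(i : 'I_n)
    ((fun x : 'cV[R]_n => x i ord0) @^-1` `]a i ord0, b i ord0])).
  apply: fin_bigcap_measurable => [|i _]; first exact: finite_finset.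
  by rewrite -[X in measurable X]setTI; exact: measurable_cV_coord.
by apply/seteqP; split=> x /= H i; [move=> _; exact: H|exact: H].
Qed.

Lemma boxocI n (a b c d : 'cV[R]_n) : boxoc a b `&` boxoc c d =
  boxoc (\col_i Num.max (a i ord0) (c i ord0)) (\col_i Num.min (b i ord0) (d i ord0)).
Proof.
apply/seteqP; split => [x [h1 h2] i|x h].
  have := h1 i; have := h2 i; rewrite /= !in_itv/= !mxE gt_max le_min.
  by move=> /andP[-> ->] /andP[-> ->].
by split => i; have := h i; rewrite /= !in_itv/= !mxE gt_max le_min;
  move=> /andP[/andP[h1 h2] /andP[h3 h4]]; rewrite ?h1 ?h2 ?h3 ?h4.
Qed.

(** A cylinder over ]a, b] in one coordinate is the union over k of the boxes whose other sides are
    ]-k, k]. *)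
Lemma measurable_boxes n : @measurable _ 'cV[R]_n = <<s @boxes n >>.
Proof.
apply/seteqP; split; last first.
  apply: smallest_sub; first exact: sigma_algebra_measurable.
  by move=> _ [[a b] _ <-]; exact: measurable_boxoc.
apply: smallest_sub; first exact: smallest_sigma_algebra.
move=> B; rewrite -bigcup_seq/= => -[i _ [Y mY <-]]; rewrite setTI.
suff: <<s @ocitv R >> `<=` [set Y | <<s @boxes n >> ((@cV_coord _ R n i) @^-1` Y)].
  by apply; exact: mY.
apply: smallest_sub.
  split => /=; first by rewrite preimage_set0; exact: sigma_algebra0.
  - by move=> A mA; rewrite setTD preimage_setC; exact: sigma_algebraC.
  - by move=> F mF; rewrite preimage_bigcup; exact: sigma_algebra_bigcup.
move=> _ [[a b] _ <-] /=.
pose u (k : nat) (c : R) : 'cV[R]_n := \col_j (if j == i then c else k%:R).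
pose v (k : nat) (c : R) : 'cV[R]_n := \col_j (if j == i then c else - k%:R).
rewrite (_ : _ @^-1` _ = \bigcup_k boxoc (v k a) (u k b)).
  apply: sigma_algebra_bigcup => k; apply: sub_sigma_algebra.
  by exists (v k a, u k b).
apply/seteqP; split => [x /= xab|x [k _ /(_ i)]]; last first.
  by rewrite /= !mxE eqxx.
exists (\sum_j (Num.truncn `|x j ord0|).+1)%N => // j; rewrite !mxE.
case: eqP => [->//|_]; rewrite in_itv/=.
have h : `|x j ord0| < (\sum_j (Num.truncn `|x j ord0|).+1)%:R.
  apply: lt_le_trans (truncnS_gt _) _; rewrite ler_nat.
  by rewrite (bigD1 j)//= leq_addr.
by move: h; rewrite ltr_norml => /andP[-> /ltW ->].
Qed.

Lemma boxocN_cover n : \bigcup_k boxoc (const_mx (- k%:R)) (const_mx k%:R) = [set: 'cV[R]_n].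
Proof.
apply/seteqP; split => // x _.
exists (\sum_j (Num.truncn `|x j ord0|).+1)%N => // j; rewrite !mxE in_itv/=.
have h : `|x j ord0| < (\sum_j (Num.truncn `|x j ord0|).+1)%:R.
  apply: lt_le_trans (truncnS_gt _) _; rewrite ler_nat.
  by rewrite (bigD1 j)//= leq_addr.
by move: h; rewrite ltr_norml => /andP[-> /ltW ->].
Qed.

(** A monotone class argument on each cube ]-k, k]^n. Multiplying by the indicator of the cube makes
    [phi], which is only locally integrable, integrable on the whole space, and keeps the hypothesis
    since boxes are stable under intersection. *)
Lemma Rintegral_boxes_ae0 n (phi : 'cV[R]_n -> R) : measurable_fun setT phi ->
  (forall a b, L1 (mu n) (fun x => phi x * \1_(boxoc a b) x)) ->
  (forall a b, \int[mu n]_x (phi x * \1_(boxoc a b) x) = 0) ->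
  {ae mu n, forall x, phi x = 0}.
Proof.
move=> mphi lphi iphi.
have H k : {ae mu n, forall x, phi x * \1_(boxoc (const_mx (- k%:R)) (const_mx k%:R)) x = 0}.
  set Q := boxoc _ _; set phiQ := fun x => phi x * \1_Q x.
  have lQ : L1 (mu n) phiQ by exact: lphi.
  have key : forall S, measurable S -> (\int[mu n]_(x in S) (phiQ x)%:E = 0)%E.
    rewrite measurable_boxes.
    apply: (@dynkin_induction _ _ (@boxes n)) => //.
    - exact: measurable_boxes.
    - by move=> _ _ [[a b] _ <-] [[c e] _ <-]; rewrite boxocI/=; eexists (_, _).
    - by rewrite -EFin_Rintegral// iphi.
    - move=> _ [[a b] _ <-] /=; have mab := measurable_boxoc a b.
      rewrite integral_mkcond (eq_integral (fun x => (phi x * \1_(Q `&` boxoc a b) x)%:E)); last first.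
        by move=> x _; rewrite restrict_EFin patch_indic indicI /phiQ/= mulrA.
      by rewrite /Q boxocI -EFin_Rintegral// iphi.
    - move=> S mS S0.
      have h := @integral_setU_EFin _ _ _ (mu n) S (~` S) phiQ mS (measurableC mS).
      have : (\int[mu n]_x (phiQ x)%:E = 0)%E by rewrite -EFin_Rintegral// iphi.
      rewrite -{1}(setUv S) h ?S0 ?add0e ?setUv//.
      - exact: L1_measurable lQ.
      - by apply/disj_setPCl.
    - move=> F mF tF F0; rewrite integral_bigcup//.
        by apply: eseries0 => i _ _; exact: F0.
      by apply: integrableS lQ => //; exact: bigcup_measurable.
  have := @integral_ae_eq _ _ _ (mu n) setT measurableT (fun=> 0%E) (EFin \o phiQ) lQ (measurable_cst _).
  have h E : E `<=` setT -> measurable E ->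
      (\int[mu n]_(x in E) (EFin \o phiQ) x = \int[mu n]_(x in E) 0)%E.
    by move=> _ mE; rewrite integral0; exact: key.
  by move=> /(_ h); apply: filterS => x /(_ I) /= [].
have := ae_foralln H; apply: filterS => x Hx.
have : [set: 'cV[R]_n] x by []; rewrite -boxocN_cover => -[k _ xk].
by have := Hx k; rewrite indicE mem_set// mulr1.
Qed.

Definition poisson_box n (e : R) (a b : 'cV[R]_n) (x : 'cV[R]_n) :=
  tensor (fun i => poisson_itv e (a i ord0) (b i ord0)) x.

End boxes.

(** * Hyperplanes are null sets *)

Section hyperplane.
Context {R : realType}.
Local Notation lam := (@lebesgue_measure R).
Local Notation mu := (@lebesgue_cV R).

Lemma ae_cV_cons n (P : 'cV[R]_n.+1 -> Prop) :
  measurable [set x | P x] ->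
  {ae lam, forall s, {ae mu n, forall x, P (cV_cons (s, x))}} ->
  {ae mu n.+1, forall x, P x}.
Proof.
move=> mP H; exists (~` [set x | P x]); split => //; first exact: measurableC.
set N := ~` _; have mN : measurable N by exact: measurableC.
have mi : measurable_fun setT (fun x => (\1_N x)%:E : \bar R).
  exact/measurable_EFinP.
have mic : measurable_fun setT (fun z => (\1_N (@cV_cons R n z))%:E : \bar R).
  exact: (measurableT_comp mi (@measurable_cV_cons R n)).
rewrite -[N]setIT -integral_indic//.
rewrite (ge0_integral_cV_cons mi); last by move=> y; rewrite lee_fin.
rewrite (fubini_tonelli1 _ mic); last by move=> z; rewrite lee_fin.
rewrite -(integral0 lam setT); apply: ae_eq_integral => //.
  apply: (@measurable_fun_fubini_tonelli_F _ _ _ _ _ (mu n) _ mic).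
  by move=> z; rewrite lee_fin.
apply: filterS H => s Hs _; rewrite /fubini_F.
rewrite -(integral0 (mu n) setT); apply: ae_eq_integral => //.
  by apply: (measurableT_comp mic); exact: measurable_pair1.
by apply: filterS Hs => x Px _; rewrite indicE memNset.
Qed.

(** Slicing along the first coordinate: if the other coefficients are not all 0, every slice is a
    hyperplane of lower dimension; otherwise the hyperplane lies in the single slice s = c / t. *)
Lemma ae_hyperplane n (a : 'cV[R]_n) (c : R) : a != 0 ->
  {ae mu n, forall x, dot_cV a x != c}.
Proof.
elim: n a c => [|n ih] a c a0.
  by case/eqP: a0; apply/matrixP => -[].
have mH : measurable [set x | dot_cV a x != c].
  have md : measurable_fun setT (fun x => dot_cV a x) by exact: measurable_dot.
  rewrite (_ : mkset _ = (fun x => dot_cV a x) @^-1` (~` [set c])); last first.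
    by apply/seteqP; split => x /= /eqP.
  by rewrite -[X in measurable X]setTI; apply: md => //; exact: measurableC.
have aE : a = cV_cons (cV_uncons a).
  apply/matrixP => i j; rewrite (ord1 j); have [k ->|->] := unliftP ord0 i.
    by rewrite cV_consES mxE.
  by rewrite cV_consE0.
move: a0 mH; rewrite aE; case: (cV_uncons a) => {aE} [t u] a0 mH.
apply: ae_cV_cons => //.
have [u0|u0] := eqVneq u 0; last first.
  by apply/nearW => s; have := ih u (c - t * s) u0; apply: filterS => x; rewrite dot_cV_cons; apply: contra_neq => <-; ring.
have t0 : t != 0.
  apply: contra_neq a0 => t0; apply/matrixP => i j; rewrite (ord1 j) !mxE.
  by rewrite u0 t0; case: unliftP => //= k _; rewrite mxE.
exists [set c / t]; split => //; first exact: lebesgue_measure_set1.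
move=> s /=; apply: contra_notP => /eqP sc; apply/nearW => x.
rewrite dot_cV_cons u0 /dot_cV big1 ?addr0; last by move=> i _; rewrite mxE mul0r.
by apply: contra_neq sc => <-; rewrite mulrC mulKf.
Qed.

End hyperplane.

(** * Inversion of Fourier integrals *)

Section more_L1.
Context d1 d2 (T1 : measurableType d1) (T2 : measurableType d2) (R : realType).
Variables (m1 : {sigma_finite_measure set T1 -> \bar R})
          (m2 : {sigma_finite_measure set T2 -> \bar R}).

Lemma L1_prod_le (F : T1 * T2 -> R) (G : T1 -> R) :
  measurable_fun setT F -> (forall x, L1 m2 (fun y => F (x, y))) -> L1 m1 G ->
  (forall x, \int[m2]_y `|F (x, y)| <= G x) -> L1 (m1 \x m2)%E F.
Proof.
move=> mF lF lG FG.
have mF' : measurable_fun setT (EFin \o F) by exact/measurable_EFinP.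
apply/(@integrable12ltyP _ _ _ _ _ m1 m2 _ mF').
have /integrableP[_] := lG; apply: le_lt_trans; apply: ge0_le_integral => //.
- by move=> x _; exact: integral_ge0.
- apply: (@measurable_fun_fubini_tonelli_F _ _ _ _ _ m2 (fun z => `|(F z)%:E|%E)) => //.
  exact: measurableT_comp.
- apply: measurableT_comp => //; exact: measurable_int lG.
- move=> x _ /=; have /= <- := EFin_Rintegral (L1_norm (lF x)).
  by rewrite lee_fin (le_trans (FG x))// ler_norm.
Qed.

Lemma fatou_L1 (f_ : nat -> T1 -> R) (f : T1 -> R) (M : R) :
  (forall k, L1 m1 (f_ k)) -> (forall k x, 0 <= f_ k x) ->
  (forall x, f_ k x @[k --> \oo] --> f x) ->
  (forall k, \int[m1]_x f_ k x <= M) -> L1 m1 f /\ \int[m1]_x f x <= M.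
Proof.
move=> lf f0 ff fM.
have mf : measurable_fun setT f.
  by apply: (measurable_fun_cvg (fun k => L1_measurable (lf k))) => x _; exact: ff.
have f_ge0 x : 0 <= f x.
  by apply: (cvgr_to_ge (ff x)); exact: nearW.
have cf x : (f_ k x)%:E @[k --> \oo] --> (f x)%:E by apply/cvg_EFin; [exact: nearW|exact: ff].
have H : (\int[m1]_x (f x)%:E <= M%:E)%E.
  have := @fatou _ _ _ m1 setT measurableT (fun k => EFin \o f_ k)
    (fun k => measurable_int _ (lf k)) (fun k x _ => f0 k x).
  rewrite (_ : (\int[m1]_x _)%E = (\int[m1]_x (f x)%:E)%E); last first.
    apply: eq_integral => x _; rewrite is_cvg_limn_einfE; last by apply/cvg_ex; exists (f x)%:E; exact: cf.
    exact/cvg_lim/cf.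
  move=> /le_trans; apply; rewrite limn_einf_lim; apply: lime_le.
    exact: is_cvg_einfs.
  apply: nearW => k; apply: ereal_inf_le; exists (\int[m1]_x (f_ k x)%:E)%E.
    by exists k => //=.
  by rewrite -EFin_Rintegral// lee_fin.
have lf' : L1 m1 f.
  apply/integrableP; split; first exact/measurable_EFinP.
  under eq_integral do rewrite /= ger0_norm//.
  exact: le_lt_trans H (ltry _).
by split => //; rewrite -lee_fin EFin_Rintegral.
Qed.

End more_L1.

(** * Boxes smoothed by the Poisson kernel *)

Section box_limit.
Context {R : realType}.
Local Notation lam := (@lebesgue_measure R).
Local Notation mu := (@lebesgue_cV R).

Definition invsqr_cV n (x : 'cV[R]_n) := tensor (fun=> invsqr) x.

Lemma invsqr_cV_gt0 n (x : 'cV[R]_n) : 0 < invsqr_cV x.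
Proof. by apply: prodr_gt0 => i _; exact: invsqr_gt0. Qed.

Lemma L1_invsqr_cV n : L1 (mu n) (@invsqr_cV n).
Proof. by apply: L1_tensor => i; exact: L1_invsqr. Qed.

Lemma invsqr_cV_le1 n (x : 'cV[R]_n) : invsqr_cV x <= 1.
Proof.
apply: tensor_le1 => i t; rewrite (ltW (invsqr_gt0 _))/=.
exact: le_trans (ler_norm _) (bounded_invsqr _).
Qed.

Lemma indic_boxocE n (a b : 'cV[R]_n) x :
  \1_(boxoc a b) x = tensor (fun i => \1_`]a i ord0, b i ord0]) x :> R.
Proof.
rewrite indicE; have [xB|xB] := boolP (x \in boxoc a b).
  rewrite inE in xB.
  by rewrite /tensor big1// => i _; rewrite indicE mem_set//; exact: xB.
have [i Hi] : exists i, ~ x i ord0 \in `]a i ord0, b i ord0].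
  apply/existsNP => H; move/negP: xB; apply; rewrite inE => i; exact: H.
by rewrite /tensor (bigD1 i)//= indicE memNset ?mul0r.
Qed.

Lemma L1_indic_boxoc n (a b : 'cV[R]_n) : L1 (mu n) \1_(boxoc a b).
Proof.
apply: (@eq_L1 _ _ _ _ (tensor (fun i => \1_`]a i ord0, b i ord0]))).
  by move=> x; rewrite indic_boxocE.
by apply: L1_tensor => i; exact: integrable_indic_itv.
Qed.

Lemma boxoc_empty n (a b : 'cV[R]_n) i : b i ord0 <= a i ord0 ->
  boxoc a b = set0.
Proof.
move=> ba; apply/seteqP; split => // x /(_ i); rewrite /= in_itv/=.
by move=> /andP[/lt_le_trans /[apply]]; rewrite ltNge ba.
Qed.

Lemma poisson_le (e x : R) : 0 < e -> `|poisson e x| <= 2 / e.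
Proof.
move=> e0; rewrite ger0_norm ?poisson_ge0// /poisson.
rewrite ler_pdivrMr ?ltr_wpDr ?sqr_ge0 ?exprn_gt0//.
apply: (@le_trans _ _ (2 / e * e ^+ 2)).
  by rewrite expr2 mulrA divfK ?gt_eqF.
by rewrite ler_wpM2l ?divr_ge0 ?(ltW e0)// lerDl sqr_ge0.
Qed.

Lemma Rintegral_poisson_box n (e : R) (a b x : 'cV[R]_n) : 0 < e ->
  (forall i, a i ord0 < b i ord0) ->
  \int[mu n]_y (\1_(boxoc a b) y * poisson_cV e (x - y)) = poisson_box e a b x.
Proof.
move=> e0 ab.
rewrite (@eq_Rintegral _ _ _ _ _ (tensor (fun i t => \1_`]a i ord0, b i ord0] t *
   poisson e (x i ord0 - t)))); last first.
  move=> y _; rewrite tensorM indic_boxocE; congr (_ * _).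
  by apply: eq_bigr => i _; rewrite !mxE.
have cp i := @continuous_poisson_sub R e (x i ord0) e0.
rewrite Rintegral_tensor; last first.
  move=> i; apply: (L1_bounded (C := 2 / e)).
  - exact: integrable_indic_itv.
  - exact: (continuous_measurable_fun (cp i)).
  - by move=> t; exact: poisson_le.
apply: eq_bigr => i _; rewrite -poisson_itvE//; last exact: ltW.
rewrite -Rintegral_itv_obnd_cbnd; last first.
  apply: integrableS (continuous_integrable_itv (a i ord0) (b i ord0) (cp i)) => //.
  exact: subset_itv_oc_cc.
by rewrite [RHS]Rintegral_mkcond; apply: eq_Rintegral => t _; rewrite patch_indic/= mulrC.
Qed.

Lemma poisson_box_ge0 n (e : R) (a b x : 'cV[R]_n) : 0 < e ->
  (forall i, a i ord0 < b i ord0) -> 0 <= poisson_box e a b x.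
Proof. by move=> e0 ab; apply: prodr_ge0 => i _; apply: poisson_itv_ge0 => //; exact: ltW. Qed.

Lemma poisson_box_le n (a b : 'cV[R]_n) : (forall i, a i ord0 < b i ord0) ->
  exists C, forall e x, 0 < e <= 1 -> poisson_box e a b x <= C * invsqr_cV x.
Proof.
move=> ab.
pose c i : R := 2 * (1 + (`|a i ord0| + `|b i ord0|) ^+ 2) * (1 + (b i ord0 - a i ord0)).
exists (\prod_i c i) => e x e1; rewrite /poisson_box /invsqr_cV /tensor -big_split/=.
apply: ler_prod => i _; rewrite poisson_itv_le ?poisson_itv_ge0//; last exact: ltW.
- by case/andP: e1.
- exact: ltW.
Qed.

Lemma indic_boxoc_le n (a b : 'cV[R]_n) :
  exists C, forall x, \1_(boxoc a b) x <= C * invsqr_cV x.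
Proof.
pose c i : R := 1 + (`|a i ord0| + `|b i ord0|) ^+ 2.
exists (\prod_i c i) => x; rewrite indic_boxocE /invsqr_cV /tensor -big_split/=.
apply: ler_prod => i _; rewrite indicE; case: (boolP (_ \in _)) => xi.
  rewrite ler01/= /invsqr ler_pdivlMr ?ltr_wpDr ?sqr_ge0// mul1r /c lerD2l.
  move: xi; rewrite inE/= in_itv/= => /andP[ax xb].
  rewrite -(real_normK (num_real (x i ord0))) ler_pXn2r ?nnegrE ?addr_ge0//.
  rewrite ler_norml; apply/andP; split.
    by have := normr_ge0 (b i ord0); have := ler_norm (- a i ord0); rewrite normrN; lra.
  by have := normr_ge0 (a i ord0); have := ler_norm (b i ord0); lra.
rewrite lexx/= mulr_ge0 ?(ltW (invsqr_gt0 _))// /c addr_ge0 ?sqr_ge0//.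
Qed.

(** Removes the faces of a box, where the smoothed indicators need not converge to the indicator. *)
Lemma ae_boundary n (a : 'cV[R]_n) :
  {ae mu n, forall x : 'cV[R]_n, forall i, x i ord0 != a i ord0}.
Proof.
have H i : {ae mu n, forall x : 'cV[R]_n, x i ord0 != a i ord0}.
  have d0 : delta_mx i ord0 != 0 :> 'cV[R]_n.
    by apply/eqP => /matrixP /(_ i ord0); rewrite !mxE !eqxx => /eqP; rewrite oner_eq0.
  apply: filterS (ae_hyperplane (a i ord0) d0) => x.
  rewrite /dot_cV (bigD1 i)//= big1 ?addr0; last first.
    by move=> j ji; rewrite mxE (negbTE ji) mul0r.
  by rewrite mxE !eqxx mul1r.
exact: filter_forall.
Qed.

Lemma cvg_poisson_box n (a b x : 'cV[R]_n) : (forall i, a i ord0 < b i ord0) ->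
  (forall i, x i ord0 != a i ord0) -> (forall i, x i ord0 != b i ord0) ->
  poisson_box k.+1%:R^-1 a b x @[k --> \oo] --> (\1_(boxoc a b) x : R).
Proof.
move=> ab xa xb; rewrite indic_boxocE.
apply: cvg_big => [|i _]; first exact: mul_continuous.
have xai := xa i; have xbi := xb i; rewrite indicE; case: (boolP (_ \in _)) => xi.
  apply: cvg_poisson_itv_in; move: xi; rewrite inE/= in_itv/= => /andP[-> xb'].
  by rewrite lt_neqAle xbi.
apply: cvg_poisson_itv_out; first exact: ltW.
have [h|h] := ltP (x i ord0) (a i ord0); [by left|right].
have {}h : a i ord0 < x i ord0 by rewrite lt_neqAle eq_sym xai.
rewrite ltNge; apply: contra xi => xb'.
by rewrite inE/= in_itv/= h.
Qed.

End box_limit.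

Section inversion.
Context {R : realType} (n : nat).
Local Notation mu := (@lebesgue_cV R n).
Implicit Types (h hc hs w : 'cV[R]_n -> R) (x y : 'cV[R]_n).

(* The real part of [e^{i theta} int (hc - i hs) e^{2 pi i x.xi} dxi]: varying
   [theta] gives access to the imaginary part. *)
Definition phase_transform hc hs (theta : R) x : R :=
  \int[mu]_xi (hc xi * cos (2 * pi * dot_cV x xi + theta) +
               hs xi * sin (2 * pi * dot_cV x xi + theta)).

(** Abel summation of the inverse transform of hc - i hs gives the Poisson integral of h. This is
    all that inversion uses of the link between a function and its transform, so that it serves L^1
    and L^2 functions alike. *)
Definition poisson_pair h hc hs := forall (e : R) y (theta : R), 0 < e ->
  phase_transform (fun xi => expabs_cV e xi * hc xi)
    (fun xi => expabs_cV e xi * hs xi) theta y =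
  cos theta * \int[mu]_x (h x * poisson_cV e (x - y)).

Lemma measurable_phase d (T : measurableType d) (f g : T -> 'cV[R]_n) (theta : R) :
  measurable_fun setT f -> measurable_fun setT g ->
  measurable_fun setT (fun t => 2 * pi * dot_cV (f t) (g t) + theta).
Proof.
move=> mf mg; apply: measurable_funD => //; apply: measurable_funM => //.
exact: measurable_dot.
Qed.

Lemma L1_phase_transform hc hs theta x : L1 mu hc -> L1 mu hs ->
  L1 mu (fun xi => hc xi * cos (2 * pi * dot_cV x xi + theta) +
               hs xi * sin (2 * pi * dot_cV x xi + theta)).
Proof.
move=> lc ls; apply: L1D; apply: (L1_bounded (C := 1)) => //.
- by apply: measurable_cos_comp; exact: measurable_phase.
- by move=> y; exact: cos_max.
- by apply: measurable_sin_comp; exact: measurable_phase.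
- by move=> y; exact: sin_max.
Qed.

Lemma phase_transform_bound hc hs theta x : L1 mu hc -> L1 mu hs ->
  `|phase_transform hc hs theta x| <= \int[mu]_xi (`|hc xi| + `|hs xi|).
Proof.
move=> lc ls; apply: le_Rintegral_norm.
- by apply: L1D; exact: L1_norm.
- exact/L1_measurable/L1_phase_transform.
- move=> xi; apply: le_trans (ler_normD _ _) _; rewrite !normrM.
  by apply: lerD; rewrite ler_piMr// ?cos_max ?sin_max.
Qed.

Lemma L1_phase_transform_prod (g : 'cV[R]_n -> R) hc hs theta :
  L1 mu g -> L1 mu hc -> L1 mu hs ->
  L1 (mu \x mu)%E (fun z => g z.1 * (hc z.2 * cos (2 * pi * dot_cV z.1 z.2 + theta) +
               hs z.2 * sin (2 * pi * dot_cV z.1 z.2 + theta))).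
Proof.
move=> lg lc ls.
apply: (@eq_L1 _ _ _ _ (fun z => (g z.1 * hc z.2) * cos (2 * pi * dot_cV z.1 z.2 + theta) +
               (g z.1 * hs z.2) * sin (2 * pi * dot_cV z.1 z.2 + theta))).
  by move=> z; ring.
apply: L1D; apply: (L1_bounded (C := 1)); try exact: L1_prod.
- by apply: measurable_cos_comp; exact: measurable_phase.
- by move=> y; exact: cos_max.
- by apply: measurable_sin_comp; exact: measurable_phase.
- by move=> y; exact: sin_max.
Qed.

(** Measurability comes from Fubini's theorem, which requires integrability in x as well: hence the
    cutoff by cubes, removed in the limit. *)
Lemma measurable_phase_transform hc hs theta : L1 mu hc -> L1 mu hs ->
  measurable_fun setT (phase_transform hc hs theta).
Proof.
move=> lc ls; pose Q k : set 'cV[R]_n := boxoc (const_mx (- k%:R)) (const_mx k%:R).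
apply: (@measurable_fun_cvg _ _ _ _ (fun k x => \1_(Q k) x * phase_transform hc hs theta x)).
  move=> k.
  have H := L1_fubini1 (L1_phase_transform_prod theta (L1_indic_boxoc (const_mx (- k%:R)) (const_mx k%:R)) lc ls).
  have := L1_measurable H; apply: eq_measurable_fun => x _ /=.
  by rewrite RintegralZl//; exact: L1_phase_transform.
move=> x _; rewrite -[X in _ --> X]mul1r; apply: cvgM; last exact: cvg_cst.
have : [set: 'cV[R]_n] x by []; rewrite -boxocN_cover => -[k _ xk].
apply: cvg_near_cst; exists k => // m /= km; rewrite indicE mem_set// => i.
have := xk i; rewrite /= !mxE !in_itv/= => /andP[h1 h2].
by rewrite (le_lt_trans _ h1) ?lerN2 ?ler_nat// (le_trans h2)// ler_nat.
Qed.

Lemma cvg_expabs_cV (x : 'cV[R]_n) : expabs_cV k.+1%:R^-1 x @[k --> \oo] --> (1 : R).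
Proof.
rewrite [X in _ --> X](_ : 1 = \prod_(i < n) 1); last by rewrite big1.
apply: cvg_big => [|i _]; first exact: mul_continuous.
rewrite [X in _ --> X](_ : 1 = expR (- (0 * `|x i ord0|))); last first.
  by rewrite mul0r oppr0 expR0.
rewrite /expabs; apply: continuous_cvg; first exact: continuous_expR.
apply: cvgN.
by apply: cvgM; [exact: cvg_harmonic|exact: cvg_cst].
Qed.

Lemma cvg_phase_transform_expabs hc hs theta x : L1 mu hc -> L1 mu hs ->
  phase_transform (fun xi => expabs_cV k.+1%:R^-1 xi * hc xi)
    (fun xi => expabs_cV k.+1%:R^-1 xi * hs xi) theta x @[k --> \oo] -->
  phase_transform hc hs theta x.
Proof.
move=> lc ls.
have le k w : L1 mu w -> L1 mu (fun xi => expabs_cV k.+1%:R^-1 xi * w xi).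
  move=> lw; apply: (@eq_L1 _ _ _ _ (fun xi => w xi * expabs_cV k.+1%:R^-1 xi)).
    by move=> xi; rewrite mulrC.
  apply: (L1_bounded (C := 1)) => //; first exact/L1_measurable/L1_expabs_cV.
  by move=> xi; rewrite ger0_norm ?expabs_cV_ge0 ?expabs_cV_le1.
apply: (@dominated_cvg_Rintegral _ _ _ _ _ _ (fun xi => `|hc xi| + `|hs xi|)).
- by move=> k; apply/L1_measurable/L1_phase_transform; exact: le.
- exact/L1_measurable/L1_phase_transform.
- apply/nearW => xi; rewrite -[X in cos X]/(_) ; apply: cvgD; apply: cvgM; try exact: cvg_cst.
  + by rewrite -[X in _ --> X]mul1r; apply: cvgM; [exact: cvg_expabs_cV|exact: cvg_cst].
  + by rewrite -[X in _ --> X]mul1r; apply: cvgM; [exact: cvg_expabs_cV|exact: cvg_cst].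
- by apply: L1D; exact: L1_norm.
- move=> k xi; apply: le_trans (ler_normD _ _) _; rewrite !normrM.
  have E : `|expabs_cV k.+1%:R^-1 xi : R| <= 1.
    by rewrite ger0_norm ?expabs_cV_ge0 ?expabs_cV_le1.
  apply: lerD.
    rewrite -[leRHS]mulr1; apply: ler_pM => //; rewrite ?cos_max//.
    by rewrite ler_piMl.
  rewrite -[leRHS]mulr1; apply: ler_pM => //; rewrite ?sin_max//.
  by rewrite ler_piMl.
Qed.

(** Both sides are compared through their integrals over boxes. Against the indicator of a box, the
    Abel sums are integrals of h against the smoothed indicator, and both sides pass to the limit by
    domination. No pointwise convergence of Poisson integrals of h is involved. *)
Lemma poisson_inversion h hc hs theta : measurable_fun setT h ->
  L1 mu (fun x => h x * invsqr_cV x) -> L1 mu hc -> L1 mu hs ->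
  poisson_pair h hc hs ->
  {ae mu, forall x, phase_transform hc hs theta x = cos theta * h x}.
Proof.
move=> mh lh lc ls H.
have mZ := measurable_phase_transform theta lc ls.
set Z := phase_transform hc hs theta in mZ *.
set C := \int[mu]_xi (`|hc xi| + `|hs xi|).
have ZC x : `|Z x| <= C by exact: phase_transform_bound.
have lhB a b : L1 mu (fun x => h x * \1_(boxoc a b) x).
  have [K HK] := indic_boxoc_le a b.
  apply: (@L1_le _ _ _ _ _ (fun x => K * (h x * invsqr_cV x))); last exact: L1Z.
    by apply: measurable_funM => //; exact: L1_measurable (L1_indic_boxoc a b).
  move=> x; rewrite mulrCA !normrM ler_wpM2l// -normrM ger0_norm//.
  exact: le_trans (HK x) (ler_norm _).
have lZB a b : L1 mu (fun x => Z x * \1_(boxoc a b) x).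
  apply: (@eq_L1 _ _ _ _ (fun x => \1_(boxoc a b) x * Z x)).
    by move=> x; rewrite mulrC.
  by apply: (L1_bounded (C := C)) => //; exact: L1_indic_boxoc.
suff : {ae mu, forall x, Z x - cos theta * h x = 0}.
  by apply: filterS => x /eqP; rewrite subr_eq0 => /eqP.
have E : forall a b x, (Z x - cos theta * h x) * \1_(boxoc a b) x =
    Z x * \1_(boxoc a b) x - cos theta * (h x * \1_(boxoc a b) x).
  by move=> a b x; rewrite mulrBl mulrA.
apply: Rintegral_boxes_ae0.
- by apply: measurable_funB => //; exact: measurable_funM.
- move=> a b; apply: (eq_L1 (fun x => esym (E a b x))).
  by apply: L1B => //; exact: L1Z.
move=> a b; have [ab|nab] := pselect (forall i, a i ord0 < b i ord0); last first.
  have [j] : exists i, ~ (a i ord0 < b i ord0) by apply/existsNP.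
  move=> /negP; rewrite -leNgt => /boxoc_empty ->.
  under eq_Rintegral do rewrite indic0 mulr0.
  by rewrite Rintegral_cst// mul0r.
under eq_Rintegral do rewrite E.
rewrite (RintegralB measurableT (lZB a b) (L1Z (cos theta) (lhB a b))).
rewrite (RintegralZl _ measurableT (lhB a b)); apply/eqP; rewrite subr_eq0; apply/eqP.
pose e k : R := k.+1%:R^-1.
have e0 k : 0 < e k by rewrite invr_gt0.
have e1 k : e k <= 1 by rewrite invf_le1 ?ler1n.
pose Ze k := phase_transform (fun xi => expabs_cV (e k) xi * hc xi)
    (fun xi => expabs_cV (e k) xi * hs xi) theta.
have lE k w : L1 mu w -> L1 mu (fun xi => expabs_cV (e k) xi * w xi).
  move=> lw; apply: (@eq_L1 _ _ _ _ (fun xi => w xi * expabs_cV (e k) xi)).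
    by move=> xi; rewrite mulrC.
  apply: (L1_bounded (C := 1)) => //; first exact/L1_measurable/L1_expabs_cV.
  by move=> xi; rewrite ger0_norm ?expabs_cV_ge0 ?expabs_cV_le1.
have mZe k : measurable_fun setT (Ze k) by apply: measurable_phase_transform; exact: lE.
have ZeC k x : `|Ze k x| <= C.
  apply: le_trans (phase_transform_bound _ _ (lE k _ lc) (lE k _ ls)) _.
  apply: le_Rintegral => //.
  - by apply: L1D; exact/L1_norm/lE.
  - by apply: L1D; exact/L1_norm.
  - move=> xi _; have E1 : `|expabs_cV (e k) xi : R| <= 1.
      by rewrite ger0_norm ?expabs_cV_ge0 ?expabs_cV_le1.
    by rewrite !normrM lerD// ler_piMl.
have lim1 : \int[mu]_x (Ze k x * \1_(boxoc a b) x) @[k --> \oo] -->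
    \int[mu]_x (Z x * \1_(boxoc a b) x).
  apply: (@dominated_cvg_Rintegral _ _ _ _ _ _ (fun x => C * \1_(boxoc a b) x)).
  - by move=> k; apply: measurable_funM => //; exact: L1_measurable (L1_indic_boxoc a b).
  - exact: L1_measurable (lZB a b).
  - apply/nearW => x; apply: cvgM; last exact: cvg_cst.
    exact: cvg_phase_transform_expabs.
  - by apply: L1Z; exact: L1_indic_boxoc.
  - by move=> k x; rewrite normrM ler_pM// ger0_norm.
have lim2 : \int[mu]_x (h x * poisson_box (e k) a b x) @[k --> \oo] -->
    \int[mu]_x (h x * \1_(boxoc a b) x).
  have [K HK] := poisson_box_le ab.
  apply: (@dominated_cvg_Rintegral _ _ _ _ _ _ (fun x => K * `|h x * invsqr_cV x|)).
  - move=> k; apply: measurable_funM => //; apply: measurable_tensor => i.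
    apply: measurable_funM => //; apply: measurable_funB.
      apply: (measurableT_comp (continuous_measurable_fun (@continuous_atan R))).
      by apply: measurable_funM => //; exact: measurable_funB.
    apply: (measurableT_comp (continuous_measurable_fun (@continuous_atan R))).
    by apply: measurable_funM => //; exact: measurable_funB.
  - exact: L1_measurable (lhB a b).
  - have := ae_boundary b; have := ae_boundary a; apply: filterS2 => x xa xb.
    by apply: cvgM; [exact: cvg_cst|exact: cvg_poisson_box].
  - by apply: L1Z; exact: L1_norm.
  - move=> k x; rewrite !normrM mulrCA ler_wpM2l//.
    rewrite ger0_norm ?poisson_box_ge0// (ger0_norm (ltW (invsqr_cV_gt0 x))).
    by apply: HK; rewrite e0 e1.
(* Fubini moves the Poisson kernel from h to the indicator of the box, where it becomes
   [poisson_box]. *)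
have key k : \int[mu]_x (Ze k x * \1_(boxoc a b) x) =
    cos theta * \int[mu]_x (h x * poisson_box (e k) a b x).
  have [K HK] := poisson_box_le ab.
  pose F (z : 'cV[R]_n * 'cV[R]_n) := h z.1 * (\1_(boxoc a b) z.2 * poisson_cV (e k) (z.1 - z.2)).
  have mF : measurable_fun setT F.
    apply: measurable_funM; first exact: (measurableT_comp mh measurable_fst).
    apply: measurable_funM.
      exact: (measurableT_comp (L1_measurable (L1_indic_boxoc a b)) measurable_snd).
    apply: (measurableT_comp (L1_measurable (L1_poisson_cV n (e0 k)))).
    exact: measurable_cVB.
  have lFx x : L1 mu (fun y => \1_(boxoc a b) y * poisson_cV (e k) (x - y)).
    apply: (@eq_L1 _ _ _ _ (fun y => poisson_cV (e k) (x - y) * \1_(boxoc a b) y)).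
      by move=> y; rewrite mulrC.
    apply: (L1_bounded (C := 1)).
    - by apply: L1_cV_subl; exact: L1_poisson_cV.
    - exact: (L1_measurable (L1_indic_boxoc a b)).
    - by move=> y; rewrite ger0_norm// indic_le1.
  have lF : L1 (mu \x mu)%E F.
    apply: (@L1_prod_le _ _ _ _ _ _ _ _ (fun x => K * `|h x * invsqr_cV x|)) => //.
    - by move=> x; exact: (L1Z (h x) (lFx x)).
    - by apply: L1Z; exact: L1_norm.
    - move=> x; rewrite /F /=.
      under eq_Rintegral do rewrite normrM [X in _ * X]ger0_norm ?mulr_ge0 ?poisson_cV_ge0//.
      rewrite (RintegralZl _ measurableT (lFx x)) Rintegral_poisson_box// normrM mulrCA ler_wpM2l//.
      rewrite (ger0_norm (ltW (invsqr_cV_gt0 x))).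
      by apply: HK; rewrite e0 e1.
  transitivity (cos theta * \int[mu]_y \int[mu]_x F (x, y)).
    rewrite -RintegralZl//; last exact: L1_fubini2.
    apply: eq_Rintegral => y _; rewrite /Ze H// -mulrA; congr (_ * _).
    rewrite indicE; case yB : (y \in boxoc a b).
      rewrite mulr1; apply: eq_Rintegral => x _.
      by rewrite /F/= indicE yB mul1r.
    rewrite mulr0; under [RHS]eq_Rintegral do rewrite /F/= indicE yB mul0r mulr0.
    by rewrite Rintegral_cst// mul0r.
  congr (_ * _); rewrite -(Rintegral_fubini lF); apply: eq_Rintegral => x _.
  by rewrite /F/= (RintegralZl _ measurableT (lFx x)) Rintegral_poisson_box.
have /cvg_lim <- // := lim1.
apply/cvg_lim => //; under eq_cvg do rewrite key.
by apply: cvgM => //; exact: cvg_cst.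
Qed.

End inversion.

(** * The Plancherel transform *)

Lemma sqr_le_norm (R : realDomainType) (x C : R) : `|x| <= C -> x ^+ 2 <= C ^+ 2.
Proof.
move=> xC; rewrite -(real_normK (num_real x)) ler_pXn2r ?nnegrE//.
exact: le_trans xC.
Qed.

Section transforms.
Context {R : realType} (n : nat).
Local Notation mu := (@lebesgue_cV R n).
Implicit Types (h hc hs w : 'cV[R]_n -> R) (x y : 'cV[R]_n).

Definition fcos w y : R := \int[mu]_x (w x * cos (2 * pi * dot_cV x y)).
Definition fsin w y : R := \int[mu]_x (w x * sin (2 * pi * dot_cV x y)).

Lemma measurable_dot2pi d (T : measurableType d) (f g : T -> 'cV[R]_n) :
  measurable_fun setT f -> measurable_fun setT g ->
  measurable_fun setT (fun t => 2 * pi * dot_cV (f t) (g t)).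
Proof. by move=> mf mg; apply: measurable_funM => //; exact: measurable_dot. Qed.

Lemma L1_mul_cos w y : L1 mu w -> L1 mu (fun x => w x * cos (2 * pi * dot_cV x y)).
Proof.
move=> lw; apply: (L1_bounded (C := 1)) => //.
  by apply: measurable_cos_comp; exact: measurable_dot2pi.
by move=> x; exact: cos_max.
Qed.

Lemma L1_mul_sin w y : L1 mu w -> L1 mu (fun x => w x * sin (2 * pi * dot_cV x y)).
Proof.
move=> lw; apply: (L1_bounded (C := 1)) => //.
  by apply: measurable_sin_comp; exact: measurable_dot2pi.
by move=> x; exact: sin_max.
Qed.

Lemma fcosE w y : fcos w y = phase_transform w (fun=> 0) 0 y.
Proof.
by apply: eq_Rintegral => x _; rewrite mul0r !addr0 dot_cVC.
Qed.

Lemma fsinE w y : fsin w y = phase_transform (fun=> 0) w 0 y.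
Proof.
by apply: eq_Rintegral => x _; rewrite mul0r add0r addr0 dot_cVC.
Qed.

Lemma measurable_fcos w : L1 mu w -> measurable_fun setT (fcos w).
Proof.
move=> lw; rewrite (funext (fcosE w)); apply: measurable_phase_transform => //.
exact: L1_0.
Qed.

Lemma measurable_fsin w : L1 mu w -> measurable_fun setT (fsin w).
Proof.
move=> lw; rewrite (funext (fsinE w)); apply: measurable_phase_transform => //.
exact: L1_0.
Qed.

Lemma fcos_bound w y : L1 mu w -> `|fcos w y| <= \int[mu]_x `|w x|.
Proof.
move=> lw; apply: le_Rintegral_norm; first exact: L1_norm.
  exact/L1_measurable/L1_mul_cos.
by move=> x; rewrite normrM ler_piMr// cos_max.
Qed.

Lemma fsin_bound w y : L1 mu w -> `|fsin w y| <= \int[mu]_x `|w x|.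
Proof.
move=> lw; apply: le_Rintegral_norm; first exact: L1_norm.
  exact/L1_measurable/L1_mul_sin.
by move=> x; rewrite normrM ler_piMr// sin_max.
Qed.

Lemma poisson_cVN (e : R) x : poisson_cV e (- x) = poisson_cV e x.
Proof.
by apply: eq_bigr => i _; rewrite mxE /poisson mulrN sqrrN.
Qed.

Lemma poisson_cV_le (e : R) x : 0 < e -> `|poisson_cV e x| <= (2 / e) ^+ n.
Proof.
move=> e0; rewrite /poisson_cV /tensor normr_prod.
rewrite -[X in _ <= _ ^+ X]card_ord -prodr_const.
by apply: ler_prod => i _; rewrite normr_ge0 poisson_le.
Qed.

(** The multiplication formula, which exchanges the transform between the two factors of an
    integral. *)
Lemma fcos_fubini h w : L1 mu h -> L1 mu w ->
  \int[mu]_xi (fcos h xi * w xi) = \int[mu]_y (h y * fcos w y).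
Proof.
move=> lh lw.
pose F (z : 'cV[R]_n * 'cV[R]_n) := h z.1 * w z.2 * cos (2 * pi * dot_cV z.1 z.2).
have lF : L1 (mu \x mu)%E F.
  apply: (L1_bounded (C := 1)); first exact: L1_prod.
    by apply: measurable_cos_comp; exact: measurable_dot2pi.
  by move=> z; exact: cos_max.
transitivity (\int[mu]_xi \int[mu]_y F (y, xi)).
  apply: eq_Rintegral => xi _; rewrite -RintegralZr//; last exact: L1_mul_cos.
  by apply: eq_Rintegral => y _; rewrite /F/=; ring.
rewrite -(Rintegral_fubini lF); apply: eq_Rintegral => y _.
rewrite -RintegralZl//; last exact: L1_mul_cos.
by apply: eq_Rintegral => xi _; rewrite /F/= dot_cVC; ring.
Qed.

Lemma fsin_fubini h w : L1 mu h -> L1 mu w ->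
  \int[mu]_xi (fsin h xi * w xi) = \int[mu]_y (h y * fsin w y).
Proof.
move=> lh lw.
pose F (z : 'cV[R]_n * 'cV[R]_n) := h z.1 * w z.2 * sin (2 * pi * dot_cV z.1 z.2).
have lF : L1 (mu \x mu)%E F.
  apply: (L1_bounded (C := 1)); first exact: L1_prod.
    by apply: measurable_sin_comp; exact: measurable_dot2pi.
  by move=> z; exact: sin_max.
transitivity (\int[mu]_xi \int[mu]_y F (y, xi)).
  apply: eq_Rintegral => xi _; rewrite -RintegralZr//; last exact: L1_mul_sin.
  by apply: eq_Rintegral => y _; rewrite /F/=; ring.
rewrite -(Rintegral_fubini lF); apply: eq_Rintegral => y _.
rewrite -RintegralZl//; last exact: L1_mul_sin.
by apply: eq_Rintegral => xi _; rewrite /F/= dot_cVC; ring.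
Qed.

(** The squared modulus of the transform, damped by e^{- e |xi|_1}, integrates to the double
    integral of h(x) h(y) P_e(x - y). As P_e has mass 1, bounding h(x) h(y) by the mean of the
    squares gives the integral of h^2, and Fatou's lemma removes the damping. Applied to differences
    of truncations, the inequality makes their transforms a Cauchy sequence. *)
Lemma bessel h : L1 mu h -> L2 mu h ->
  L1 mu (fun xi => fcos h xi ^+ 2 + fsin h xi ^+ 2) /\
  \int[mu]_xi (fcos h xi ^+ 2 + fsin h xi ^+ 2) <= \int[mu]_x (h x ^+ 2).
Proof.
move=> lh l2h; have mh := L1_measurable lh.
pose e k : R := k.+1%:R^-1.
have e0 k : 0 < e k by rewrite invr_gt0.
set M := \int[mu]_x (h x ^+ 2).
pose f_ k xi := expabs_cV (e k) xi * (fcos h xi ^+ 2 + fsin h xi ^+ 2).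
have mf2 : measurable_fun setT (fun xi => fcos h xi ^+ 2 + fsin h xi ^+ 2).
  by apply: measurable_funD; apply: measurable_funX; [exact: measurable_fcos|exact: measurable_fsin].
apply: (@fatou_L1 _ _ _ mu f_).
- move=> k; set C := \int[mu]_x `|h x|.
  apply: (L1_bounded (C := C ^+ 2 + C ^+ 2)) => //; first exact: L1_expabs_cV.
  move=> xi; rewrite ger0_norm ?addr_ge0 ?sqr_ge0//.
  have C0 : 0 <= C by apply: Rintegral_ge0.
  by apply: lerD; apply: sqr_le_norm; [exact: fcos_bound|exact: fsin_bound].
- by move=> k xi; rewrite mulr_ge0 ?expabs_cV_ge0 ?addr_ge0 ?sqr_ge0.
- move=> xi; rewrite -[X in _ --> X]mul1r; apply: cvgM; last exact: cvg_cst.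
  exact: cvg_expabs_cV.
move=> k; set C := \int[mu]_x `|h x|.
pose w1 xi := expabs_cV (e k) xi * fcos h xi.
pose w2 xi := expabs_cV (e k) xi * fsin h xi.
have lw1 : L1 mu w1.
  apply: (L1_bounded (C := C)); [exact: L1_expabs_cV|exact: measurable_fcos|].
  by move=> xi; exact: fcos_bound.
have lw2 : L1 mu w2.
  apply: (L1_bounded (C := C)); [exact: L1_expabs_cV|exact: measurable_fsin|].
  by move=> xi; exact: fsin_bound.
(* The damped transform of h is inverted to its Poisson integral: the addition formula collects the
   two products into cos (2 pi (x - y).xi), whose integral against the weight is the kernel. *)
have Ew y : fcos w1 y + fsin w2 y = \int[mu]_x (h x * poisson_cV (e k) (x - y)).
  pose F (z : 'cV[R]_n * 'cV[R]_n) :=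
    h z.1 * expabs_cV (e k) z.2 * cos (2 * pi * dot_cV (z.1 - y) z.2 + 0).
  have lF : L1 (mu \x mu)%E F.
    apply: (L1_bounded (C := 1)).
    - exact: (L1_prod lh (L1_expabs_cV n (e0 k))).
    - apply: measurable_cos_comp; apply: measurable_phase => //.
      exact: measurable_cVB.
    - by move=> z; exact: cos_max.
  transitivity (\int[mu]_xi \int[mu]_x F (x, xi)).
    rewrite -RintegralD//; [|exact: L1_mul_cos|exact: L1_mul_sin].
    apply: eq_Rintegral => xi _; rewrite /w1 /w2 /F/=.
    have lc := L1_mul_cos xi lh; have ls := L1_mul_sin xi lh.
    transitivity (expabs_cV (e k) xi * \int[mu]_x (cos (2 * pi * dot_cV xi y) * (h x * cos (2 * pi * dot_cV x xi)) +
       sin (2 * pi * dot_cV xi y) * (h x * sin (2 * pi * dot_cV x xi)))).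
      rewrite (RintegralD measurableT (L1Z _ lc) (L1Z _ ls)).
      rewrite (RintegralZl _ measurableT lc) (RintegralZl _ measurableT ls).
      by rewrite -/(fcos h xi) -/(fsin h xi); ring.
    rewrite -(RintegralZl _ measurableT (L1D (L1Z _ lc) (L1Z _ ls))).
    by apply: eq_Rintegral => x _; rewrite addr0 dot_cVBl mulrBr cosB (dot_cVC y); ring.
  rewrite -(Rintegral_fubini lF); apply: eq_Rintegral => x _; rewrite /F/=.
  under eq_Rintegral do rewrite -mulrA.
  rewrite RintegralZl//; last first.
    apply: (L1_bounded (C := 1)); first exact: L1_expabs_cV.
      by apply: measurable_cos_comp; exact: measurable_phase.
    by move=> xi; exact: cos_max.
  by rewrite poisson_cV_transform// cos0 mul1r.
have E1 : \int[mu]_xi f_ k xi = \int[mu]_y (h y * (fcos w1 y + fsin w2 y)).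
  transitivity (\int[mu]_xi (fcos h xi * w1 xi + fsin h xi * w2 xi)).
    by apply: eq_Rintegral => xi _; rewrite /f_ /w1 /w2; ring.
  have bc := L1_bounded lw1 (measurable_fcos lh) (fun y => fcos_bound y lh).
  have bs := L1_bounded lw2 (measurable_fsin lh) (fun y => fsin_bound y lh).
  have bc' : L1 mu (fun xi => fcos h xi * w1 xi) by apply: eq_L1 bc => xi; rewrite mulrC.
  have bs' : L1 mu (fun xi => fsin h xi * w2 xi) by apply: eq_L1 bs => xi; rewrite mulrC.
  rewrite (RintegralD measurableT bc' bs') fcos_fubini// fsin_fubini//.
  have hc := L1_bounded lh (measurable_fcos lw1) (fun y => fcos_bound y lw1).
  have hs := L1_bounded lh (measurable_fsin lw2) (fun y => fsin_bound y lw2).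
  rewrite -(RintegralD measurableT hc hs).
  by apply: eq_Rintegral => y _; rewrite mulrDr.
have mP : measurable_fun setT (fun z : 'cV[R]_n * 'cV[R]_n => poisson_cV (e k) (z.1 - z.2)).
  apply: (measurableT_comp (L1_measurable (L1_poisson_cV n (e0 k)))).
  exact: measurable_cVB.
have lP x : L1 mu (fun y => poisson_cV (e k) (x - y)).
  by apply: L1_cV_subl; exact: L1_poisson_cV.
have iP x : \int[mu]_y poisson_cV (e k) (x - y) = 1.
  rewrite (@Rintegral_cV_subl _ _ x (poisson_cV (e k))) ?Rintegral_poisson_cV//.
    exact/L1_measurable/L1_poisson_cV.
  by move=> y; exact: poisson_cV_ge0.
have m1 : measurable_fun setT (fun z : 'cV[R]_n * 'cV[R]_n => h z.1).
  exact: (measurableT_comp mh measurable_fst).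
have m2 : measurable_fun setT (fun z : 'cV[R]_n * 'cV[R]_n => h z.2).
  exact: (measurableT_comp mh measurable_snd).
have l1 : L1 (mu \x mu)%E (fun z => h z.1 ^+ 2 * poisson_cV (e k) (z.1 - z.2)).
  apply: (@L1_prod_le _ _ _ _ _ _ _ _ (fun x => h x ^+ 2)) => //=.
  - by apply: measurable_funM => //; exact: measurable_funX.
  - by move=> x; exact: (L1Z (h x ^+ 2) (lP x)).
  - by case: l2h.
  - move=> x; rewrite (@eq_Rintegral _ _ _ _ _ (fun y => h x ^+ 2 * poisson_cV (e k) (x - y))).
      by rewrite (RintegralZl _ measurableT (lP x)) iP mulr1.
    by move=> y _; rewrite ger0_norm// mulr_ge0 ?sqr_ge0 ?poisson_cV_ge0.
have l2 : L1 (mu \x mu)%E (fun z => h z.2 ^+ 2 * poisson_cV (e k) (z.1 - z.2)).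
  by apply: eq_L1 (L1_swap l1) => z /=; rewrite -poisson_cVN opprB.
have i1 : \int[(mu \x mu)%E]_z (h z.1 ^+ 2 * poisson_cV (e k) (z.1 - z.2)) = M.
  rewrite Rintegral_fubini1//=; apply: eq_Rintegral => x _.
  by rewrite (RintegralZl _ measurableT (lP x)) iP mulr1.
have i2 : \int[(mu \x mu)%E]_z (h z.2 ^+ 2 * poisson_cV (e k) (z.1 - z.2)) = M.
  rewrite Rintegral_fubini2//=; apply: eq_Rintegral => x _.
  under eq_Rintegral do rewrite -poisson_cVN opprB.
  by rewrite (RintegralZl _ measurableT (lP x)) iP mulr1.
have le z : `|h z.1 * h z.2 * poisson_cV (e k) (z.1 - z.2)| <=
   2^-1 * (h z.1 ^+ 2 * poisson_cV (e k) (z.1 - z.2) +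
    h z.2 ^+ 2 * poisson_cV (e k) (z.1 - z.2)).
  have P0 := poisson_cV_ge0 (z.1 - z.2) (e0 k).
  rewrite -mulrDl normrM (ger0_norm P0) mulrA ler_wpM2r// normrM.
  rewrite -(real_normK (num_real (h z.1))) -(real_normK (num_real (h z.2))).
  have := sqr_ge0 (`|h z.1| - `|h z.2|); rewrite sqrrB; lra.
have lhP : L1 (mu \x mu)%E (fun z => h z.1 * h z.2 * poisson_cV (e k) (z.1 - z.2)).
  apply: (L1_le _ _ (L1Z 2^-1 (L1D l1 l2))).
    by apply: measurable_funM => //; exact: measurable_funM.
  by move=> z; exact: le_trans (le z) (ler_norm _).
have E2 : \int[mu]_xi f_ k xi = \int[(mu \x mu)%E]_z (h z.1 * h z.2 * poisson_cV (e k) (z.1 - z.2)).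
  rewrite E1 (Rintegral_fubini2 lhP); apply: eq_Rintegral => y _ /=.
  rewrite Ew -RintegralZl//; first by apply: eq_Rintegral => x _; ring.
  apply: (L1_bounded lh _ (fun x => poisson_cV_le (x - y) (e0 k))).
  apply: (measurableT_comp (L1_measurable (L1_poisson_cV n (e0 k)))).
  exact: measurable_cVB.
rewrite E2.
have -> : M = \int[(mu \x mu)%E]_z (2^-1 * (h z.1 ^+ 2 * poisson_cV (e k) (z.1 - z.2) +
    h z.2 ^+ 2 * poisson_cV (e k) (z.1 - z.2))).
  rewrite (RintegralZl _ measurableT (L1D l1 l2)) (RintegralD measurableT l1 l2) i1 i2.
  by lra.
apply: le_trans (ler_norm _) _; apply: le_Rintegral_norm => //.
  exact: (L1Z 2^-1 (L1D l1 l2)).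
exact: L1_measurable lhP.
Qed.

Lemma L2_fcos h : L1 mu h -> L2 mu h -> L2 mu (fcos h).
Proof.
move=> lh l2h; have [l _] := bessel lh l2h; split; first exact: measurable_fcos.
apply: (L1_le _ _ l); first by apply: measurable_funX; exact: measurable_fcos.
by move=> x; rewrite !ger0_norm ?addr_ge0 ?sqr_ge0// lerDl sqr_ge0.
Qed.

Lemma L2_fsin h : L1 mu h -> L2 mu h -> L2 mu (fsin h).
Proof.
move=> lh l2h; have [l _] := bessel lh l2h; split; first exact: measurable_fsin.
apply: (L1_le _ _ l); first by apply: measurable_funX; exact: measurable_fsin.
by move=> x; rewrite !ger0_norm ?addr_ge0 ?sqr_ge0// lerDr sqr_ge0.
Qed.

(* [hc - i hs] is the Fourier-Plancherel transform of [h], tested against the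
    transforms of functions in the intersection of [L1] and [L2]. *)
Definition plancherel_pair h hc hs := [/\ L2 mu hc, L2 mu hs &
  forall w1 w2, L1 mu w1 -> L2 mu w1 -> L1 mu w2 -> L2 mu w2 ->
  \int[mu]_xi (hc xi * w1 xi + hs xi * w2 xi) =
  \int[mu]_y (h y * (fcos w1 y + fsin w2 y))].

Lemma plancherel_pair_L1 h : L1 mu h -> L2 mu h -> plancherel_pair h (fcos h) (fsin h).
Proof.
move=> lh l2h; split; [exact: L2_fcos|exact: L2_fsin|].
move=> w1 w2 l1 l21 l2 l22.
rewrite RintegralD//; [|by apply: L2_mul => //; exact: L2_fcos|by apply: L2_mul => //; exact: L2_fsin].
rewrite fcos_fubini// fsin_fubini//.
under [RHS]eq_Rintegral do rewrite mulrDr.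
have lw1 := L2_fcos l1 l21; have lw2 := L2_fsin l2 l22.
by rewrite (RintegralD measurableT (L2_mul l2h lw1) (L2_mul l2h lw2)).
Qed.

(** For fixed [w1] and [w2] both sides of the tested identity are continuous in L^2, the transforms
    of [w1] and [w2] being square-integrable by [bessel]. *)
Lemma plancherel_pair_limit (u v r : nat -> 'cV[R]_n -> R) h hc hs :
  (forall k, plancherel_pair (r k) (u k) (v k)) ->
  (forall k, L2 mu (r k)) -> L2 mu h -> L2 mu hc -> L2 mu hs ->
  \int[mu]_x (r k x - h x) ^+ 2 @[k --> \oo] --> 0 ->
  \int[mu]_x (u k x - hc x) ^+ 2 @[k --> \oo] --> 0 ->
  \int[mu]_x (v k x - hs x) ^+ 2 @[k --> \oo] --> 0 ->
  plancherel_pair h hc hs.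
Proof.
move=> H lr lh lc ls rh uc vs; split => // w1 w2 l1 l21 l2 l22.
have lu k : L2 mu (u k) by case: (H k).
have lv k : L2 mu (v k) by case: (H k).
have lw1 := L2_fcos l1 l21; have lw2 := L2_fsin l2 l22.
have c1 := L2_cvg_mul lu lc l21 uc.
have c2 := L2_cvg_mul lv ls l22 vs.
have c3 := L2_cvg_mul lr lh (L2D lw1 lw2) rh.
rewrite RintegralD//; [|exact: L2_mul|exact: L2_mul].
have /cvg_lim <- // := c3.
have c12 : \int[mu]_x (u k x * w1 x) + \int[mu]_x (v k x * w2 x) @[k --> \oo] -->
  \int[mu]_x (hc x * w1 x) + \int[mu]_x (hs x * w2 x) by exact: cvgD.
have /cvg_lim <- // := c12.
congr (limn _); apply/funext => k /=.
have [_ _ Hk] := H k; rewrite -Hk// RintegralD//; exact: L2_mul.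
Qed.

Lemma fcosB w1 w2 y : L1 mu w1 -> L1 mu w2 ->
  fcos (fun x => w1 x - w2 x) y = fcos w1 y - fcos w2 y.
Proof.
move=> l1 l2; rewrite /fcos -RintegralB//; [|exact: L1_mul_cos|exact: L1_mul_cos].
by apply: eq_Rintegral => x _; rewrite mulrBl.
Qed.

Lemma fsinB w1 w2 y : L1 mu w1 -> L1 mu w2 ->
  fsin (fun x => w1 x - w2 x) y = fsin w1 y - fsin w2 y.
Proof.
move=> l1 l2; rewrite /fsin -RintegralB//; [|exact: L1_mul_sin|exact: L1_mul_sin].
by apply: eq_Rintegral => x _; rewrite mulrBl.
Qed.

(** The truncation of [is_fourier], written as a product with an indicator so that the lemmas on
    bounded factors apply. *)
Definition trunc (k : nat) h x : R := h x * \1_[set x | euclidean_norm x <= k%:R] x.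

Lemma measurable_euclidean_norm : measurable_fun setT (@euclidean_norm R n).
Proof.
apply: (measurableT_comp (continuous_measurable_fun (@sqrt_continuous R))).
exact: measurable_dot.
Qed.

Lemma measurable_euclidean_ball (c : R) : measurable [set x : 'cV[R]_n | euclidean_norm x <= c].
Proof.
rewrite (_ : mkset _ = @euclidean_norm R n @^-1` `]-oo, c]); last first.
  by apply/seteqP; split => x /=; rewrite in_itv.
by rewrite -[X in measurable X]setTI; exact: measurable_euclidean_norm.
Qed.

Lemma coord_le_euclidean (x : 'cV[R]_n) i : `|x i ord0| <= euclidean_norm x.
Proof.
rewrite /euclidean_norm -sqrtr_sqr ler_wsqrtr// /dot_cV (bigD1 i)//= -expr2.
by rewrite lerDl sumr_ge0// => j _; rewrite -expr2 sqr_ge0.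
Qed.

Lemma L1_indic_euclidean_ball k : L1 mu (\1_[set x | euclidean_norm x <= k%:R]).
Proof.
pose B : set 'cV[R]_n := boxoc (const_mx (- k%:R - 1)) (const_mx k%:R).
apply: (L1_le _ _ (L1_indic_boxoc (const_mx (- k%:R - 1)) (const_mx k%:R))).
  apply: measurable_indic; exact: measurable_euclidean_ball.
move=> x; rewrite !ger0_norm// !indicE ler_nat; case: (boolP (x \in _)) => //.
rewrite inE/= => xk; rewrite mem_set// => i; rewrite in_itv/= !mxE.
have := le_trans (coord_le_euclidean x i) xk; rewrite ler_norml => /andP[h1 ->].
by rewrite andbT (lt_le_trans _ h1)// ltrBlDr ltrDl.
Qed.

Lemma L2_trunc k h : L2 mu h -> L2 mu (trunc k h).
Proof.
move=> lh; apply: (L2_bounded (C := 1)) => //.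
  by apply: measurable_indic; exact: measurable_euclidean_ball.
by move=> x; rewrite ger0_norm// indic_le1.
Qed.

Lemma L1_trunc k h : L2 mu h -> L1 mu (trunc k h).
Proof.
move=> lh; apply: L2_mul => //; apply: (@L1_bounded_L2 _ _ _ _ 1).
  exact: L1_indic_euclidean_ball.
by move=> x; rewrite ger0_norm// indic_le1.
Qed.

Lemma cvg_trunc h : L2 mu h -> \int[mu]_x (trunc k h x - h x) ^+ 2 @[k --> \oo] --> 0.
Proof.
move=> lh; rewrite [X in _ --> X](_ : 0 = \int[mu]_x (0 : R)); last first.
  by rewrite Rintegral_cst// mul0r.
apply: (@dominated_cvg_Rintegral _ _ _ _ _ _ (fun x => h x ^+ 2)) => //.
- by move=> k; have [m _] := L2B (L2_trunc k lh) lh; exact: measurable_funX.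
- apply/nearW => x; apply: cvg_near_cst.
  exists (Num.truncn `|euclidean_norm x|).+1 => // k /= xk.
  rewrite /trunc indicE mem_set ?mulr1 ?subrr ?expr0n//=.
  apply: (le_trans (ler_norm _)); apply/ltW/(lt_le_trans (truncnS_gt _)).
  by rewrite ler_nat.
- by case: lh.
- move=> k x; rewrite ger0_norm ?sqr_ge0// /trunc indicE; case: (x \in _).
    by rewrite mulr1 subrr expr0n/= sqr_ge0.
  by rewrite mulr0 sub0r sqrrN.
Qed.

Lemma trunc_sub_le k m h : L2 mu h -> (k <= m)%N ->
  \int[mu]_x (trunc m h x - trunc k h x) ^+ 2 <= \int[mu]_x (trunc k h x - h x) ^+ 2.
Proof.
move=> lh km; apply: le_Rintegral => //.
- by case: (L2B (L2_trunc m lh) (L2_trunc k lh)).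
- by case: (L2B (L2_trunc k lh) lh).
move=> x _; rewrite /trunc !indicE /=.
have [xk|xk] := boolP (x \in [set x | euclidean_norm x <= k%:R]).
  rewrite (_ : x \in _ = true) ?mulr1 ?subrr//.
  apply/mem_set; move: xk; rewrite inE/= => xk; apply: (le_trans xk); by rewrite ler_nat.
by case: (x \in _); rewrite ?mulr0 ?mulr1 ?subr0 ?sub0r ?sqrrN ?expr0n ?lexx ?sqr_ge0.
Qed.

(** Provides a transform for a function that comes with none, namely the h of the theorem. By
    [bessel] the transforms of the truncations are Cauchy in L^2. *)
Lemma plancherel_pair_exists h : L2 mu h -> exists hc hs, plancherel_pair h hc hs.
Proof.
move=> lh.
have lt k := L1_trunc k lh; have l2t k := L2_trunc k lh.
have B k m : (k <= m)%N ->
   \int[mu]_xi (fcos (trunc m h) xi - fcos (trunc k h) xi) ^+ 2 +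
   \int[mu]_xi (fsin (trunc m h) xi - fsin (trunc k h) xi) ^+ 2 <=
   \int[mu]_x (trunc k h x - h x) ^+ 2.
  move=> km; apply: le_trans _ (trunc_sub_le lh km).
  have l1 := L1B (lt m) (lt k); have l2 := L2B (l2t m) (l2t k).
  have [b1 b2] := bessel l1 l2; apply: le_trans _ b2.
  rewrite -RintegralD//; last 2 first.
  - by case: (L2B (L2_fcos (lt m) (l2t m)) (L2_fcos (lt k) (l2t k))).
  - by case: (L2B (L2_fsin (lt m) (l2t m)) (L2_fsin (lt k) (l2t k))).
  by under eq_Rintegral do rewrite -fcosB// -fsinB//.
have [hc lhc c1] := @L2_complete _ _ _ mu (fun k => fcos (trunc k h)) _
   (fun k => L2_fcos (lt k) (l2t k)) (cvg_trunc lh)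
   (fun k m km => le_trans (ler_wpDr (L2_sqr_ge0 _ _) (lexx _)) (B k m km)).
have [hs lhs c2] := @L2_complete _ _ _ mu (fun k => fsin (trunc k h)) _
   (fun k => L2_fsin (lt k) (l2t k)) (cvg_trunc lh)
   (fun k m km => le_trans (ler_wpDl (L2_sqr_ge0 _ _) (lexx _)) (B k m km)).
exists hc, hs; apply: (plancherel_pair_limit _ l2t lh lhc lhs (cvg_trunc lh) c1 c2).
by move=> k; exact: plancherel_pair_L1.
Qed.

End transforms.

(** * Spectra of convolutions *)

Section Lfun2.
Context d (T : measurableType d) (R : realType) (mu : {measure set T -> \bar R}).

Lemma L2_Lfun (f : T -> R) : f \in Lfun mu 2%:E -> L2 mu f.
Proof.
move=> lf; split; first by have := lf; rewrite inE => /andP[]; rewrite inE.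
by have := Lfun2_integrable_sqr lf.
Qed.

Lemma Lnorm2E (f : T -> R) : L2 mu f ->
  ('N[mu]_2%:E[EFin \o f] = (Num.sqrt (\int[mu]_x (f x ^+ 2)))%:E)%E.
Proof.
move=> lf; have [mf l2] := lf.
rewrite unlock.
have -> : (\int[mu]_x (`|(EFin \o f) x| `^ 2) = (\int[mu]_x (f x ^+ 2))%:E)%E.
  rewrite EFin_Rintegral//; apply: eq_integral => x _ /=.
  by rewrite powR_mulrn// real_normK// num_real.
by rewrite poweR_EFin powR12_sqrt// L2_sqr_ge0.
Qed.

Lemma Lnorm2_sqr (f : T -> R) : L2 mu f ->
  ('N[mu]_2%:E[EFin \o f] ^+ 2 = (\int[mu]_x (f x ^+ 2))%:E)%E.
Proof.
by move=> lf; rewrite Lnorm2E// -EFin_expe sqr_sqrtr// L2_sqr_ge0.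
Qed.

Lemma Lfun_L2 (f : T -> R) : L2 mu f -> f \in Lfun mu 2%:E.
Proof.
move=> lf; rewrite inE; apply/andP; split; rewrite inE; first by case: lf.
by rewrite /= /finite_norm Lnorm2E// ltry.
Qed.

End Lfun2.

Section spectral.
Context {R : realType} (n : nat).
Local Notation mu := (@lebesgue_cV R n).
Implicit Types (h hc hs w p q psi a b : 'cV[R]_n -> R) (x y xi : 'cV[R]_n).

Lemma L1_cos_phase w theta y : L1 mu w ->
  L1 mu (fun xi => w xi * cos (2 * pi * dot_cV y xi + theta)).
Proof.
move=> lw; apply: (L1_bounded (C := 1)) => //.
  by apply: measurable_cos_comp; exact: measurable_phase.
by move=> x; exact: cos_max.
Qed.

Lemma L1_sin_phase w theta y : L1 mu w ->
  L1 mu (fun xi => w xi * sin (2 * pi * dot_cV y xi + theta)).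
Proof.
move=> lw; apply: (L1_bounded (C := 1)) => //.
  by apply: measurable_sin_comp; exact: measurable_phase.
by move=> x; exact: sin_max.
Qed.

Lemma L2_cos_phase w theta y : L2 mu w ->
  L2 mu (fun xi => w xi * cos (2 * pi * dot_cV y xi + theta)).
Proof.
move=> lw; apply: (L2_bounded (C := 1)) => //.
  by apply: measurable_cos_comp; exact: measurable_phase.
by move=> x; exact: cos_max.
Qed.

Lemma L2_sin_phase w theta y : L2 mu w ->
  L2 mu (fun xi => w xi * sin (2 * pi * dot_cV y xi + theta)).
Proof.
move=> lw; apply: (L2_bounded (C := 1)) => //.
  by apply: measurable_sin_comp; exact: measurable_phase.
by move=> x; exact: sin_max.
Qed.

Lemma L2_expabs_cV (e : R) : 0 < e -> L2 mu (expabs_cV e).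
Proof.
move=> e0; apply: (@L1_bounded_L2 _ _ _ _ 1); first exact: L1_expabs_cV.
by move=> x; rewrite ger0_norm ?expabs_cV_ge0 ?expabs_cV_le1.
Qed.

(* The functions paired with [hc] and [hs] below are transforms of a
   modulated exponential, so that [fcos + fsin] is a translated Poisson kernel. *)
Lemma poisson_pairP h hc hs :
  (forall e y, 0 < e -> L1 mu (fun x => h x * poisson_cV e (x - y))) ->
  (forall w1 w2, L1 mu w1 -> L2 mu w1 -> L1 mu w2 -> L2 mu w2 ->
    \int[mu]_xi (hc xi * w1 xi + hs xi * w2 xi) =
    \int[mu]_y (h y * (fcos w1 y + fsin w2 y))) -> poisson_pair h hc hs.
Proof.
move=> lhP H e y theta e0.
have l1 := L1_expabs_cV n e0; have l2 := L2_expabs_cV e0.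
pose w1 xi := expabs_cV e xi * cos (2 * pi * dot_cV y xi + theta).
pose w2 xi := expabs_cV e xi * sin (2 * pi * dot_cV y xi + theta).
have lw1 : L1 mu w1 by exact: L1_cos_phase.
have lw2 : L1 mu w2 by exact: L1_sin_phase.
transitivity (\int[mu]_xi (hc xi * w1 xi + hs xi * w2 xi)).
  by apply: eq_Rintegral => xi _; rewrite /w1 /w2; ring.
rewrite H//; [|exact: L2_cos_phase|exact: L2_sin_phase].
transitivity (\int[mu]_x (cos theta * (h x * poisson_cV e (x - y)))).
  apply: eq_Rintegral => x _; rewrite mulrCA; congr (_ * _).
  rewrite -poisson_cVN opprB -poisson_cV_transform//.
  rewrite -(RintegralD measurableT (L1_mul_cos x lw1) (L1_mul_sin x lw2)).
  apply: eq_Rintegral => xi _; rewrite /w1 /w2 dot_cVBl (dot_cVC xi).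
  rewrite (_ : 2 * pi * (_ - _) + theta = 2 * pi * dot_cV y xi + theta - 2 * pi * dot_cV x xi).
    by rewrite cosB; ring.
  by ring.
by rewrite (RintegralZl _ measurableT (lhP e y e0)).
Qed.

Lemma measurable_poisson_cV_subr (e : R) y : 0 < e ->
  measurable_fun setT (fun x => poisson_cV e (x - y)).
Proof.
move=> e0; apply: (measurableT_comp (L1_measurable (L1_poisson_cV n e0))).
exact: measurable_cVB.
Qed.

Lemma L1_mul_poisson h (e : R) y : 0 < e -> L1 mu h -> L1 mu (fun x => h x * poisson_cV e (x - y)).
Proof.
move=> e0 lh; apply: (L1_bounded lh _ (fun x => poisson_cV_le (x - y) e0)).
exact: measurable_poisson_cV_subr.
Qed.

Lemma L2_mul_poisson h (e : R) y : 0 < e -> L2 mu h -> L1 mu (fun x => h x * poisson_cV e (x - y)).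
Proof.
move=> e0 lh; apply: L2_mul => //.
have := L2_cV_subl y (L1_bounded_L2 (L1_poisson_cV n e0) (fun x => poisson_cV_le x e0)).
by under eq_fun do rewrite -poisson_cVN opprB.
Qed.

Lemma L2_mul_invsqr h : L2 mu h -> L1 mu (fun x => h x * invsqr_cV x).
Proof.
move=> lh; apply: L2_mul => //; apply: (@L1_bounded_L2 _ _ _ _ 1).
  exact: L1_invsqr_cV.
by move=> x; rewrite ger0_norm ?invsqr_cV_le1// ltW// invsqr_cV_gt0.
Qed.

Lemma L1_mul_invsqr h : L1 mu h -> L1 mu (fun x => h x * invsqr_cV x).
Proof.
move=> lh; apply: (L1_bounded (C := 1)) => //.
  exact/L1_measurable/L1_invsqr_cV.
by move=> x; rewrite ger0_norm ?invsqr_cV_le1// ltW// invsqr_cV_gt0.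
Qed.

(** By the multiplication formula, p forms a Poisson pair with the zero transform, whose inversion
    gives 0. *)
Lemma fourier_injective p : L1 mu p ->
  (forall y, fcos p y = 0) -> (forall y, fsin p y = 0) ->
  {ae mu, forall x, p x = 0}.
Proof.
move=> lp pc ps.
have H : poisson_pair p (fun=> 0) (fun=> 0).
  apply: poisson_pairP => [e y e0|w1 w2 l1 _ l2 _]; first exact: L1_mul_poisson.
  have lc : L1 mu (fun y => p y * fcos w1 y).
    by apply: (L1_bounded lp _ (fun y => fcos_bound y l1)); exact: measurable_fcos.
  have ls : L1 mu (fun y => p y * fsin w2 y).
    by apply: (L1_bounded lp _ (fun y => fsin_bound y l2)); exact: measurable_fsin.
  under [RHS]eq_Rintegral do rewrite mulrDr.
  rewrite (RintegralD measurableT lc ls) -fcos_fubini// -fsin_fubini//.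
  under [X in _ = X + _]eq_Rintegral do rewrite pc mul0r.
  under [X in _ = _ + X]eq_Rintegral do rewrite ps mul0r.
  under eq_Rintegral do rewrite !mul0r addr0.
  by rewrite Rintegral_cst// mul0r addr0.
apply: filterS (@poisson_inversion _ _ _ _ _ 0 (L1_measurable lp) (L1_mul_invsqr lp) (L1_0 mu) (L1_0 mu) H).
move=> x; rewrite cos0 mul1r => <-; rewrite /phase_transform.
under eq_Rintegral do rewrite !mul0r addr0.
by rewrite Rintegral_cst// mul0r.
Qed.

Lemma plancherel_pair_inversion psi a b theta : L2 mu psi ->
  plancherel_pair psi a b -> L1 mu a -> L1 mu b ->
  {ae mu, forall x, phase_transform a b theta x = cos theta * psi x}.
Proof.
move=> lpsi [_ _ H] la lb; apply: poisson_inversion => //.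
- by case: lpsi.
- exact: L2_mul_invsqr.
- by apply: poisson_pairP => // e y e0; exact: L2_mul_poisson.
Qed.

(** The pair on the left is the product (hc - i hs) (a - i b). The functions [w1] and [w2] are
    chosen so that the sum of their transforms at y is the phase transform of (a, b) at x - y, that
    is cos theta psi(x - y) for almost every y. As y is integrated out, the identity holds for every
    x. *)
Lemma convolution_spectral h hc hs psi a b theta x :
  L2 mu h -> L2 mu psi ->
  plancherel_pair h hc hs -> plancherel_pair psi a b -> L1 mu a -> L1 mu b ->
  phase_transform (fun xi => hc xi * a xi - hs xi * b xi)
    (fun xi => hc xi * b xi + hs xi * a xi) theta x =
  cos theta * convolution h psi x.
Proof.
move=> lh lpsi [lhc lhs Hh] Hpsi la lb; have [l2a l2b _] := Hpsi.
pose w1 xi := a xi * cos (2 * pi * dot_cV x xi + theta) +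
              b xi * sin (2 * pi * dot_cV x xi + theta).
pose w2 xi := a xi * sin (2 * pi * dot_cV x xi + theta) -
              b xi * cos (2 * pi * dot_cV x xi + theta).
have lw1 : L1 mu w1 by apply: L1D; [exact: L1_cos_phase|exact: L1_sin_phase].
have lw2 : L1 mu w2 by apply: L1B; [exact: L1_sin_phase|exact: L1_cos_phase].
have l2w1 : L2 mu w1 by apply: L2D; [exact: L2_cos_phase|exact: L2_sin_phase].
have l2w2 : L2 mu w2 by apply: L2B; [exact: L2_sin_phase|exact: L2_cos_phase].
transitivity (\int[mu]_xi (hc xi * w1 xi + hs xi * w2 xi)).
  by apply: eq_Rintegral => xi _; rewrite /w1 /w2; ring.
rewrite Hh// /convolution.
have lhp : L1 mu (fun y => h y * psi (x - y)) by apply: L2_mul => //; exact: L2_cV_subl.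
rewrite -RintegralZl//; apply: ae_eq_Rintegral.
- apply: measurable_funM; first by case: lh.
  by apply: measurable_funD; [exact: measurable_fcos|exact: measurable_fsin].
- exact: (L1_measurable (L1Z (cos theta) lhp)).
apply: filterS (ae_cV_subl x (plancherel_pair_inversion theta lpsi Hpsi la lb)) => y.
rewrite mulrCA => <-; congr (_ * _).
rewrite -(RintegralD measurableT (L1_mul_cos y lw1) (L1_mul_sin y lw2)).
apply: eq_Rintegral => xi _; rewrite /w1 /w2 dot_cVBl (dot_cVC xi).
rewrite (_ : 2 * pi * (dot_cV x xi - dot_cV y xi) + theta =
   2 * pi * dot_cV x xi + theta - 2 * pi * dot_cV y xi); last by ring.
by rewrite cosB sinB; ring.
Qed.

(** Convergence of the modulus in L^2 is convergence of both components. The minus sign reflects the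
    convention that a pair (hc, hs) stands for hc - i hs. *)
Lemma plancherel_pair_fourier h (g : 'cV[R]_n -> R[i]) : L2 mu h ->
  is_fourier h g ->
  plancherel_pair h (fun xi => complex.Re (g xi)) (fun xi => - complex.Im (g xi)).
Proof.
move=> lh [/L2_Lfun lr /L2_Lfun li cg].
have lt k := L1_trunc k lh; have l2t k := L2_trunc k lh.
have lc k := L2_fcos (lt k) (l2t k); have ls k := L2_fsin (lt k) (l2t k).
have lu k := L2B (lc k) lr; have lv k := L2B (ls k) (L2N li).
pose D k := \int[mu]_xi ((fcos (trunc k h) xi - complex.Re (g xi)) ^+ 2 +
   (fsin (trunc k h) xi - - complex.Im (g xi)) ^+ 2).
have DE k : D k = \int[mu]_xi ((fcos (trunc k h) xi - complex.Re (g xi)) ^+ 2) +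
   \int[mu]_xi ((fsin (trunc k h) xi - - complex.Im (g xi)) ^+ 2).
  by rewrite /D RintegralD//; [case: (lu k)|case: (lv k)].
have cD : D k @[k --> \oo] --> 0.
  pose N k xi := ComplexField.Normc.normc (fourier (h \_ [set x | euclidean_norm x <= k%:R]) xi - g xi).
  have tE k : h \_ [set x | euclidean_norm x <= k%:R] = trunc k h.
    apply/funext => x; rewrite /trunc /patch indicE.
    by case: ifP => _; rewrite ?mulr1 ?mulr0.
  have NE0 k xi : N k xi = Num.sqrt ((fcos (trunc k h) xi - complex.Re (g xi)) ^+ 2 +
      (fsin (trunc k h) xi - - complex.Im (g xi)) ^+ 2).
    rewrite /N /ComplexField.Normc.normc /fourier tE; case: (g xi) => a b /=.
    by congr Num.sqrt; rewrite -/(fcos _ xi) -/(fsin _ xi); ring.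
  have NE k xi : N k xi ^+ 2 = (fcos (trunc k h) xi - complex.Re (g xi)) ^+ 2 +
      (fsin (trunc k h) xi - - complex.Im (g xi)) ^+ 2.
    by rewrite NE0 sqr_sqrtr ?addr_ge0 ?sqr_ge0.
  have mN k : measurable_fun setT (N k).
    rewrite (funext (NE0 k)).
    apply: (measurableT_comp (continuous_measurable_fun (@sqrt_continuous R))).
    by apply: measurable_funD; apply: measurable_funX; [case: (lu k)|case: (lv k)].
  have lN k : L2 mu (N k).
    by split => //; apply: eq_L1 (L1D (lu k).2 (lv k).2) => xi; rewrite NE.
  have : (Num.sqrt (D k))%:E @[k --> \oo] --> 0%E.
    rewrite (_ : (fun k => _) = (fun k => Lnorm mu 2%:E (EFin \o N k))); first exact: cg.
    apply/funext => k; rewrite Lnorm2E//; congr (Num.sqrt _)%:E.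
    by apply: eq_Rintegral => xi _; rewrite NE.
  move=> /fine_cvgP[_ c0].
  rewrite (_ : D = (fun k => Num.sqrt (D k) * Num.sqrt (D k))).
    by rewrite -[X in _ --> X](mulr0 0); exact: cvgM.
  apply/funext => k; rewrite -expr2 sqr_sqrtr// DE addr_ge0 ?L2_sqr_ge0//.
apply: (plancherel_pair_limit _ l2t lh lr (L2N li) (cvg_trunc lh)).
- by move=> k; exact: plancherel_pair_L1.
- apply: (squeeze_cvgr _ (cvg_cst 0) cD); apply/nearW => k.
  by rewrite L2_sqr_ge0 DE lerDl L2_sqr_ge0.
- apply: (squeeze_cvgr _ (cvg_cst 0) cD); apply/nearW => k.
  by rewrite L2_sqr_ge0 DE lerDr L2_sqr_ge0.
Qed.

End spectral.

(** * Sampling of trigonometric integrals *)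

Section bernstein.
Context {R : realType}.
Implicit Types (y : R) (phi psi : nat -> R) (r : R -> R).

(* The expectation of [phi] under the binomial distribution with parameters
   [n] and [y]; [r] being sampled at [k / n], it is a Bernstein polynomial. *)
Fixpoint binomial_mean y n phi : R :=
  if n is n'.+1 then (1 - y) * binomial_mean y n' phi +
                     y * binomial_mean y n' (fun k => phi k.+1)
  else phi 0%N.

Lemma binomial_mean_cst y n (c : R) : binomial_mean y n (fun=> c) = c.
Proof. by elim: n => //= n ->; ring. Qed.

Lemma binomial_meanD y n phi psi :
  binomial_mean y n (fun k => phi k + psi k) = binomial_mean y n phi + binomial_mean y n psi.
Proof. by elim: n phi psi => //= n ih phi psi; rewrite !ih; ring. Qed.

Lemma binomial_meanZ y n (c : R) phi :
  binomial_mean y n (fun k => c * phi k) = c * binomial_mean y n phi.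
Proof. by elim: n phi => //= n ih phi; rewrite !ih; ring. Qed.

Lemma le_binomial_mean y n phi psi : 0 <= y <= 1 -> (forall k, phi k <= psi k) ->
  binomial_mean y n phi <= binomial_mean y n psi.
Proof.
move=> /andP[y0 y1]; elim: n phi psi => //= n ih phi psi H.
by apply: lerD; rewrite ler_wpM2l ?subr_ge0// ih.
Qed.

Lemma binomial_mean_bound y n phi (C : R) : 0 <= y <= 1 -> (forall k, `|phi k| <= C) ->
  `|binomial_mean y n phi| <= C.
Proof.
move=> y01 H; rewrite ler_norml -{1}(binomial_mean_cst y n (- C)) -{2}(binomial_mean_cst y n C).
by apply/andP; split; apply: le_binomial_mean => // k; have := H k; rewrite ler_norml => /andP[].
Qed.

(** Variance plus squared bias. The centre c is arbitrary because a success in one trial shifts it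
    by 1 in the induction. *)
Lemma binomial_mean_sqr y n (c : R) :
  binomial_mean y n (fun k => (k%:R - c) ^+ 2) = n%:R * (y * (1 - y)) + (n%:R * y - c) ^+ 2.
Proof.
elim: n c => [c|n ih c] /=; first by ring.
rewrite ih (_ : (fun k => (k.+1%:R - c) ^+ 2) = fun k => (k%:R - (c - 1)) ^+ 2 :> R).
  by rewrite ih -natr1; ring.
by apply/funext => k; rewrite -natr1; ring.
Qed.

Lemma binomial_mean0 n phi : binomial_mean 0 n phi = phi 0%N.
Proof. by elim: n phi => //= n ih phi; rewrite !ih; ring. Qed.

Lemma binomial_mean1 n phi : binomial_mean 1 n phi = phi n.
Proof. by elim: n phi => //= n ih phi; rewrite !ih; ring. Qed.

(** The degree is [n.+1], so that the division in the nodes is never by 0. *)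
Definition bernstein r n y := binomial_mean y n.+1 (fun k => r (k%:R / n.+1%:R)).

(** Bernstein's argument through Chebyshev's inequality. At 0 and 1 the approximation is exact,
    which is why continuity is asked only inside the interval. *)
Lemma cvg_bernstein r (C : R) y : (forall z, `|r z| <= C) -> 0 <= y <= 1 ->
  (0 < y < 1 -> {for y, continuous r}) ->
  bernstein r n y @[n --> \oo] --> r y.
Proof.
move=> rC y01 rc.
have [->|y0] := eqVneq y 0.
  by apply: cvg_near_cst; apply/nearW => n; rewrite /bernstein binomial_mean0 mul0r.
have [->|y1] := eqVneq y 1.
  apply: cvg_near_cst; apply/nearW => n; rewrite /bernstein binomial_mean1 divff//.
have {}rc : {for y, continuous r} by apply: rc; rewrite !lt_neqAle eq_sym y0 y1.
apply/cvgrPdist_le => e e0.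
have /cvgrPdist_le/(_ (e / 2)) := rc.
rewrite divr_gt0// => /(_ isT) /nbhs_ballP[dl /= dl0 H].
have C0 : 0 <= C by exact: le_trans (normr_ge0 _) (rC 0).
(* Continuity covers the z close to y and boundedness the others; the quadratic term has mean of
   order 1 / n. *)
have B z : `|r z - r y| <= e / 2 + 2 * C / dl ^+ 2 * (z - y) ^+ 2.
  have [zy|zy] := ltP `|y - z| dl.
    apply: ler_wpDr; last by rewrite distrC H.
    by rewrite mulr_ge0 ?sqr_ge0// divr_ge0 ?sqr_ge0// mulr_ge0.
  apply: ler_wpDl; first by rewrite divr_ge0// ltW.
  apply: (@le_trans _ _ (2 * C)).
    by apply: le_trans (ler_normB _ _) _; have := rC z; have := rC y; lra.
  rewrite -mulrA ler_peMr ?mulr_ge0// mulrC ler_pdivlMr ?exprn_gt0// mul1r.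
  rewrite -(real_normK (num_real (z - y))) distrC.
  by rewrite ler_pXn2r// nnegrE// ltW.
have B2 n : `|r y - bernstein r n y| <= e / 2 + 2 * C / dl ^+ 2 / n.+1%:R.
  rewrite distrC /bernstein; set N := n.+1.
  have -> : binomial_mean y N (fun k => r (k%:R / N%:R)) - r y =
            binomial_mean y N (fun k => r (k%:R / N%:R) - r y).
    by rewrite binomial_meanD binomial_mean_cst.
  have E : e / 2 + 2 * C / dl ^+ 2 / N%:R * (y * (1 - y)) =
      binomial_mean y N (fun k => e / 2 + 2 * C / dl ^+ 2 * (k%:R / N%:R - y) ^+ 2).
    rewrite binomial_meanD binomial_mean_cst binomial_meanZ.
    rewrite (_ : (fun k => (k%:R / N%:R - y) ^+ 2) =
       fun k => N%:R ^- 2 * (k%:R - N%:R * y) ^+ 2).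
      rewrite binomial_meanZ binomial_mean_sqr subrr expr0n addr0.
      congr (_ + _); rewrite -!mulrA; congr (_ * (_ * (_ * _))).
      have : N%:R != 0 :> R by rewrite pnatr_eq0.
      by move=> ?; field.
    apply/funext => k; have : N%:R != 0 :> R by rewrite pnatr_eq0.
    by move=> ?; field.
  have le1 : y * (1 - y) <= 1 by move/andP: y01 => [? ?]; nra.
  apply: (@le_trans _ _ (e / 2 + 2 * C / dl ^+ 2 / N%:R * (y * (1 - y)))).
    rewrite E ler_norml -mulN1r -binomial_meanZ; apply/andP; split.
      apply: le_binomial_mean => // k; have := B (k%:R / N%:R).
      by rewrite ler_norml mulN1r => /andP[].
    apply: le_binomial_mean => // k; have := B (k%:R / N%:R).
    by rewrite ler_norml => /andP[].
  rewrite lerD2l ler_piMr// divr_ge0// divr_ge0 ?sqr_ge0//; exact: mulr_ge0.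
have c0 : 2 * C / dl ^+ 2 / n.+1%:R @[n --> \oo] --> (0 : R).
  rewrite -[X in _ --> X](mulr0 (2 * C / dl ^+ 2)); apply: cvgM; first exact: cvg_cst.
  exact: cvg_harmonic.
have e2 : 0 < e / 2 by rewrite divr_gt0.
move/cvgrPdist_le : c0 => /(_ (e / 2) e2); apply: filterS => n.
rewrite sub0r normrN => H1.
by apply: le_trans (B2 n) _; rewrite [leRHS]splitr lerD2l (le_trans (ler_norm _)).
Qed.

Lemma bernstein_bound r n (C y : R) : (forall z, `|r z| <= C) -> 0 <= y <= 1 ->
  `|bernstein r n y| <= C.
Proof. by move=> rC y01; exact: binomial_mean_bound. Qed.

End bernstein.

Section trigonometric_identities.
Context {R : realType}.
Implicit Types a b : R.

(** With b = pi z, multiplication by cos^2 b sends frequency n to a combination of the frequencies n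
    and n + 1, n - 1, so that it preserves vanishing at all integers. *)
Lemma cos_mul_sqr_cos a b :
  cos a * cos b ^+ 2 = 2^-1 * cos a + 4^-1 * (cos (a + (b + b)) + cos (a - (b + b))).
Proof.
have := cos2Dsin2 b; rewrite cosB cosD cosD sinD.
move: (cos b) (sin b) => c s cs.
have -> : s * s = 1 - c ^+ 2 by rewrite -expr2 -cs; ring.
by field.
Qed.

End trigonometric_identities.

Section sampling.
Context d (T : measurableType d) (R : realType) (mu : {measure set T -> \bar R}).
Implicit Types (P Q zeta y : T -> R) (r : R -> R).

(** The integrals against polynomials in y vanish, in particular against Bernstein polynomials,
    which converge boundedly to r. Boundedness of r replaces uniform convergence. *)
Lemma moments_eq0 P y r (C : R) : L1 mu P -> measurable_fun setT y ->
  (forall x, 0 <= y x <= 1) ->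
  (forall m : nat, \int[mu]_x (P x * y x ^+ m) = 0) ->
  (forall z, `|r z| <= C) -> (forall z, 0 < z < 1 -> {for z, continuous r}) ->
  measurable_fun setT (fun x => r (y x)) ->
  \int[mu]_x (P x * r (y x)) = 0.
Proof.
move=> lP my y01 mom rC rc mr.
have mP := L1_measurable lP.
have lPy m : L1 mu (fun x => P x * y x ^+ m).
  apply: (L1_bounded (C := 1)) => //; first exact: measurable_funX.
  move=> x; have /andP[y0 y1] := y01 x.
  by rewrite normrX ger0_norm// exprn_ile1.
(* The factor y^m is carried along because unfolding [binomial_mean] produces factors 1 - y and
   y. *)
have H n : forall phi m, L1 mu (fun x => P x * y x ^+ m * binomial_mean (y x) n phi) /\
   \int[mu]_x (P x * y x ^+ m * binomial_mean (y x) n phi) = 0.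
  elim: n => [phi m|n ih phi m] /=.
    split; first by apply: eq_L1 (L1Z (phi 0%N) (lPy m)) => x; rewrite mulrC.
    by rewrite (RintegralZr _ measurableT (lPy m)) mom mul0r.
  have [l1 i1] := ih phi m; have [l2 i2] := ih phi m.+1.
  have [l3 i3] := ih (fun k => phi k.+1) m.+1.
  have E x : P x * y x ^+ m * binomial_mean (y x) n phi
    - P x * y x ^+ m.+1 * binomial_mean (y x) n phi +
    P x * y x ^+ m.+1 * binomial_mean (y x) n (fun k => phi k.+1) =
     P x * y x ^+ m * ((1 - y x) * binomial_mean (y x) n phi +
                     y x * binomial_mean (y x) n (fun k => phi k.+1)).
    by rewrite exprS; ring.
  split; first by apply: eq_L1 (L1D (L1B l1 l2) l3).
  rewrite -(funext E) (RintegralD measurableT (L1B l1 l2) l3).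
  by rewrite (RintegralB measurableT l1 l2) i1 i2 i3 subr0 addr0.
have Hb n : L1 mu (fun x => P x * bernstein r n (y x)) /\
    \int[mu]_x (P x * bernstein r n (y x)) = 0.
  have [l i] := H n.+1 (fun k => r (k%:R / n.+1%:R)) 0%N; split.
    by apply: eq_L1 l => x; rewrite expr0 mulr1.
  by rewrite -[RHS]i; apply: eq_Rintegral => x _; rewrite expr0 mulr1.
have c : \int[mu]_x (P x * bernstein r n (y x)) @[n --> \oo] --> \int[mu]_x (P x * r (y x)).
  apply: (@dominated_cvg_Rintegral _ _ _ _ _ _ (fun x => `|P x| * C)).
  - by move=> n; have [l _] := Hb n; exact: L1_measurable l.
  - exact: measurable_funM.
  - apply/nearW => x; apply: cvgM; first exact: cvg_cst.
    exact: (cvg_bernstein rC (y01 x) (rc (y x))).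
  - by apply: eq_L1 (L1Z C (L1_norm lP)) => x; rewrite mulrC.
  - by move=> n x; rewrite normrM ler_wpM2l// bernstein_bound.
have := cvg_lim (@Rhausdorff R) c.
rewrite (_ : (fun n => _) = fun=> 0); last by apply/funext => n; have [] := Hb n.
by rewrite lim_cst// => <-.
Qed.

Lemma measurable_cos2_pi zeta : measurable_fun setT zeta ->
  measurable_fun setT (fun x => cos (pi * zeta x) ^+ 2).
Proof.
by move=> mz; apply: measurable_funX; apply: measurable_cos_comp; exact: measurable_funM.
Qed.

Lemma cos2_itv01 (a : R) : 0 <= cos a ^+ 2 <= 1.
Proof. by rewrite sqr_ge0 -[leRHS](expr1n _ 2) sqr_le_norm// cos_max. Qed.

(** Induction on m through [cos_mul_sqr_cos], for all n simultaneously. The phase c is 0 for cosines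
    and - pi / 2 for sines. *)
Lemma phase_moments P zeta (c : R) : L1 mu P -> measurable_fun setT zeta ->
  (forall n : int, \int[mu]_x (P x * cos (2 * pi * (n%:~R * zeta x) + c)) = 0) ->
  forall (m : nat) (n : int),
  \int[mu]_x (P x * cos (2 * pi * (n%:~R * zeta x) + c) * cos (pi * zeta x) ^+ 2 ^+ m) = 0.
Proof.
move=> lP mz H; pose y x := cos (pi * zeta x) ^+ 2.
have my : measurable_fun setT y by exact: measurable_cos2_pi.
have lPc (s : R) : L1 mu (fun x => P x * cos (2 * pi * (s * zeta x) + c)).
  apply: (L1_bounded (C := 1)) => //; last by move=> x; exact: cos_max.
  apply: measurable_cos_comp; apply: measurable_funD => //.
  by do 2 apply: measurable_funM => //.
have lPy m (s : R) : L1 mu (fun x => P x * cos (2 * pi * (s * zeta x) + c) * y x ^+ m).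
  apply: (L1_bounded (C := 1)) => //; first exact: measurable_funX.
  move=> x; have /andP[y0 y1] := cos2_itv01 (pi * zeta x).
  by rewrite normrX ger0_norm// exprn_ile1.
elim=> [n|m ih n].
  by rewrite -[RHS](H n); apply: eq_Rintegral => x _; rewrite expr0 mulr1.
pose F (k : int) x := P x * cos (2 * pi * (k%:~R * zeta x) + c) * y x ^+ m.
have lF k : L1 mu (F k) by exact: lPy.
transitivity (\int[mu]_x (2^-1 * F n x + 4^-1 * (F (n + 1) x + F (n - 1) x))).
  apply: eq_Rintegral => x _; rewrite /F exprS.
  rewrite [LHS](_ : _ = P x * y x ^+ m *
    (cos (2 * pi * (n%:~R * zeta x) + c) * cos (pi * zeta x) ^+ 2)); last by rewrite /y; ring.
  rewrite cos_mul_sqr_cos.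
  rewrite (_ : _ + (pi * zeta x + _) = 2 * pi * ((n + 1)%:~R * zeta x) + c); last first.
    by rewrite rmorphD /=; move: (@pi R) => p; ring.
  rewrite (_ : _ - (pi * zeta x + _) = 2 * pi * ((n - 1)%:~R * zeta x) + c); last first.
    by rewrite rmorphB /=; move: (@pi R) => p; ring.
  by ring.
rewrite (RintegralD measurableT (L1Z _ (lF n)) (L1Z _ (L1D (lF _) (lF _)))).
rewrite (RintegralZl _ measurableT (lF n)) (RintegralZl _ measurableT (L1D (lF _) (lF _))).
by rewrite (RintegralD measurableT (lF _) (lF _)) !ih !addr0 !mulr0 addr0.
Qed.

Lemma acos_sqrt_cos2 (z : R) : `|z| < 2^-1 ->
  acos (Num.sqrt (cos (pi * z) ^+ 2)) = pi * `|z|.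
Proof.
move=> z1.
have p0 := @pi_gt0 R.
have zx : - (pi / 2) <= pi * z <= pi / 2.
  by have := ltW z1; rewrite ler_norml -mulrN !ler_pM2l.
rewrite sqrtr_sqr ger0_norm ?cos_ge0_pihalf//.
rewrite -cos_norm cosK ?normrM ?(ger0_norm (ltW p0))//.
rewrite in_itv/= mulr_ge0 ?(ltW p0)//= ler_piMr// ?(ltW p0)// ltW// (lt_trans z1)//; lra.
Qed.

Lemma continuous_acos_sqrt (z : R) : 0 < z < 1 ->
  {for z, continuous (fun z => acos (Num.sqrt z))}.
Proof.
move=> /andP[z0 z1]; apply: continuous_comp; first exact: sqrt_continuous.
apply: continuous_acos; rewrite (@lt_le_trans _ _ 0) ?sqrtr_ge0//=.
by rewrite -[ltRHS]sqrtr1 ltr_sqrt.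
Qed.

(* Each [cos (2 pi n z)] is a polynomial in [cos (pi z) ^ 2], and, for |z| < 1/2
   and real t, [cos (2 pi t z)] is a bounded function of [cos (pi z) ^ 2],
   continuous inside [0, 1]; Bernstein polynomials are exact at 0 and 1. *)
Lemma cos_sampling P zeta : L1 mu P -> measurable_fun setT zeta ->
  (forall x, `|zeta x| < 2^-1) ->
  (forall n : int, \int[mu]_x (P x * cos (2 * pi * (n%:~R * zeta x))) = 0) ->
  forall t : R, \int[mu]_x (P x * cos (2 * pi * (t * zeta x))) = 0.
Proof.
move=> lP mz z1 H t.
have mom := @phase_moments P zeta 0 lP mz.
pose y x := cos (pi * zeta x) ^+ 2.
pose r z := cos (2 * t * acos (Num.sqrt z)).
have rE x : r (y x) = cos (2 * pi * (t * zeta x)).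
  rewrite /r acos_sqrt_cos2// -cos_norm -[RHS]cos_norm; congr cos.
  by rewrite !normrM normr_id; ring.
transitivity (\int[mu]_x (P x * r (y x))).
  by apply: eq_Rintegral => x _; rewrite rE.
apply: (@moments_eq0 P y r 1) => //.
- exact: measurable_cos2_pi.
- by move=> x; exact: cos2_itv01.
- move=> m; rewrite -[RHS](mom _ m 0); last first.
    by move=> n; rewrite -[RHS](H n); apply: eq_Rintegral => x _; rewrite addr0.
  by apply: eq_Rintegral => x _; rewrite mul0r mulr0 addr0 cos0 mulr1.
- by move=> z; exact: cos_max.
- move=> z z01; apply: continuous_comp; last exact: continuous_cos.
  by apply: cvgM; [exact: cvg_cst|exact: continuous_acos_sqrt].
- rewrite (funext rE); apply: measurable_cos_comp.
  by do 2 apply: measurable_funM => //.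
Qed.

(* The quotient of [sin (2 pi t z)] by [sin (2 pi z)] is a function of
   [cos (pi z) ^ 2], but unbounded near |z| = 1/2: the parameter [e] in the proof
   regularizes it. *)
Lemma sin_sampling Q zeta : L1 mu Q -> measurable_fun setT zeta ->
  (forall x, `|zeta x| < 2^-1) ->
  (forall n : int, \int[mu]_x (Q x * sin (2 * pi * (n%:~R * zeta x))) = 0) ->
  forall t : R, \int[mu]_x (Q x * sin (2 * pi * (t * zeta x))) = 0.
Proof.
move=> lQ mz z1 H t.
have ms (s : R) : measurable_fun setT (fun x => sin (2 * pi * (s * zeta x))).
  by apply: measurable_sin_comp; do 2 apply: measurable_funM => //.
have lQs (s : R) : L1 mu (fun x => Q x * sin (2 * pi * (s * zeta x))).
  by apply: (L1_bounded (C := 1)) => // x; exact: sin_max.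
pose s1 x := sin (2 * pi * (1 * zeta x)).
have ms1 : measurable_fun setT s1 by exact: ms.
(* The factor after Q is bounded by 1 and tends to sin (2 pi t z) as e tends to 0 wherever [s1] is
   nonzero. *)
pose P (e : R) x := Q x * (s1 x * (sin (2 * pi * (t * zeta x)) * s1 x / (s1 x ^+ 2 + e))).
have s1E x : s1 x = sin (2 * pi * zeta x) by rewrite /s1 mul1r.
(* Where [s1] vanishes, the bound |z| < 1/2 leaves only z = 0, at which the limit sin (2 pi t z)
   vanishes too. *)
have s1_0 x : s1 x = 0 -> zeta x = 0.
  have p0 := @pi_gt0 R; have := z1 x; rewrite s1E ltr_norml => /andP[l1 l2] s0.
  have [z0|z0|//] := ltgtP (zeta x) 0.
    have : 0 < sin (- (2 * pi * zeta x)) by apply: sin_gt0_pi; nra.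
    by rewrite sinN s0 oppr0 ltxx.
  have : 0 < sin (2 * pi * zeta x) by apply: sin_gt0_pi; nra.
  by rewrite s0 ltxx.
have b1 (e : R) x : 0 < e ->
   `|s1 x * (sin (2 * pi * (t * zeta x)) * s1 x / (s1 x ^+ 2 + e))| <= 1.
  move=> e0; have se : 0 < s1 x ^+ 2 + e by rewrite ltr_wpDl ?sqr_ge0.
  rewrite (_ : _ * _ = sin (2 * pi * (t * zeta x)) * (s1 x ^+ 2 / (s1 x ^+ 2 + e))); last by ring.
  rewrite normrM mulr_ile1 ?sin_max//.
  rewrite ger0_norm ?divr_ge0 ?sqr_ge0 ?(ltW se)// ler_pdivrMr// mul1r lerDl ltW//.
have E (e : R) : 0 < e -> L1 mu (P e) /\ \int[mu]_x P e x = 0.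
  move=> e0.
  pose r z := let u := acos (Num.sqrt z) in
    sin (2 * t * u) * sin (2 * u) / (sin (2 * u) ^+ 2 + e).
  pose y x := cos (pi * zeta x) ^+ 2.
  have rE x : r (y x) = sin (2 * pi * (t * zeta x)) * s1 x / (s1 x ^+ 2 + e).
    rewrite /r/= acos_sqrt_cos2// s1E.
    rewrite [_ * `|zeta x|](_ : _ = `|pi * zeta x|); last first.
      by rewrite normrM (ger0_norm (pi_ge0 R)).
    case: (ger0P (pi * zeta x)) => _.
      by rewrite !mulrA (mulrAC 2 t).
    rewrite !mulrN !sinN mulrNN sqrrN.
    by rewrite !mulrA (mulrAC 2 t).
  have se z : 0 < sin z ^+ 2 + e :> R by rewrite ltr_wpDl ?sqr_ge0.
  have mr : measurable_fun setT (fun x => r (y x)).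
    rewrite (funext rE); apply: measurable_funM; first exact: measurable_funM.
    have ci : continuous (fun u : R => (u ^+ 2 + e)^-1).
      move=> u; apply: cvgV; first by rewrite gt_eqF// ltr_wpDl ?sqr_ge0.
      by apply: cvgD; [exact: exprn_continuous|exact: cvg_cst].
    exact: (measurableT_comp (continuous_measurable_fun ci) ms1).
  split.
    apply: (L1_bounded (C := 1)) => //; last by move=> x; exact: b1.
    by apply: measurable_funM => //; rewrite -(funext rE).
  transitivity (\int[mu]_x (Q x * s1 x * r (y x))).
    by apply: eq_Rintegral => x _; rewrite rE /P !mulrA.
  apply: (@moments_eq0 (fun x => Q x * s1 x) y r e^-1) => //.
  - exact: lQs.
  - exact: measurable_cos2_pi.
  - by move=> x; exact: cos2_itv01.
  (* sin (2 pi z) is the cosine of frequency 1 with phase - pi / 2, so the moments of Q [s1] are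
     those given by [phase_moments] with n = 1. *)
  - move=> m; rewrite -[RHS](@phase_moments Q zeta (- (pi / 2)) lQ mz _ m 1); last first.
      by move=> n; rewrite -[RHS](H n); apply: eq_Rintegral => x _; rewrite cosBpihalf.
    by apply: eq_Rintegral => x _; rewrite cosBpihalf.
  - move=> z; rewrite /r/=; set u := acos _.
    rewrite normrM -[leRHS]mul1r ler_pM ?normr_ge0//.
      by rewrite normrM mulr_ile1 ?sin_max.
    rewrite normfV (ger0_norm (ltW (se _))) lef_pV2 ?posrE//.
    by rewrite lerDr sqr_ge0.
  - move=> z z01; have ca := continuous_acos_sqrt z01.
    have cs (a : R) : {for z, continuous (fun z => sin (a * acos (Num.sqrt z)))}.
      apply: continuous_comp; last exact: continuous_sin.
      by apply: cvgM; [exact: cvg_cst|exact: ca].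
    apply: cvgM; first exact: (cvgM (cs _) (cs _)).
    apply: cvgV; first by rewrite gt_eqF.
    apply: cvgD; last exact: cvg_cst.
    by rewrite expr2; exact: (cvgM (cs _) (cs _)).
have c : \int[mu]_x P n.+1%:R^-1 x @[n --> \oo] --> \int[mu]_x (Q x * sin (2 * pi * (t * zeta x))).
  apply: (@dominated_cvg_Rintegral _ _ _ _ _ _ (fun x => `|Q x|)).
  - by move=> n; have [|l _] := E n.+1%:R^-1; [rewrite invr_gt0|exact: L1_measurable l].
  - exact: L1_measurable (lQs t).
  - apply/nearW => x; apply: cvgM; first exact: cvg_cst.
    have [s0|s0] := eqVneq (s1 x) 0.
      have z0 := s1_0 x s0; under eq_fun do rewrite s0 mul0r.
      by rewrite z0 mulr0 mulr0 sin0; exact: cvg_cst.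
    set a := sin _.
    rewrite [X in _ --> X](_ : a = s1 x * (a * s1 x / (s1 x ^+ 2 + 0))); last by field.
    apply: cvgM; first exact: cvg_cst.
    apply: cvgM; first exact: cvg_cst.
    apply: cvgV; first by rewrite addr0 expf_neq0.
    by apply: cvgD; [exact: cvg_cst|exact: cvg_harmonic].
  - exact: L1_norm.
  - by move=> n x; rewrite normrM ler_piMr// b1// invr_gt0.
have := cvg_lim (@Rhausdorff R) c.
rewrite (_ : (fun n => _) = fun=> 0); last first.
  by apply/funext => n; have [] := E n.+1%:R^-1; rewrite ?invr_gt0.
by rewrite lim_cst// => <-.
Qed.

(* The hypotheses for [n] and [- n] separate the cosines from the sines. *)
Lemma phase_sampling P Q zeta : L1 mu P -> L1 mu Q -> measurable_fun setT zeta ->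
  (forall x, P x != 0 \/ Q x != 0 -> `|zeta x| < 2^-1) ->
  (forall n : int, \int[mu]_x (P x * cos (2 * pi * (n%:~R * zeta x)) +
                              Q x * sin (2 * pi * (n%:~R * zeta x))) = 0) ->
  forall t : R, \int[mu]_x (P x * cos (2 * pi * (t * zeta x)) +
                           Q x * sin (2 * pi * (t * zeta x))) = 0.
Proof.
move=> lP lQ mz sz H t.
(* Changing [zeta] where P and Q both vanish affects no integral and makes the bound 1/2 hold
   everywhere. *)
pose z1 x := if `|zeta x| < 2^-1 then zeta x else 0.
have z1lt x : `|z1 x| < 2^-1 by rewrite /z1; case: ifP => //; rewrite normr0 invr_gt0.
have mz1 : measurable_fun setT z1.
  apply: measurable_fun_ifT => //.
  by apply: measurable_fun_ltr => //; exact: measurableT_comp.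
have lc (s : R) : L1 mu (fun x => P x * cos (2 * pi * (s * z1 x))).
  apply: (L1_bounded (C := 1)) => //; last by move=> x; exact: cos_max.
  by apply: measurable_cos_comp; do 2 apply: measurable_funM => //.
have ls (s : R) : L1 mu (fun x => Q x * sin (2 * pi * (s * z1 x))).
  apply: (L1_bounded (C := 1)) => //; last by move=> x; exact: sin_max.
  by apply: measurable_sin_comp; do 2 apply: measurable_funM => //.
have E (s : R) : \int[mu]_x (P x * cos (2 * pi * (s * zeta x)) + Q x * sin (2 * pi * (s * zeta x))) =
    \int[mu]_x (P x * cos (2 * pi * (s * z1 x))) + \int[mu]_x (Q x * sin (2 * pi * (s * z1 x))).
  rewrite -(RintegralD measurableT (lc s) (ls s)); apply: eq_Rintegral => x _.
  have [P0|P0] := eqVneq (P x) 0; last by rewrite /z1 ifT//; apply: sz; left.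
  have [Q0|Q0] := eqVneq (Q x) 0; first by rewrite P0 Q0 !mul0r.
  by rewrite /z1 ifT//; apply: sz; right.
have {}H (n : int) := H n; rewrite E.
have cN (n : int) : \int[mu]_x (P x * cos (2 * pi * ((- n)%:~R * z1 x))) =
  \int[mu]_x (P x * cos (2 * pi * (n%:~R * z1 x))).
  by apply: eq_Rintegral => x _; rewrite rmorphN/= mulNr mulrN cosN.
have sN (n : int) : \int[mu]_x (Q x * sin (2 * pi * ((- n)%:~R * z1 x))) =
  - \int[mu]_x (Q x * sin (2 * pi * (n%:~R * z1 x))).
  rewrite -[RHS]mulN1r -(RintegralZl _ measurableT (ls _)).
  by apply: eq_Rintegral => x _; rewrite rmorphN/= mulNr mulrN sinN mulN1r mulrN.
have H0 (n : int) : \int[mu]_x (P x * cos (2 * pi * (n%:~R * z1 x))) = 0 /\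
    \int[mu]_x (Q x * sin (2 * pi * (n%:~R * z1 x))) = 0.
  have := H n; have := H (- n); rewrite !E cN sN; split; lra.
by rewrite cos_sampling// ?sin_sampling ?addr0// => n; have [] := H0 n.
Qed.

End sampling.

(** * Analyticity of trigonometric integrals *)

Section calculus.
Context {R : realType}.
Implicit Types (t h u : R) (f : R -> R).

Lemma sin_lipschitz u v : `|sin u - sin v| <= `|u - v|.
Proof.
wlog uv : u v / v <= u.
  by move=> H; have [/H//|/ltW/H] := leP v u; rewrite distrC (distrC v).
have [c _ ->] := @MVT_segment R sin cos v u uv
  (fun z _ => is_derive_sin z) (continuous_subspaceT (@continuous_sin R)).
by rewrite normrM ler_piMl// cos_max.
Qed.

Lemma cos_lipschitz u v : `|cos u - cos v| <= `|u - v|.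
Proof.
rewrite -!sinDpihalf (le_trans (sin_lipschitz _ _))//.
by rewrite opprD addrACA subrr addr0.
Qed.

Lemma one_sub_cos_le (x : R) : `|cos x - 1| <= x ^+ 2 / 2.
Proof.
have -> : cos x - 1 = - (2 * sin (x / 2) ^+ 2).
  rewrite [in LHS](splitr x) cosD; have := cos2Dsin2 (x / 2).
  by rewrite !expr2 => H; rewrite -[X in _ - X = _]H; ring.
rewrite normrN ger0_norm; last by rewrite mulr_ge0// sqr_ge0.
have := sin_lipschitz (x / 2) 0; rewrite sin0 !subr0 => /sqr_le_norm.
rewrite (real_normK (num_real _)) exprMn; lra.
Qed.

Lemma sin_sub_le (x : R) : `|sin x - x| <= x ^+ 2.
Proof.
wlog x0 : x / 0 <= x.
  move=> H; have [/H//|x0] := leP 0 x.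
  rewrite -normrN -sqrrN opprB addrC -sinN.
  have := H (- x); rewrite opprK; apply; by rewrite oppr_ge0 ltW.
have dg (z : R) : is_derive z 1 (sin \+ (- id)) (cos z - 1).
  by apply: is_derive_eq.
have [c] := @MVT_segment R _ _ 0 x x0 (fun z _ => dg z)
  (derivable_within_continuous (fun z _ => @ex_derive _ _ _ _ _ _ _ (dg z))).
rewrite in_itv/= => /andP[c0 c1].
rewrite /= sin0 !fctE !subr0 => ->; rewrite normrM (ger0_norm x0) expr2 ler_wpM2r//.
have := cos_lipschitz c 0; rewrite cos0 subr0 => /le_trans; apply.
by rewrite ger0_norm.
Qed.

Lemma cos_taylor2 u h : `|cos (u + h) - cos u + h * sin u| <= 2 * h ^+ 2.
Proof.
rewrite (_ : _ + _ = cos u * (cos h - 1) - sin u * (sin h - h)); last first.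
  by rewrite cosD; ring.
apply: le_trans (ler_normB _ _) _; rewrite !normrM.
have := one_sub_cos_le h; have := sin_sub_le h; have := cos_max u; have := sin_max u.
have := normr_ge0 (cos h - 1); have := normr_ge0 (sin h - h).
by move: `|_ - _| `|_ - _| `|sin u| `|cos u| => a b c d; have := sqr_ge0 h; nra.
Qed.

(** A quadratic remainder bound passes through an integral, so that parameter integrals are
    differentiated without exchanging limits. *)
Lemma is_derive_quadratic f (l M t : R) :
  (forall h, `|f (t + h) - f t - h * l| <= M * h ^+ 2) -> is_derive t 1 f l.
Proof.
move=> H.
have M0 : 0 <= M.
  by have := H 1; rewrite expr1n mulr1; exact: le_trans.
have C : h^-1 *: ((f \o shift t) (h *: 1) - f t) @[h --> 0^'] --> l.
  apply/cvgrPdist_lt => e e0; near=> h.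
  have h0 : h != 0 by near: h; exact: nbhs_dnbhs_neq.
  rewrite /= /shift/= /GRing.scale/= mulr1.
  rewrite (_ : l - _ = - (h^-1 * (f (t + h) - f t - h * l))); last first.
    by rewrite (addrC h); field.
  rewrite normrN normrM normfV mulrC ltr_pdivrMr ?normr_gt0//.
  apply: le_lt_trans (H h) _; rewrite -(real_normK (num_real h)) expr2 mulrA.
  rewrite ltr_pM2r ?normr_gt0//.
  apply: (@le_lt_trans _ _ ((M + 1) * `|h|)); first by rewrite ler_wpM2r// lerDl.
  rewrite mulrC -ltr_pdivlMr ?ltr_wpDl//.
  near: h; apply: dnbhs0_lt; by rewrite divr_gt0// ltr_wpDl.
by apply: DeriveDef; [exact: (cvgP _ C)|exact: cvg_lim C].
Unshelve. all: by end_near.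
Qed.

(** Induction on N: the bound on [phi 1] makes [e * phi 0] minus the claimed bound nonincreasing,
    for both signs e. *)
Lemma taylor_bound (phi : nat -> R -> R) (t0 M s : R) N :
  (forall n t, is_derive t 1 (phi n) (phi n.+1 t)) ->
  (forall n, (n < N)%N -> phi n t0 = 0) -> (forall t, `|phi N t| <= M) -> 0 <= s ->
  `|phi 0%N (t0 + s)| <= M * (s ^+ N / N`!%:R).
Proof.
elim: N phi s => [|N ih] phi s dphi z b s0.
  by rewrite expr0 fact0 divr1 mulr1.
have H u : 0 <= u -> `|phi 1%N (t0 + u)| <= M * (u ^+ N / N`!%:R).
  by move=> u0; apply: (ih (fun n => phi n.+1)) => // n nN; exact: z.
have st : t0 <= t0 + s by rewrite lerDl.
have K (e : R) : `|e| = 1 -> e * phi 0%N (t0 + s) <= M * (s ^+ N.+1 / N.+1`!%:R).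
  move=> e1.
  pose g t := e * phi 0%N t - M / N.+1`!%:R * (t - t0) ^+ N.+1.
  pose dg t := e * phi 1%N t - M / N`!%:R * (t - t0) ^+ N.
  have dgP t : is_derive t 1 g (dg t).
    have -> : g = e \*: phi 0%N \- (M / N.+1`!%:R) \*: ((id \- cst t0) ^+ N.+1).
      by apply/funext => x; rewrite /g /= fctE.
    apply: is_derive_eq; rewrite /GRing.scale/= subr0 mulr1 /dg factS natrM.
    congr (_ - _); have : N.+1%:R != 0 :> R by rewrite pnatr_eq0.
    have : N`!%:R != 0 :> R by rewrite pnatr_eq0 -lt0n fact_gt0.
    by move=> ? ?; field; apply/andP.
  have [c] := @MVT_segment R g dg _ _ st (fun z _ => dgP z) (derivable_within_continuous (fun z _ => @ex_derive _ _ _ _ _ _ _ (dgP z))).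
  rewrite in_itv/= => /andP[c0 c1].
  have ct : 0 <= c - t0 by rewrite subr_ge0.
  rewrite /g/= z// subrr expr0n/= !mulr0 !subr0 [t0 + s]addrC addrK => E.
  have : dg c <= 0.
    have := H _ ct; rewrite addrC subrK => Hc.
    rewrite /dg subr_le0 mulrAC -mulrA; apply: le_trans Hc.
    by rewrite (le_trans (ler_norm _))// normrM e1 mul1r.
  move=> dg0; have : dg c * s <= 0 by rewrite mulr_le0_ge0.
  by rewrite -E subr_le0 mulrAC -mulrA.
rewrite ler_norml lerNl -mulN1r K ?normrN1//=.
by rewrite -[leLHS]mul1r K// normr1.
Qed.

End calculus.

Section analytic.
Context d (T : measurableType d) (R : realType) (mu : {measure set T -> \bar R}).
Implicit Types (P Q tau : T -> R).

Definition phase_integral P Q tau (t : R) :=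
  \int[mu]_x (P x * cos (tau x * t) + Q x * sin (tau x * t)).

Section derivatives.
Variables (P Q tau : T -> R) (alpha : R).
Hypotheses (mP : measurable_fun setT P) (mQ : measurable_fun setT Q)
  (mtau : measurable_fun setT tau) (alpha0 : 0 < alpha).
Let W x : R := `|P x| + `|Q x|.
Hypothesis lW : L1 mu (fun x => W x * expR (alpha * `|tau x|)).

Let C := \int[mu]_x (W x * expR (alpha * `|tau x|)).
Let m k : R := \int[mu]_x (W x * `|tau x| ^+ k).
(** Each derivative in t multiplies by [tau] and advances the phase by pi / 2, so that [v k] is the
    k-th derivative of [phase_integral]. *)
Let phase (k : nat) (t : R) x : R := tau x * t + k%:R * (pi / 2).
Let v k (t : R) : R := \int[mu]_x (P x * tau x ^+ k * cos (phase k t x) +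
                         Q x * tau x ^+ k * sin (phase k t x)).

Let W0 x : 0 <= W x. Proof. by rewrite addr_ge0. Qed.

Let mW : measurable_fun setT W.
Proof. by apply: measurable_funD; exact: measurableT_comp. Qed.

(** One term of the exponential series of alpha |tau| is at most its sum. *)
Let moment_le k x : `|tau x| ^+ k <= k`!%:R / alpha ^+ k * expR (alpha * `|tau x|).
Proof.
have a0 : 0 < alpha ^+ k by rewrite exprn_gt0.
have f0 : 0 < k`!%:R :> R by rewrite ltr0n fact_gt0.
have H : (alpha * `|tau x|) ^+ k / k`!%:R <= expR (alpha * `|tau x|).
  case: k {a0 f0} => [|k].
    by rewrite expr0 fact0 divr1 -[leLHS]expR0 ler_expR mulr_ge0// ltW.
  apply: le_trans (expR_ge1Dxn k _); last by rewrite mulr_ge0// ltW.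
  by rewrite lerDr.
move: H; rewrite ler_pdivrMr// exprMn => H.
by rewrite mulrAC ler_pdivlMr// mulrC [leRHS]mulrC.
Qed.

Let L1m k : L1 mu (fun x => W x * `|tau x| ^+ k).
Proof.
apply: (L1_le _ _ (L1Z (k`!%:R / alpha ^+ k) lW)).
  by apply: measurable_funM => //; apply: measurable_funX; exact: measurableT_comp.
move=> x; rewrite ger0_norm ?mulr_ge0 ?exprn_ge0//.
by apply: le_trans (ler_norm _); rewrite mulrCA ler_wpM2l.
Qed.

Let m_le k : m k <= k`!%:R / alpha ^+ k * C.
Proof.
rewrite /C -(RintegralZl _ measurableT lW); apply: le_Rintegral => //.
- exact: L1m.
- exact: (L1Z _ lW).
- by move=> x _; rewrite mulrCA ler_wpM2l.
Qed.

Let mphase k t : measurable_fun setT (phase k t).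
Proof. by apply: measurable_funD => //; exact: measurable_funM. Qed.

Let L1v k t : L1 mu (fun x => P x * tau x ^+ k * cos (phase k t x) +
                         Q x * tau x ^+ k * sin (phase k t x)).
Proof.
apply: (L1_le _ _ (L1m k)).
  apply: measurable_funD; apply: measurable_funM;
    try (by apply: measurable_funM => //; exact: measurable_funX).
    exact: measurable_cos_comp.
  exact: measurable_sin_comp.
move=> x; rewrite (ger0_norm (mulr_ge0 (W0 x) (exprn_ge0 _ (normr_ge0 _)))).
apply: le_trans (ler_normD _ _) _; rewrite !normrM normrX mulrDl.
by apply: lerD; rewrite ler_piMr ?cos_max ?sin_max// mulr_ge0 ?exprn_ge0.
Qed.

Let v_le k t : `|v k t| <= m k.
Proof.
apply: le_Rintegral_norm => //; first exact: (L1_measurable (L1v k t)).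
move=> x.
apply: le_trans (ler_normD _ _) _; rewrite !normrM normrX mulrDl.
by apply: lerD; rewrite ler_piMr ?cos_max ?sin_max// mulr_ge0 ?exprn_ge0.
Qed.

Let v_quadratic k (t h : R) : `|v k (t + h) - v k t - h * v k.+1 t| <= 2 * m k.+2 * h ^+ 2.
Proof.
have l1 := L1v k (t + h); have l2 := L1v k t; have l3 := L1Z h (L1v k.+1 t).
rewrite /v -(RintegralZl _ measurableT (L1v k.+1 t)).
rewrite -(RintegralB measurableT l1 l2) -(RintegralB measurableT (L1B l1 l2) l3).
rewrite mulrAC -(RintegralZl _ measurableT (L1m k.+2)).
apply: le_Rintegral_norm; [exact: (L1Z _ (L1m k.+2))|exact: (L1_measurable (L1B (L1B l1 l2) l3))|].
move=> x; set u := phase k t x.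
have Eh : phase k (t + h) x = u + tau x * h by rewrite /u /phase; ring.
have E1 : phase k.+1 t x = u + pi / 2 by rewrite /u /phase -natr1; ring.
rewrite Eh E1 cosDpihalf sinDpihalf.
rewrite (_ : _ - _ = P x * tau x ^+ k * (cos (u + tau x * h) - cos u + tau x * h * sin u) -
  Q x * tau x ^+ k * (cos (u + pi / 2 + tau x * h) - cos (u + pi / 2) + tau x * h * sin (u + pi / 2))); last first.
  by rewrite (addrAC u) !cosDpihalf sinDpihalf exprS; ring.
apply: le_trans (ler_normB _ _) _; rewrite !normrM.
have B := cos_taylor2 u (tau x * h); have B' := cos_taylor2 (u + pi / 2) (tau x * h).
apply: le_trans (lerD (ler_wpM2l _ B) (ler_wpM2l _ B')) _; rewrite ?mulr_ge0//.
rewrite -mulrDl -mulrDl !normrX /W exprMn -(real_normK (num_real (tau x))).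
by rewrite le_eqVlt; apply/orP; left; apply/eqP; rewrite !exprS expr0; ring.
Qed.

Let is_derive_v k (t : R) : is_derive t 1 (v k) (v k.+1 t).
Proof. by apply: is_derive_quadratic => h; exact: v_quadratic. Qed.

Let v_eq0_step k a b : (forall t, a < t < b -> v k t = 0) ->
  forall t, a < t < b -> v k.+1 t = 0.
Proof.
move=> H t /andP[a_t tb]; apply/eqP/negPn/negP => v0.
have M0 : 0 <= m k.+2.
  by apply: Rintegral_ge0 => x _; rewrite mulr_ge0// exprn_ge0.
pose K := `|v k.+1 t|; have K0 : 0 < K by rewrite normr_gt0.
(* [h] keeps t + h inside the interval and satisfies (2 m + 1) h <= K, whereas the remainder bound
   yields K <= 2 m h. *)
pose h := Num.min ((b - t) / 2) (K / (2 * m k.+2 + 1)).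
have h0 : 0 < h.
  by rewrite lt_min !divr_gt0 ?subr_gt0// ltr_wpDl// mulr_ge0.
have hb : t + h < b.
  have : h <= (b - t) / 2 by rewrite ge_min lexx.
  lra.
have := v_quadratic k t h.
rewrite (H t) ?a_t// (H (t + h)) ?hb ?(lt_trans a_t)// ?ltrDl//.
rewrite subrr sub0r normrN normrM (ger0_norm (ltW h0)) -/K.
rewrite expr2 mulrCA ler_pM2l// => KM.
have : h <= K / (2 * m k.+2 + 1) by rewrite ge_min lexx orbT.
rewrite ler_pdivlMr ?ltr_wpDl ?mulr_ge0// mulrDr mulr1 mulrC => H2.
by have := le_trans H2 KM; rewrite gerDl leNgt h0.
Qed.

Let v_eq0 a b k : (forall t, a < t < b -> v 0 t = 0) ->
  forall t, a < t < b -> v k t = 0.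
Proof. by move=> H; elim: k => // k ih; exact: v_eq0_step. Qed.

Let v_eq0_near a b t0 s : (forall t, a < t < b -> v 0 t = 0) ->
  a < t0 < b -> 0 <= s < alpha -> v 0 (t0 + s) = 0.
Proof.
move=> H ab /andP[s0 sa].
have B n : `|v 0 (t0 + s)| <= C * (s / alpha) ^+ n.
  apply: le_trans (taylor_bound (fun n t => is_derive_v n t) (fun n _ => v_eq0 n H ab) (v_le n) s0) _.
  rewrite exprMn exprVn.
  apply: le_trans (ler_wpM2r _ (m_le n)) _.
    by rewrite divr_ge0 ?exprn_ge0.
  have f0 : n`!%:R != 0 :> R by rewrite pnatr_eq0 -lt0n fact_gt0.
  have a0 : alpha ^+ n != 0 by rewrite expf_neq0// gt_eqF.
  by rewrite le_eqVlt; apply/orP; left; apply/eqP; field; apply/andP.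
apply/eqP; rewrite -normr_le0.
have c : C * (s / alpha) ^+ n @[n --> \oo] --> (0 : R).
  rewrite -[X in _ --> X](mulr0 C); apply: cvgM; first exact: cvg_cst.
  apply: cvg_expr; rewrite ger0_norm ?divr_ge0// ?(ltW alpha0)//.
  by rewrite ltr_pdivrMr// mul1r.
rewrite -(cvg_lim (@Rhausdorff R) c); apply: limr_ge; first exact: (cvgP _ c).
exact/nearW.
Qed.

Lemma phase_integral_right a b : a < b ->
  (forall t, a < t < b -> phase_integral P Q tau t = 0) ->
  forall t, a < t -> phase_integral P Q tau t = 0.
Proof.
have E t : phase_integral P Q tau t = v 0 t.
  by apply: eq_Rintegral => x _; rewrite /phase !expr0 !mulr1 mul0r addr0.
move=> ab H; have {}H t : a < t < b -> v 0 t = 0 by move=> /H; rewrite E.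
have S (n : nat) : forall t, a < t < b + n%:R * (alpha / 2) -> v 0 t = 0.
  elim: n => [|n ih] t.
    by rewrite mul0r addr0; exact: H.
  rewrite -natr1 mulrDl mul1r addrA => /andP[a_t].
  set b' := b + n%:R * (alpha / 2) in ih * => tb.
  have b'b : b <= b' by rewrite lerDl mulr_ge0// divr_ge0// ltW.
  have ab' : a < b' by exact: lt_le_trans ab b'b.
  have a0 := alpha0; clearbody b'.
  have [tb'|b't] := ltP t b'; first by apply: ih; rewrite a_t.
  (* An expansion point inside the interval of zeros and at distance at most alpha / 4 from its end:
     any t < b' + alpha / 2 is then within 3 alpha / 4 of it. *)
  pose t0 := Num.max ((a + b') / 2) (b' - alpha / 4).
  have t0b : t0 < b' by rewrite gt_max; apply/andP; split; lra.
  have t0a : a < t0 by rewrite lt_max; apply/orP; left; lra.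
  have t0c : b' - alpha / 4 <= t0 by rewrite le_max lexx orbT.
  rewrite -(subrK t0 t) addrC; apply: (v_eq0_near ih); first by rewrite t0a.
  apply/andP; split; lra.
move=> t a_t; rewrite E; apply: (S (Num.truncn (`|t - b| / (alpha / 2))).+1).
rewrite a_t/= -ltrBlDl; apply: (le_lt_trans (ler_norm _)).
rewrite -ltr_pdivrMr ?divr_gt0//; exact: truncnS_gt.
Qed.

End derivatives.

(* The derivatives are bounded by [k! / alpha ^ k] up to a constant, so the Taylor
   series converges on intervals of fixed length, by which the set of zeros can
   be extended repeatedly. *)
Lemma phase_integral_analytic P Q tau (alpha a b : R) :
  measurable_fun setT P -> measurable_fun setT Q -> measurable_fun setT tau ->
  0 < alpha -> L1 mu (fun x => (`|P x| + `|Q x|) * expR (alpha * `|tau x|)) ->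
  a < b -> (forall t, a < t < b -> phase_integral P Q tau t = 0) ->
  forall t, phase_integral P Q tau t = 0.
Proof.
move=> mP mQ mt a0 lW ab H t.
have [at_|ta] := ltP a t; first exact: (phase_integral_right mP mQ mt a0 lW ab H).
(* Reversing t amounts to changing the sign of Q, which reduces propagation to the left to
   propagation to the right. *)
have E s : phase_integral P (fun x => - Q x) tau (- s) = phase_integral P Q tau s.
  by apply: eq_Rintegral => x _; rewrite mulrN cosN sinN mulrNN.
rewrite -E; apply: (phase_integral_right mP _ mt a0 _ (a := - b) (b := - a)).
- exact: measurableT_comp.
- by apply: eq_L1 lW => x; rewrite normrN.
- by rewrite ltrN2.
- move=> s /andP[s1 s2]; rewrite -(opprK s) E; apply: H.
  by rewrite ltrNr s2 ltrNl.
- by rewrite ltrN2 (le_lt_trans ta).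
Qed.

End analytic.

(** * Fourier integrals of exponentially decaying functions *)

Section neighborhoods.
Context {R : realType} (n : nat).
Local Notation mu := (@lebesgue_cV R n).
Implicit Types (x y : 'cV[R]_n) (U V : set 'cV[R]_n).

Lemma nbhs_cVP x V : nbhs x V <->
  exists2 e : R, 0 < e & forall y, (forall i, `|y i ord0 - x i ord0| < e) -> V y.
Proof.
split=> [/nbhs_ballP[e /= e0 H]|[e e0 H]].
  exists e => // y xy; apply: H; split => // i j; rewrite (ord1 j) /ball/= distrC.
  exact: xy.
apply/nbhs_ballP; exists e => // y xy; apply: H => i; rewrite distrC.
exact: (xy.2 i ord0).
Qed.

(** Countably many cubes with rational centres are enough: outside the support, every point lies in
    one of them on which g vanishes almost everywhere. *)
Lemma ae_ess_support (g : 'cV[R]_n -> R[i]) :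
  {ae mu, forall x, ~ ess_support g x -> g x = 0}.
Proof.
pose B (p : nat * 'cV[int]_n) : set 'cV[R]_n :=
  [set y | forall i, `|y i ord0 - (p.2 i ord0)%:~R / p.1.+1%:R| <= p.1.+1%:R^-1].
pose P k y := if unpickle k is Some p then
  {ae mu, forall z, B p z -> g z = 0} -> B p y -> g y = 0 else True.
have H k : {ae mu, forall y, P k y}.
  rewrite /P; case: (unpickle k) => [p|]; last exact/nearW.
  have [h|h] := pselect {ae mu, forall z, B p z -> g z = 0}.
    by apply: filterS h => y h1 _.
  by apply/nearW => y /h.
apply: filterS (ae_foralln H) => x Hx /existsNP[V /not_implyP[/nbhs_cVP[e e0 xV] /contrapT aeV]].
(* With this m the side 2 / (m + 1) of the cubes is less than e, so that a cube containing x stays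
   inside V. *)
pose m := Num.truncn (2 / e).
pose p : nat * 'cV[int]_n := (m, \col_i Num.floor (x i ord0 * m.+1%:R)).
have m0 : 0 < m.+1%:R :> R by [].
have fl i : `|x i ord0 - (Num.floor (x i ord0 * m.+1%:R))%:~R / m.+1%:R| <= m.+1%:R^-1.
  rewrite -[X in `|X - _|](mulfK (lt0r_neq0 m0)) -mulrBl normrM normfV (ger0_norm (ltW m0)).
  rewrite ler_piMl ?invr_ge0// ger0_norm ?subr_ge0 ?floor_le//.
  by rewrite lerBlDl -[1]/(1%:~R) -rmorphD ltW// floorD1_gt.
have Bx y : B p y -> V y.
  move=> By; apply: xV => i; have := By i; rewrite /p mxE => h.
  have h2 := fl i.
  rewrite (@le_lt_trans _ _ (m.+1%:R^-1 + m.+1%:R^-1))//.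
    by apply: le_trans (lerD h h2); rewrite (distrC (x i ord0)) ler_distD.
  rewrite (_ : _ + _ = 2 / m.+1%:R); last by ring.
  rewrite ltr_pdivrMr// mulrC -ltr_pdivrMr//.
  exact: truncnS_gt.
have := Hx (pickle p); rewrite /P pickleK; apply.
  by apply: filterS aeV => y h /Bx.
by move=> i; rewrite /p mxE/=; exact: fl.
Qed.

(** Connectedness of the line is used along the line through a point of A and a point of B. *)
Lemma open_meet (A B : set 'cV[R]_n) : open A -> open B -> A `|` B = setT ->
  A !=set0 -> B !=set0 -> A `&` B !=set0.
Proof.
move=> oA oB AB [x Ax] [y By].
apply/set0P/negP => /eqP AB0.
pose gam (t : R) : 'cV[R]_n := x + t *: (y - x).
have cg : continuous gam.
  move=> t; apply: cvgD; first exact: cvg_cst.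
  by apply: cvgZl; exact: cvg_id.
have BA : gam @^-1` A = ~` (gam @^-1` B).
  apply/seteqP; split=> t /=.
    by move=> At Bt; have : (A `&` B) (gam t) by []; rewrite AB0.
  move=> nB; have : (A `|` B) (gam t) by rewrite AB.
  by case.
have oA' : open (gam @^-1` A) by move/continuousP : cg; exact.
have oB' : open (gam @^-1` B) by move/continuousP : cg; exact.
have cR : connected [set: R] by apply/connected_intervalP.
have E : gam @^-1` A = setT.
  apply: cR.
  - by exists 0; rewrite /gam/= scale0r addr0.
  - by exists (gam @^-1` A); rewrite ?setTI.
  - by exists (gam @^-1` A); rewrite ?setTI// BA; exact: open_closedC.
have : (gam @^-1` A) 1 by rewrite E.
rewrite /gam/= scale1r addrC subrK => Ay.
by have : (A `&` B) y by []; rewrite AB0.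
Qed.

End neighborhoods.

Section decay.
Context {R : realType} (n : nat).
Local Notation mu := (@lebesgue_cV R n).
Implicit Types (p q b : 'cV[R]_n -> R) (x y xi : 'cV[R]_n).

Definition norm1_cV xi : R := \sum_i `|xi i ord0|.

Lemma norm1_cV_ge0 xi : 0 <= norm1_cV xi.
Proof. exact: sumr_ge0. Qed.

Lemma measurable_norm1_cV : measurable_fun setT norm1_cV.
Proof.
apply: measurable_sum => i; apply: measurableT_comp => //.
exact: measurable_cV_coord.
Qed.

Lemma dot_cV_norm1 (c : R) x xi : (forall i, `|x i ord0| <= c) ->
  `|dot_cV x xi| <= c * norm1_cV xi.
Proof.
move=> xc; apply: le_trans (ler_norm_sum _ _ _) _; rewrite /norm1_cV mulr_sumr.
by apply: ler_sum => i _; rewrite normrM ler_wpM2r.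
Qed.

(** Covers both the exponential moment of f and, with alpha = 1, spectra of bounded support. The
    weight uses |xi|_1, against which inner products are bounded by a sup norm. *)
Definition decay (alpha : R) p := measurable_fun setT p /\
  L1 mu (fun xi => p xi * expR (alpha * norm1_cV xi)).

Lemma measurable_expR_norm1 (alpha : R) :
  measurable_fun setT (fun xi : 'cV[R]_n => expR (alpha * norm1_cV xi)).
Proof.
apply: measurableT_comp => //; apply: measurable_funM => //.
exact: measurable_norm1_cV.
Qed.

Lemma decay_L1 alpha p : 0 < alpha -> decay alpha p -> L1 mu p.
Proof.
move=> a0 [mp lp]; apply: L1_le lp => // x.
rewrite normrM ler_peMr// ger0_norm ?expR_ge0// -[leLHS]expR0 ler_expR.
by rewrite mulr_ge0 ?norm1_cV_ge0// ltW.
Qed.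

Lemma decayD alpha p q : decay alpha p -> decay alpha q -> decay alpha (fun xi => p xi + q xi).
Proof.
move=> [mp lp] [mq lq]; split; first exact: measurable_funD.
by apply: eq_L1 (L1D lp lq) => x; rewrite mulrDl.
Qed.

Lemma decayZ alpha (c : R) p : decay alpha p -> decay alpha (fun xi => c * p xi).
Proof.
move=> [mp lp]; split; first exact: measurable_funM.
by apply: eq_L1 (L1Z c lp) => x; rewrite mulrA.
Qed.

Lemma decayB alpha p q : decay alpha p -> decay alpha q -> decay alpha (fun xi => p xi - q xi).
Proof. by move=> dp /(decayZ (-1)) /(decayD dp); under eq_fun do rewrite mulN1r. Qed.

Lemma decay_norm alpha p : decay alpha p -> decay alpha (fun xi => `|p xi|).
Proof.
move=> [mp lp]; split; first exact: measurableT_comp.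
by apply: eq_L1 (L1_norm lp) => x; rewrite normrM (ger0_norm (expR_ge0 _)).
Qed.

Lemma decay_bounded alpha (C : R) p b : decay alpha p -> measurable_fun setT b ->
  (forall xi, `|b xi| <= C) -> decay alpha (fun xi => p xi * b xi).
Proof.
move=> [mp lp] mb bC; split; first exact: measurable_funM.
by apply: eq_L1 (L1_bounded lp mb bC) => x; rewrite mulrAC.
Qed.

Lemma decay_support (r : R) p : L1 mu p ->
  (forall xi, p xi != 0 -> forall i, `|xi i ord0| <= r) -> decay 1 p.
Proof.
move=> lp pr; have mp := L1_measurable lp; split => //.
apply: (L1_le _ _ (L1Z (expR (r *+ n)) lp)).
  by apply: measurable_funM => //; exact: measurable_expR_norm1.
move=> x; have [->|px] := eqVneq (p x) 0; first by rewrite mul0r normr0.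
rewrite mulrC !normrM ler_wpM2r// !(ger0_norm (expR_ge0 _)) ler_expR mul1r.
rewrite /norm1_cV -[X in _ *+ X](card_ord n) -sumr_const.
by apply: ler_sum => i _; exact: pr.
Qed.

(** Expanding the phase at x leaves an integral in one variable with frequencies 2 pi y.xi, to which
    propagation of zeros applies. *)
Lemma phase_transform_line p q x y theta (t : R) :
  phase_transform p q theta (x + t *: y) =
  phase_integral mu
    (fun xi => p xi * cos (2 * pi * dot_cV x xi + theta) + q xi * sin (2 * pi * dot_cV x xi + theta))
    (fun xi => q xi * cos (2 * pi * dot_cV x xi + theta) - p xi * sin (2 * pi * dot_cV x xi + theta))
    (fun xi => 2 * pi * dot_cV y xi) t.
Proof.
apply: eq_Rintegral => xi _; rewrite dot_cVDl dot_cVZl.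
rewrite (_ : 2 * pi * (dot_cV x xi + t * dot_cV y xi) + theta =
  2 * pi * dot_cV x xi + theta + 2 * pi * dot_cV y xi * t); last by ring.
by set A := _ + theta; rewrite (cosD A) (sinD A); ring.
Qed.

Lemma phase_transform_analytic alpha p q theta x y (a b : R) : 0 < alpha ->
  decay alpha p -> decay alpha q -> a < b ->
  (forall t, a < t < b -> phase_transform p q theta (x + t *: y) = 0) ->
  forall t, phase_transform p q theta (x + t *: y) = 0.
Proof.
move=> a0 dp dq ab H t.
pose u xi := 2 * pi * dot_cV x xi + theta.
have mc : measurable_fun setT (fun xi => cos (u xi)).
  by apply: measurable_cos_comp; exact: measurable_phase.
have ms : measurable_fun setT (fun xi => sin (u xi)).
  by apply: measurable_sin_comp; exact: measurable_phase.
have d1 : decay alpha (fun xi => p xi * cos (u xi) + q xi * sin (u xi)).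
  by apply: decayD; apply: (decay_bounded (C := 1)) => // xi; rewrite ?cos_max ?sin_max.
have d2 : decay alpha (fun xi => q xi * cos (u xi) - p xi * sin (u xi)).
  by apply: decayB; apply: (decay_bounded (C := 1)) => // xi; rewrite ?cos_max ?sin_max.
pose Y := \sum_i `|y i ord0|.
have Y0 : 0 <= Y by exact: sumr_ge0.
have p0 := @pi_gt0 R.
(* The frequencies on the line are at most 2 pi Y |xi|_1, whence the rate alpha / (2 pi Y + 1)
   below; adding 1 covers y = 0. *)
have K0 : 0 < 2 * pi * Y + 1 by rewrite ltr_wpDl// mulr_ge0// mulr_ge0// ltW.
rewrite phase_transform_line.
apply: (phase_integral_analytic (alpha := alpha / (2 * pi * Y + 1)) (a := a) (b := b)) => //.
- by case: d1.
- by case: d2.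
- by apply: measurable_funM => //; exact: measurable_dot.
- by rewrite divr_gt0.
- have [m3 l3] := decayD (decay_norm d1) (decay_norm d2).
  apply: L1_le l3.
    apply: measurable_funM => //; apply: measurableT_comp => //.
    apply: measurable_funM => //; apply: measurableT_comp => //.
    by apply: measurable_funM => //; exact: measurable_dot.
  move=> xi.
  have yY i : `|y i ord0| <= Y by rewrite /Y (bigD1 i)//= lerDl sumr_ge0.
  have tb : `|2 * pi * dot_cV y xi| <= 2 * pi * Y * norm1_cV xi.
    have h := dot_cV_norm1 xi yY.
    have pp : 0 < 2 * pi :> R by rewrite mulr_gt0.
    by rewrite -[leRHS]mulrA normrM (gtr0_norm pp) ler_pM2l.
  set tau := 2 * pi * dot_cV y xi in tb *; clearbody tau.
  rewrite !normrM ler_wpM2l// !(ger0_norm (expR_ge0 _)) ler_expR.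
  rewrite mulrAC ler_pdivrMr// -[leRHS]mulrA ler_pM2l// mulrDr mulr1 ler_wpDr ?norm1_cV_ge0//.
  by rewrite mulrC.
- by move=> s /H; rewrite phase_transform_line.
Qed.

(** The transform is Lipschitz, with a constant given by the first moment of |p| + |q|, which is
    finite because exponentials dominate linear functions. *)
Lemma phase_transform_nbhs alpha p q theta x : 0 < alpha ->
  decay alpha p -> decay alpha q -> phase_transform p q theta x != 0 ->
  \forall y \near x, phase_transform p q theta y != 0.
Proof.
move=> a0 dp dq nz.
have lp := decay_L1 a0 dp; have lq := decay_L1 a0 dq.
have [mW lW] := decayD (decay_norm dp) (decay_norm dq).
pose W xi := (`|p xi| + `|q xi|) * norm1_cV xi.
have lWn : L1 mu W.
  apply: (L1_le _ _ (L1Z alpha^-1 lW)).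
    by apply: measurable_funM => //; exact: measurable_norm1_cV.
  move=> xi; rewrite !normrM mulrCA ler_wpM2l// !ger0_norm ?expR_ge0 ?norm1_cV_ge0 ?invr_ge0 ?(ltW a0)//.
  rewrite ler_pdivlMl//; have := expR_ge1Dx (alpha * norm1_cV xi); lra.
pose M := \int[mu]_xi W xi.
have M0 : 0 <= M by apply: Rintegral_ge0 => xi _; rewrite mulr_ge0 ?addr_ge0 ?norm1_cV_ge0.
have p0 := @pi_gt0 R.
set z := phase_transform _ _ _ x in nz.
have lip (c : R) y : 0 <= c -> (forall i, `|y i ord0 - x i ord0| <= c) ->
    `|phase_transform p q theta y - z| <= c * (2 * pi) * M.
  move=> c0 yx; rewrite /z /phase_transform.
  rewrite -(RintegralB measurableT (L1_phase_transform theta y lp lq) (L1_phase_transform theta x lp lq)).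
  rewrite -(RintegralZl _ measurableT lWn); apply: le_Rintegral_norm.
  - exact: L1Z.
  - exact: L1_measurable (L1B (L1_phase_transform theta y lp lq) (L1_phase_transform theta x lp lq)).
  move=> xi; set u := _ + theta; set v := 2 * pi * dot_cV x xi + theta.
  rewrite (_ : _ - _ = p xi * (cos u - cos v) + q xi * (sin u - sin v)); last by ring.
  have uv : `|u - v| <= c * (2 * pi) * norm1_cV xi.
    rewrite (_ : u - v = 2 * pi * dot_cV (y - x) xi); last by rewrite dot_cVBl /u /v; ring.
    rewrite normrM ger0_norm ?mulr_ge0 ?(ltW p0)//.
    rewrite [leRHS](_ : _ = 2 * pi * (c * norm1_cV xi)); last by ring.
    rewrite ler_pM2l ?mulr_gt0//.
    by apply: dot_cV_norm1 => i; rewrite !mxE.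
  apply: le_trans (ler_normD _ _) _; rewrite !normrM /W mulrCA mulrDl.
  have cl := cos_lipschitz u v; have sl := sin_lipschitz u v.
  by apply: lerD; rewrite ler_wpM2l// (le_trans _ uv).
have e0 : 0 < `|z| / (2 * pi * M + 1).
  by rewrite divr_gt0 ?normr_gt0// ltr_wpDl// mulr_ge0// mulr_ge0// ltW.
apply/nbhs_cVP; exists (`|z| / (2 * pi * M + 1)) => // y yx.
have := lip _ y (ltW e0) (fun i => ltW (yx i)) => h; apply/negP => /eqP y0.
move: h; rewrite y0 sub0r normrN leNgt => /negP; apply.
rewrite -mulrA mulrAC ltr_pdivrMr ?ltr_wpDl ?mulr_ge0 ?(ltW p0)//.
by rewrite ltr_pM2l ?normr_gt0// ltrDl.
Qed.

(** On the line from x to y the function vanishes for small t > 0, hence at t = 1. *)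
Lemma phase_transform_identity alpha p q theta x : 0 < alpha ->
  decay alpha p -> decay alpha q ->
  (\forall y \near x, phase_transform p q theta y = 0) ->
  forall y, phase_transform p q theta y = 0.
Proof.
move=> a0 dp dq /nbhs_cVP[e e0 H] y.
pose Y := \sum_i `|(y - x) i ord0|.
have Y0 : 0 <= Y by exact: sumr_ge0.
have d0 : 0 < e / (Y + 1) by rewrite divr_gt0// ltr_wpDl.
rewrite -(subrK x y) addrC -[y - x]scale1r.
apply: (phase_transform_analytic a0 dp dq d0) => t /andP[t0 t1].
apply: H => i; rewrite !mxE (_ : _ - _ = t * (y i ord0 - x i ord0)); last by ring.
rewrite normrM (ger0_norm (ltW t0)).
have yY : `|y i ord0 - x i ord0| <= Y.
  by rewrite /Y (bigD1 i)//= !mxE lerDl sumr_ge0.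
apply: (@le_lt_trans _ _ (t * Y)); first by rewrite ler_pM2l.
apply: (@lt_le_trans _ _ (t * (Y + 1))); first by rewrite ltr_pM2l// ltrDl.
by rewrite -ler_pdivlMr ?ltr_wpDl// ltW.
Qed.

(** Near a point where the first factor is nonzero the second one vanishes, hence everywhere by the
    identity principle. *)
Lemma phase_transform_mul_eq0 alpha p1 q1 p2 q2 theta : 0 < alpha ->
  decay alpha p1 -> decay alpha q1 -> decay alpha p2 -> decay alpha q2 ->
  (forall x, phase_transform p1 q1 theta x * phase_transform p2 q2 theta x = 0) ->
  (forall x, phase_transform p1 q1 theta x = 0) \/
  (forall x, phase_transform p2 q2 theta x = 0).
Proof.
move=> a0 dp1 dq1 dp2 dq2 H.
have [|/existsNP[x /eqP nx]] := pselect (forall x, phase_transform p1 q1 theta x = 0); [by left|right].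
apply: (@phase_transform_identity alpha _ _ _ x) => //.
apply: filterS (phase_transform_nbhs a0 dp1 dq1 nx) => y ny.
by have /eqP := H y; rewrite mulf_eq0 (negbTE ny) => /eqP.
Qed.

End decay.

(** * Sampling of squares of band-limited functions *)

Section lattice_sampling.
Context d (T : measurableType d) (R : realType) (mu : {measure set T -> \bar R}).
Variables (n : nat) (zeta : 'I_n -> T -> R) (P Q : T -> R).
Hypotheses (lP : L1 mu P) (lQ : L1 mu Q)
  (mz : forall i, measurable_fun setT (zeta i))
  (sz : forall x, P x != 0 \/ Q x != 0 -> forall i, `|zeta i x| < 2^-1).

Let V (t : 'I_n -> R) := \int[mu]_x (P x * cos (2 * pi * \sum_i t i * zeta i x) +
                                     Q x * sin (2 * pi * \sum_i t i * zeta i x)).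

(** The coordinates of t are arbitrary below m and integers from m on. Each step frees one
    coordinate by [phase_sampling], the contribution [A] of the others being absorbed into the
    amplitudes. *)
Let lattice_phase_sampling_rec m : (forall k : 'I_n -> int, V (fun i => (k i)%:~R) = 0) ->
  forall t, (forall i : 'I_n, (m <= i)%N -> exists k : int, t i = k%:~R) -> V t = 0.
Proof.
move=> H; elim: m => [|m ih] t ti.
  have /choice[k tk] : forall i, exists k : int, t i = k%:~R by move=> i; exact: ti.
  by rewrite (funext tk).
have [mn|nm] := ltnP m n; last first.
  by apply: ih => i mi; have := leq_trans nm mi; rewrite leqNgt ltn_ord.
pose i0 := Ordinal mn.
pose t' s i := if i == i0 then s else t i.
pose A x := 2 * pi * \sum_i t' 0 i * zeta i x.
have S s x : 2 * pi * (\sum_i t' s i * zeta i x) = 2 * pi * (s * zeta i0 x) + A x.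
  rewrite /A (bigD1 i0)//= [in RHS](bigD1 i0)//= /t' eqxx mul0r add0r mulrDr.
  by congr (_ + _ * _); apply: eq_bigr => i /negbTE ->.
pose P' x := P x * cos (A x) + Q x * sin (A x).
pose Q' x := Q x * cos (A x) - P x * sin (A x).
have VE s : V (t' s) = \int[mu]_x (P' x * cos (2 * pi * (s * zeta i0 x)) +
                                    Q' x * sin (2 * pi * (s * zeta i0 x))).
  by apply: eq_Rintegral => x _; rewrite S cosD sinD /P' /Q'; ring.
have mA : measurable_fun setT A.
  apply: measurable_funM => //; apply: measurable_sum => i.
  exact: measurable_funM.
have bnd f : L1 mu f -> L1 mu (fun x => f x * cos (A x)) /\ L1 mu (fun x => f x * sin (A x)).
  move=> lf; split; apply: (L1_bounded (C := 1)) => //.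
  - exact: measurable_cos_comp.
  - by move=> x; exact: cos_max.
  - exact: measurable_sin_comp.
  - by move=> x; exact: sin_max.
have [lPc lPs] := bnd _ lP; have [lQc lQs] := bnd _ lQ.
have -> : t = t' (t i0) by apply/funext => i; rewrite /t'; case: eqP => [->|].
rewrite VE; apply: phase_sampling => //.
- exact: L1D.
- exact: L1B.
- move=> x PQ; apply: sz.
  have [P0|] := eqVneq (P x) 0; last by left.
  have [Q0|] := eqVneq (Q x) 0; last by right.
  by move: PQ; rewrite /P' /Q' P0 Q0 !mul0r addr0 subrr eqxx; case.
move=> k; rewrite -VE; apply: ih => i; rewrite leq_eqVlt => /predU1P[mi|mi].
  by exists k; rewrite /t' ifT//; apply/eqP/val_inj.
by rewrite /t'; case: eqP => _; [exists k|exact: ti].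
Qed.

Lemma lattice_phase_sampling : (forall k : 'I_n -> int, V (fun i => (k i)%:~R) = 0) ->
  forall t, V t = 0.
Proof.
move=> H t; apply: (lattice_phase_sampling_rec (m := n)) => // i.
by rewrite leqNgt ltn_ord.
Qed.

End lattice_sampling.

(** * Injectivity of phase transforms and their squares *)

Section phase_transforms.
Context {R : realType} (n : nat).
Local Notation mu := (@lebesgue_cV R n).
Implicit Types (p q a b : 'cV[R]_n -> R) (x y xi : 'cV[R]_n).

Lemma phase_transform_linear (c : R) p1 q1 p2 q2 theta x :
  L1 mu p1 -> L1 mu q1 -> L1 mu p2 -> L1 mu q2 ->
  phase_transform (fun xi => p1 xi + c * p2 xi) (fun xi => q1 xi + c * q2 xi) theta x =
  phase_transform p1 q1 theta x + c * phase_transform p2 q2 theta x.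
Proof.
move=> lp1 lq1 lp2 lq2.
have l1 := L1_phase_transform theta x lp1 lq1.
have l2 := L1_phase_transform theta x lp2 lq2.
rewrite /phase_transform -(RintegralZl _ measurableT l2) -(RintegralD measurableT l1 (L1Z c l2)).
by apply: eq_Rintegral => xi _; ring.
Qed.

Lemma fcosN p y : fcos p (- y) = fcos p y.
Proof.
by apply: eq_Rintegral => x _; rewrite dot_cVC dot_cVNl mulrN cosN (dot_cVC y).
Qed.

Lemma fsinN p y : L1 mu p -> fsin p (- y) = - fsin p y.
Proof.
move=> lp; rewrite -[RHS]mulN1r -(RintegralZl _ measurableT (L1_mul_sin y lp)).
by apply: eq_Rintegral => x _; rewrite dot_cVC dot_cVNl mulrN sinN (dot_cVC y) mulrN mulN1r.
Qed.

Lemma phase_transform0E p q x : L1 mu p -> L1 mu q ->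
  phase_transform p q 0 x = fcos p x + fsin q x.
Proof.
move=> lp lq; rewrite -(RintegralD measurableT (L1_mul_cos x lp) (L1_mul_sin x lq)).
by apply: eq_Rintegral => xi _; rewrite addr0 dot_cVC.
Qed.

Lemma phase_transformNpihalfE p q x : L1 mu p -> L1 mu q ->
  phase_transform p q (- (pi / 2)) x = fsin p x - fcos q x.
Proof.
move=> lp lq; rewrite -(RintegralB measurableT (L1_mul_sin x lp) (L1_mul_cos x lq)).
by apply: eq_Rintegral => xi _; rewrite cosBpihalf sinBpihalf dot_cVC mulrN.
Qed.

(** The phases 0 and - pi / 2 give two equations between cosine and sine transforms; changing the
    sign of y separates the even from the odd part. *)
Lemma phase_transform_injective p q : L1 mu p -> L1 mu q ->
  (forall theta x, phase_transform p q theta x = 0) ->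
  {ae mu, forall xi, p xi = 0} /\ {ae mu, forall xi, q xi = 0}.
Proof.
move=> lp lq H.
have H1 x : fcos p x + fsin q x = 0 by rewrite -phase_transform0E.
have H2 x : fsin p x - fcos q x = 0 by rewrite -phase_transformNpihalfE.
split; apply: fourier_injective => // y.
- by have := H1 y; have := H1 (- y); rewrite fcosN fsinN//; lra.
- by have := H2 y; have := H2 (- y); rewrite fcosN fsinN//; lra.
- by have := H2 y; have := H2 (- y); rewrite fcosN fsinN//; lra.
- by have := H1 y; have := H1 (- y); rewrite fcosN fsinN//; lra.
Qed.

(* [G] equals [int (p - i q) e^{2 pi i x.xi} dxi], whose imaginary part vanishes;
   so [G ^ 2] is the real part of the square, a double integral. *)
Lemma phase_transform_sqr p q x (G : R) : L1 mu p -> L1 mu q ->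
  (forall theta, phase_transform p q theta x = cos theta * G) ->
  G ^+ 2 = \int[(mu \x mu)%E]_z (
    (p z.1 * p z.2 - q z.1 * q z.2) * cos (2 * pi * dot_cV x (z.1 + z.2)) +
    (p z.1 * q z.2 + q z.1 * p z.2) * sin (2 * pi * dot_cV x (z.1 + z.2))).
Proof.
move=> lp lq H.
pose u1 xi := p xi * cos (2 * pi * dot_cV x xi + 0) + q xi * sin (2 * pi * dot_cV x xi + 0).
pose u2 xi := p xi * cos (2 * pi * dot_cV x xi - pi / 2) + q xi * sin (2 * pi * dot_cV x xi - pi / 2).
have l1 : L1 mu u1 by exact: L1_phase_transform.
have l2 : L1 mu u2 by exact: L1_phase_transform.
have i1 : \int[mu]_xi u1 xi = G by have := H 0; rewrite cos0 mul1r.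
have i2 : \int[mu]_xi u2 xi = 0 by have := H (- (pi / 2)); rewrite cosN cos_pihalf mul0r.
transitivity (\int[(mu \x mu)%E]_z (u1 z.1 * u1 z.2 - u2 z.1 * u2 z.2)).
  rewrite (RintegralB measurableT (L1_prod l1 l1) (L1_prod l2 l2)).
  by rewrite !Rintegral_prod// i1 i2 mul0r subr0 expr2.
apply: eq_Rintegral => z _; rewrite /u1 /u2 !addr0 !cosBpihalf !sinBpihalf.
rewrite (_ : 2 * pi * dot_cV x (z.1 + z.2) = 2 * pi * dot_cV x z.1 + 2 * pi * dot_cV x z.2).
  by rewrite cosD sinD; ring.
by rewrite dot_cVDr mulrDr.
Qed.

Lemma dot_cV_mulmx (C : 'M[R]_n) x y : dot_cV (C^T *m x) y = dot_cV x (C *m y).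
Proof.
have E (u v : 'cV[R]_n) : dot_cV u v = (u^T *m v) ord0 ord0.
  by rewrite /dot_cV mxE; apply: eq_bigr => i _; rewrite mxE.
by rewrite !E trmx_mul trmxK mulmxA.
Qed.

(* The squares have their spectrum in [S + S], where the coordinates of [C *m _]
   are less than 1/2. *)
Lemma phaseless_sampling (C : 'M[R]_n) (S : set 'cV[R]_n) p1 q1 p2 q2 (G1 G2 : 'cV[R]_n -> R) :
  C \in unitmx ->
  L1 mu p1 -> L1 mu q1 -> L1 mu p2 -> L1 mu q2 ->
  (forall xi, ~ S xi -> [/\ p1 xi = 0, q1 xi = 0, p2 xi = 0 & q2 xi = 0]) ->
  (forall xi, S xi -> forall i, `|(C *m xi) i ord0| < 4^-1) ->
  (forall theta x, phase_transform p1 q1 theta x = cos theta * G1 x) ->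
  (forall theta x, phase_transform p2 q2 theta x = cos theta * G2 x) ->
  (forall k : 'cV[int]_n, `|G1 (C^T *m map_mx intr k)| = `|G2 (C^T *m map_mx intr k)|) ->
  forall x, G1 x ^+ 2 = G2 x ^+ 2.
Proof.
move=> uC lp1 lq1 lp2 lq2 S0 SC H1 H2 Hk.
pose P z := (p1 z.1 * p1 z.2 - q1 z.1 * q1 z.2) - (p2 z.1 * p2 z.2 - q2 z.1 * q2 z.2).
pose Q z := (p1 z.1 * q1 z.2 + q1 z.1 * p1 z.2) - (p2 z.1 * q2 z.2 + q2 z.1 * p2 z.2).
have la p q : L1 mu p -> L1 mu q -> L1 (mu \x mu)%E (fun z => p z.1 * p z.2 - q z.1 * q z.2).
  by move=> lp lq; apply: L1B; exact: L1_prod.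
have lb p q : L1 mu p -> L1 mu q -> L1 (mu \x mu)%E (fun z => p z.1 * q z.2 + q z.1 * p z.2).
  by move=> lp lq; apply: L1D; exact: L1_prod.
have lP : L1 (mu \x mu)%E P by apply: L1B; exact: la.
have lQ : L1 (mu \x mu)%E Q by apply: L1B; exact: lb.
have md x : measurable_fun setT (fun z : 'cV[R]_n * 'cV[R]_n => 2 * pi * dot_cV x (z.1 + z.2)).
  by apply: measurable_dot2pi => //; exact: measurable_cVD.
(* At the lattice point C^T k the phase of z.1 + z.2 is the inner product of k with [zeta]. Sampling
   is thus applied on the product space itself, without a change of variables. *)
pose zeta (i : 'I_n) (z : 'cV[R]_n * 'cV[R]_n) := (C *m (z.1 + z.2)) i ord0.
have zetaE (t : 'cV[R]_n) z : \sum_i t i ord0 * zeta i z = dot_cV (C^T *m t) (z.1 + z.2).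
  by rewrite dot_cV_mulmx.
have mzeta i : measurable_fun setT (zeta i).
  rewrite (_ : zeta i = fun z => dot_cV (C^T *m (delta_mx i ord0)) (z.1 + z.2)); last first.
    apply/funext => z; rewrite dot_cV_mulmx /dot_cV (bigD1 i)//= big1 => [|j ji].
      by rewrite mxE !eqxx mul1r addr0.
    by rewrite mxE (negbTE ji) mul0r.
  by apply: measurable_dot => //; exact: measurable_cVD.
have D x : G1 x ^+ 2 - G2 x ^+ 2 = \int[(mu \x mu)%E]_z
   (P z * cos (2 * pi * dot_cV x (z.1 + z.2)) + Q z * sin (2 * pi * dot_cV x (z.1 + z.2))).
  rewrite (phase_transform_sqr lp1 lq1 (H1 ^~ x)) (phase_transform_sqr lp2 lq2 (H2 ^~ x)).
  have l p q : L1 mu p -> L1 mu q -> L1 (mu \x mu)%E (fun z =>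
      (p z.1 * p z.2 - q z.1 * q z.2) * cos (2 * pi * dot_cV x (z.1 + z.2)) +
      (p z.1 * q z.2 + q z.1 * p z.2) * sin (2 * pi * dot_cV x (z.1 + z.2))).
    move=> lp lq; apply: L1D; apply: (L1_bounded (C := 1)).
    - exact: la.
    - exact: measurable_cos_comp.
    - by move=> z; exact: cos_max.
    - exact: lb.
    - exact: measurable_sin_comp.
    - by move=> z; exact: sin_max.
  rewrite -(RintegralB measurableT (l _ _ lp1 lq1) (l _ _ lp2 lq2)).
  by apply: eq_Rintegral => z _; rewrite /P /Q; ring.
move=> x; apply/eqP; rewrite -subr_eq0 D; apply/eqP.
have uCt : C^T \in unitmx by rewrite unitmx_tr.
rewrite -(mulKVmx uCt x); set t := invmx C^T *m x.
pose V (t : 'I_n -> R) := \int[(mu \x mu)%E]_z (P z * cos (2 * pi * \sum_i t i * zeta i z) +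
                                     Q z * sin (2 * pi * \sum_i t i * zeta i z)).
have -> : forall s : 'cV[R]_n, \int[(mu \x mu)%E]_z
   (P z * cos (2 * pi * dot_cV (C^T *m s) (z.1 + z.2)) + Q z * sin (2 * pi * dot_cV (C^T *m s) (z.1 + z.2))) =
   V (fun i => s i ord0).
  by move=> s; apply: eq_Rintegral => z _; rewrite zetaE.
apply: lattice_phase_sampling => //.
  move=> z PQ i.
  have S1 : S z.1.
    apply: contrapT => /S0[a1 a2 a3 a4]; move: PQ.
    have -> : P z = 0 by rewrite /P a1 a2 a3 a4; ring.
    have -> : Q z = 0 by rewrite /Q a1 a2 a3 a4; ring.
    by rewrite eqxx; case.
  have S2 : S z.2.
    apply: contrapT => /S0[a1 a2 a3 a4]; move: PQ.
    have -> : P z = 0 by rewrite /P a1 a2 a3 a4; ring.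
    have -> : Q z = 0 by rewrite /Q a1 a2 a3 a4; ring.
    by rewrite eqxx; case.
  rewrite /zeta mulmxDr mxE; apply: le_lt_trans (ler_normD _ _) _.
  by have := SC _ S1 i; have := SC _ S2 i; lra.
move=> k.
have -> : \int[(mu \x mu)%E]_z (P z * cos (2 * pi * \sum_i (k i)%:~R * zeta i z) +
    Q z * sin (2 * pi * \sum_i (k i)%:~R * zeta i z)) =
    G1 (C^T *m map_mx intr (\col_i k i)) ^+ 2 - G2 (C^T *m map_mx intr (\col_i k i)) ^+ 2.
  rewrite D; apply: eq_Rintegral => z _; rewrite -zetaE.
  by under [in RHS]eq_bigr do rewrite !mxE.
by rewrite -[X in X - _]real_normK ?num_real// Hk real_normK ?num_real// subrr.
Qed.

End phase_transforms.

(** * Channels of the frame *)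

Section channels.
Context {R : realType} (n : nat).
Local Notation mu := (@lebesgue_cV R n).
Implicit Types (f h psi p q a b : 'cV[R]_n -> R) (g : 'cV[R]_n -> R[i]).
Implicit Types (x y xi : 'cV[R]_n) (S V : set 'cV[R]_n).

Lemma plancherel_pair_ae h hc hs hc' hs' : plancherel_pair h hc hs ->
  measurable_fun setT hc' -> measurable_fun setT hs' ->
  {ae mu, forall xi, hc xi = hc' xi} -> {ae mu, forall xi, hs xi = hs' xi} ->
  plancherel_pair h hc' hs'.
Proof.
move=> [lc ls H] mc ms ec es; split; [exact: L2_ae ec|exact: L2_ae es|].
move=> w1 w2 l1 l21 l2 l22; rewrite -H//; apply: ae_eq_Rintegral.
- by apply: measurable_funD; apply: measurable_funM => //; [exact: l21.1|exact: l22.1].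
- apply: measurable_funD; apply: measurable_funM;
    [exact: lc.1|exact: l21.1|exact: ls.1|exact: l22.1].
by apply: filterS2 ec es => xi -> ->.
Qed.

Lemma L2_support_L1 (r : R) p : L2 mu p ->
  (forall xi, p xi != 0 -> forall i, `|xi i ord0| <= r) -> L1 mu p.
Proof.
(* The lower corner is moved by 1 because the box is open on that side. *)
move=> lp pr; pose B : set 'cV[R]_n := boxoc (const_mx (- r - 1)) (const_mx r).
have lB : L2 mu (\1_B : 'cV[R]_n -> R).
  apply: (@L1_bounded_L2 _ _ _ _ 1); first exact: L1_indic_boxoc.
  by move=> x; rewrite ger0_norm// indic_le1.
apply: eq_L1 (L2_mul lp lB) => x.
have [->|/pr px] := eqVneq (p x) 0; first by rewrite mul0r.
rewrite indicE mem_set ?mulr1// => i; rewrite in_itv/= !mxE.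
have := px i; rewrite ler_norml => /andP[h1 ->].
by rewrite andbT (lt_le_trans _ h1)// ltrBlDr ltrDl.
Qed.

(* [a] and [b] are [Re g] and [- Im g], set to 0 on a null set in order that the
   support condition hold everywhere. *)
Lemma spectral_support psi g S (r : R) : L2 mu psi -> is_fourier psi g ->
  {ae mu, forall xi, g xi <> 0 -> S xi} ->
  (forall xi, S xi -> forall i, `|xi i ord0| <= r) ->
  exists a b, [/\ plancherel_pair psi a b, L1 mu a, L1 mu b,
    forall xi, ~ S xi -> a xi = 0 /\ b xi = 0 &
    {ae mu, forall xi, g xi <> 0 -> a xi != 0 \/ b xi != 0}].
Proof.
move=> lpsi fg [N [mN N0 gN]] Sr.
have gS xi : ~ N xi -> g xi <> 0 -> S xi.
  move=> nN g0; apply: contrapT => nS; apply: nN; apply: gN => /= /(_ g0).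
  exact: nS.
have Hp := plancherel_pair_fourier lpsi fg; have [lr li _] := Hp.
pose a xi := complex.Re (g xi) * \1_(~` N) xi.
pose b xi := - complex.Im (g xi) * \1_(~` N) xi.
have mI : measurable_fun setT (\1_(~` N) : 'cV[R]_n -> R).
  by apply: measurable_indic; exact: measurableC.
have ae1 : {ae mu, forall xi, \1_(~` N) xi = 1 :> R}.
  exists N; split => // xi /= h; apply: contrapT => nN; apply: h.
  by rewrite indicE mem_set.
have ab0 xi : ~ S xi -> a xi = 0 /\ b xi = 0.
  move=> nS; rewrite /a /b !indicE.
  have [nN|] := boolP (xi \in ~` N); last by rewrite !mulr0.
  have -> : g xi = 0 by apply: contrapT => g0; apply: nS; apply: gS => //; rewrite inE in nN.
  by rewrite /= oppr0 !mul0r.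
have ar xi : a xi != 0 -> forall i, `|xi i ord0| <= r.
  by move=> a0; apply: Sr; apply: contrapT => /ab0[a0' _]; rewrite a0' eqxx in a0.
have br xi : b xi != 0 -> forall i, `|xi i ord0| <= r.
  by move=> a0; apply: Sr; apply: contrapT => /ab0[_ a0']; rewrite a0' eqxx in a0.
have I1 xi : `|\1_(~` N) xi| <= 1 :> R by rewrite ger0_norm// indic_le1.
have la : L2 mu a by exact: (L2_bounded lr mI I1).
have lb : L2 mu b by exact: (L2_bounded li mI I1).
exists a, b; split => //.
- apply: plancherel_pair_ae Hp _ _ _ _; [by case: la|by case: lb| |].
    by apply: filterS ae1 => xi I; rewrite /a I mulr1.
  by apply: filterS ae1 => xi I; rewrite /b I mulr1.
- exact: (L2_support_L1 la ar).
- exact: (L2_support_L1 lb br).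
- apply: filterS ae1 => xi I g0; rewrite /a /b I !mulr1 oppr_eq0.
  move: g0; case: (g xi) => u v /= g0.
  have [u0|] := eqVneq u 0; [right|by left].
  by apply/eqP => v0; apply: g0; rewrite u0 v0.
Qed.

Lemma mulmx_cube_bound (M : 'M[R]_n) y i : centered_cube y ->
  `|(M *m y) i ord0| <= \sum_i \sum_j `|M i j|.
Proof.
move=> yc; rewrite mxE; apply: le_trans (ler_norm_sum _ _ _) _.
apply: (@le_trans _ _ (\sum_j `|M i j|)).
  apply: ler_sum => j _; rewrite normrM ler_piMr// ler_norml.
  by have /andP[] := yc j; lra.
by rewrite [leRHS](bigD1 i)//= lerDl; apply: sumr_ge0 => j _; exact: sumr_ge0.
Qed.

(** By injectivity the complex product (u - i v) (a - i b) vanishes almost everywhere, where u - i v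
    is the difference of the transform of f and sigma times that of h. Where g is nonzero, a^2 + b^2
    is nonzero and multiplying by the conjugate gives u = v = 0. The sampling set provides the bound
    on the spectrum that makes a and b integrable. *)
Lemma channel_agreement f h psi g fc fs hc hs (sigma : R) (X : 'cV[int]_n -> 'cV[R]_n) :
  L2 mu f -> L2 mu h -> L2 mu psi -> is_fourier psi g ->
  sign_blind_sampling_set (ess_support g) X ->
  plancherel_pair f fc fs -> plancherel_pair h hc hs ->
  (forall x, convolution f psi x = sigma * convolution h psi x) ->
  {ae mu, forall xi, g xi <> 0 -> fc xi = sigma * hc xi /\ fs xi = sigma * hs xi}.
Proof.
move=> lf lh lpsi fg [M [s [_ _ KM _ _]]] pf ph fh.
have aeS : {ae mu, forall xi, g xi <> 0 -> ess_support g xi}.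
  by apply: filterS (ae_ess_support g) => xi h1 g0; apply: contrapT => /h1.
have Sr xi : ess_support g xi -> forall i, `|xi i ord0| <= \sum_i \sum_j `|M i j|.
  by move=> /KM[y yc <-] i; exact: mulmx_cube_bound.
have [a [b [pab la lb _ ab0]]] := spectral_support lpsi fg aeS Sr.
have [l2a l2b _] := pab; have [lfc lfs _] := pf; have [lhc lhs _] := ph.
have c1 theta x := convolution_spectral theta x lf lpsi pf pab la lb.
have c2 theta x := convolution_spectral theta x lh lpsi ph pab la lb.
set p1 := (fun xi => fc xi * a xi - fs xi * b xi) in c1.
set q1 := (fun xi => fc xi * b xi + fs xi * a xi) in c1.
set p2 := (fun xi => hc xi * a xi - hs xi * b xi) in c2.
set q2 := (fun xi => hc xi * b xi + hs xi * a xi) in c2.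
have lp1 : L1 mu p1 by apply: L1B; exact: L2_mul.
have lq1 : L1 mu q1 by apply: L1D; exact: L2_mul.
have lp2 : L1 mu p2 by apply: L1B; exact: L2_mul.
have lq2 : L1 mu q2 by apply: L1D; exact: L2_mul.
have [||theta x|p0 q0] := @phase_transform_injective R n
  (fun xi => p1 xi + - sigma * p2 xi) (fun xi => q1 xi + - sigma * q2 xi).
- by apply: L1D => //; exact: L1Z.
- by apply: L1D => //; exact: L1Z.
- by rewrite phase_transform_linear// c1 c2 fh; ring.
apply: filterS3 p0 q0 ab0 => xi p0 q0 ab0 /ab0 ab.
pose u := fc xi - sigma * hc xi; pose v := fs xi - sigma * hs xi.
have e1 : u * a xi - v * b xi = 0 by rewrite -[RHS]p0 /u /v /p1 /p2; ring.
have e2 : u * b xi + v * a xi = 0 by rewrite -[RHS]q0 /u /v /q1 /q2; ring.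
have D : a xi ^+ 2 + b xi ^+ 2 != 0.
  by rewrite paddr_eq0 ?sqr_ge0// !sqrf_eq0 negb_and; apply/orP.
have uD : u * (a xi ^+ 2 + b xi ^+ 2) = 0.
  transitivity ((u * a xi - v * b xi) * a xi + (u * b xi + v * a xi) * b xi); first by ring.
  by rewrite e1 e2 !mul0r addr0.
have vD : v * (a xi ^+ 2 + b xi ^+ 2) = 0.
  transitivity ((u * b xi + v * a xi) * a xi - (u * a xi - v * b xi) * b xi); first by ring.
  by rewrite e1 e2 !mul0r subr0.
move/eqP : uD; move/eqP : vD; rewrite !mulf_eq0 (negbTE D) !orbF !subr_eq0.
by move=> /eqP -> /eqP ->.
Qed.

Lemma channel_sign f h psi g fc fs hc hs (X : 'cV[int]_n -> 'cV[R]_n) :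
  L2 mu f -> L2 mu h -> L2 mu psi -> is_fourier psi g ->
  plancherel_pair f fc fs -> plancherel_pair h hc hs ->
  sign_blind_sampling_set (ess_support g) X ->
  (forall k, `|convolution f psi (X k)| = `|convolution h psi (X k)|) ->
  (forall x, convolution f psi x = 1 * convolution h psi x) \/
  (forall x, convolution f psi x = - 1 * convolution h psi x).
Proof.
move=> lf lh lpsi fg pf ph [M [s [_ uM KM s1 XE]]] Hk.
pose Dinv : 'M[R]_n := diag_mx (\row_i (2 * s ord0 i)^-1).
have s0 i : 0 < s ord0 i by exact: lt_le_trans (s1 i).
have DD : diag_mx (2 *: s) *m Dinv = 1%:M.
  apply/matrixP => i j; rewrite mul_diag_mx !mxE; case: eqP => [->|_].
    by rewrite mulr1n divff// mulf_neq0// gt_eqF.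
  by rewrite mulr0n mulr0.
have uD : diag_mx (2 *: s) \in unitmx by have [] := mulmx1_unit DD.
have DE : invmx (diag_mx (2 *: s)) = Dinv.
  by rewrite -[RHS]mul1mx -(mulVmx uD) -mulmxA DD mulmx1.
(* In these coordinates the sampling lattice is C^T Z^n and M [-1/2, 1/2]^n becomes a box of
   half-sides 1 / (4 s_i), at most 1/4. *)
pose C := Dinv *m invmx M.
have uC : C \in unitmx by rewrite unitmx_mul unitmx_inv uM -DE unitmx_inv uD.
have XC k : X k = C^T *m map_mx intr k.
  by rewrite XE DE /C trmx_mul tr_diag_mx trmx_inv.
pose r : R := \sum_i \sum_j `|M i j|.
pose S : set 'cV[R]_n := [set xi : 'cV[R]_n | (forall i, `|xi i ord0| <= r) /\
   forall i, `|(C *m xi) i ord0| < 4^-1].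
have CK xi : ess_support g xi -> (forall i, `|xi i ord0| <= r) /\
   forall i, `|(C *m xi) i ord0| <= 4^-1.
  move=> /KM[y yc <-]; split=> i.
    exact: mulmx_cube_bound.
  rewrite /C -mulmxA mulKmx// mul_diag_mx !mxE normrM normfV.
  have si : 0 < 2 * s ord0 i by rewrite mulr_gt0.
  rewrite (gtr0_norm si) ler_pdivrMl//.
  have : `|y i ord0| <= 2^-1 by rewrite ler_norml; exact: yc.
  by have := s1 i; lra.
(* The strict inequality in [S] only excludes hyperplanes. *)
have aeS : {ae mu, forall xi, g xi <> 0 -> S xi}.
  have row0 i : C^T *m delta_mx i ord0 != 0 :> 'cV[R]_n.
    apply/eqP => /(congr1 (mulmx (invmx C^T))); rewrite mulKmx ?unitmx_tr// mulmx0.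
    by move=> /matrixP/(_ i ord0)/eqP; rewrite !mxE !eqxx oner_eq0.
  have rowE i xi : dot_cV (C^T *m delta_mx i ord0) xi = (C *m xi) i ord0.
    rewrite dot_cV_mulmx /dot_cV (bigD1 i)//= big1 => [|j ji].
      by rewrite mxE !eqxx mul1r addr0.
    by rewrite mxE (negbTE ji) mul0r.
  have H : {ae mu, forall xi, forall i : 'I_n, (C *m xi) i ord0 != 4^-1 /\ (C *m xi) i ord0 != - 4^-1}.
    apply: filter_forall => i.
    apply: filterS2 (ae_hyperplane (4^-1) (row0 i)) (ae_hyperplane (- 4^-1) (row0 i)) => xi.
    by rewrite rowE.
  apply: filterS2 (ae_ess_support g) H => xi h1 h2 g0.
  have /CK[c1 c2] : ess_support g xi by apply: contrapT => /h1.
  split => // i; have [n1 n2] := h2 i; have := c2 i.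
  rewrite ler_norml ltr_norml => /andP[l1 l2].
  by rewrite lt_neqAle eq_sym n2 l1/= lt_neqAle n1.
have Sr xi : S xi -> forall i, `|xi i ord0| <= r by case.
have [a [b [pab la lb ab0 _]]] := spectral_support lpsi fg aeS Sr.
have [l2a l2b _] := pab; have [lfc lfs _] := pf; have [lhc lhs _] := ph.
have c1 theta x := convolution_spectral theta x lf lpsi pf pab la lb.
have c2 theta x := convolution_spectral theta x lh lpsi ph pab la lb.
set p1 := (fun xi => fc xi * a xi - fs xi * b xi) in c1.
set q1 := (fun xi => fc xi * b xi + fs xi * a xi) in c1.
set p2 := (fun xi => hc xi * a xi - hs xi * b xi) in c2.
set q2 := (fun xi => hc xi * b xi + hs xi * a xi) in c2.
have lp1 : L1 mu p1 by apply: L1B; exact: L2_mul.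
have lq1 : L1 mu q1 by apply: L1D; exact: L2_mul.
have lp2 : L1 mu p2 by apply: L1B; exact: L2_mul.
have lq2 : L1 mu q2 by apply: L1D; exact: L2_mul.
have z xi : ~ S xi -> [/\ p1 xi = 0, q1 xi = 0, p2 xi = 0 & q2 xi = 0].
  by move=> /ab0[a0 b0]; rewrite /p1 /q1 /p2 /q2 a0 b0 !mulr0 subrr addr0.
have sq := phaseless_sampling uC lp1 lq1 lp2 lq2 z (fun xi => @proj2 _ _) c1 c2.
have {}sq x : convolution f psi x ^+ 2 = convolution h psi x ^+ 2.
  by apply: sq => k; rewrite -XC.
have dS p : L1 mu p -> (forall xi, ~ S xi -> p xi = 0) -> decay 1 p.
  move=> lp p0; apply: (decay_support lp) => xi px; apply: Sr.
  by apply: contrapT => /p0 px0; rewrite px0 eqxx in px.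
have d1 : decay 1 p1 by apply: dS => // xi /z[].
have d2 : decay 1 q1 by apply: dS => // xi /z[].
have d3 : decay 1 p2 by apply: dS => // xi /z[].
have d4 : decay 1 q2 by apply: dS => // xi /z[].
have E (c : R) x : phase_transform (fun xi => p1 xi + c * p2 xi) (fun xi => q1 xi + c * q2 xi) 0 x =
    convolution f psi x + c * convolution h psi x.
  by rewrite phase_transform_linear// c1 c2 cos0 !mul1r.
have [||||x|H|H] := @phase_transform_mul_eq0 R n 1 (fun xi => p1 xi + -1 * p2 xi)
  (fun xi => q1 xi + -1 * q2 xi) (fun xi => p1 xi + 1 * p2 xi) (fun xi => q1 xi + 1 * q2 xi) 0 ltr01.
- by apply: decayD => //; exact: decayZ.
- by apply: decayD => //; exact: decayZ.
- by apply: decayD => //; exact: decayZ.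
- by apply: decayD => //; exact: decayZ.
- by rewrite !E mulN1r mul1r -subr_sqr sq subrr.
- left=> x; have := H x; rewrite E; lra.
- right=> x; have := H x; rewrite E; lra.
Qed.


(** A neighborhood contains a box of side e > 0, whose measure e^n is positive. *)
Lemma ae_nbhs_exists x V (P : 'cV[R]_n -> Prop) : nbhs x V ->
  {ae mu, forall y, P y} -> exists y, V y /\ P y.
Proof.
move=> /nbhs_cVP[e e0 xV] aeP; apply: contrapT => /forallNP nVP.
pose lo : 'cV[R]_n := x - const_mx (e / 2); pose hi : 'cV[R]_n := x + const_mx (e / 2).
pose B := [set y : 'cV[R]_n | forall i, y i ord0 \in `[lo i ord0, hi i ord0]].
have BV y : B y -> V y.
  move=> By; apply: xV => i; have := By i; rewrite in_itv/= !mxE => /andP[h1 h2].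
  by rewrite ltr_norml; apply/andP; split; lra.
have mB : measurable B.
  rewrite (_ : B = \bigcap_(i : 'I_n)
      ((fun x : 'cV[R]_n => x i ord0) @^-1` `[lo i ord0, hi i ord0])).
    apply: fin_bigcap_measurable => [|i _]; first exact: finite_finset.
    by rewrite -[X in measurable X]setTI; exact: measurable_cV_coord.
  by apply/seteqP; split=> y /= H i; [move=> _; exact: H|exact: H].
have nB : mu.-negligible B.
  by apply: negligibleS aeP => y By /= Py; exact: (nVP y (conj (BV y By) Py)).
have lohi i : lo i ord0 <= hi i ord0 by rewrite !mxE; lra.
have := lebesgue_cV_box lohi; rewrite -/B => muB.
have muB0 : mu B = 0%E by exact: measure_negligible.
have : 0 < \prod_i (hi i ord0 - lo i ord0) by apply: prodr_gt0 => i _; rewrite !mxE; lra.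
by rewrite -lte_fin -muB muB0 ltxx.
Qed.

(** A nonzero value near x would persist on an open set, which has positive measure; so the zeros
    fill a neighborhood of x and the identity principle applies. *)
Lemma phase_transform_ae_eq0 alpha p q theta x V : 0 < alpha ->
  decay alpha p -> decay alpha q -> nbhs x V ->
  {ae mu, forall y, V y -> phase_transform p q theta y = 0} ->
  forall y, phase_transform p q theta y = 0.
Proof.
move=> a0 dp dq xV ae0; apply: (phase_transform_identity a0 dp dq (x := x)).
have : \forall y \near x, nbhs y V by exact: nbhs_interior.
apply: filterS => y yV; apply/eqP/negPn/negP => nz.
have [z [[nz' Vz] /(_ Vz) z0]] := ae_nbhs_exists (filterI (phase_transform_nbhs a0 dp dq nz) yV) ae0.
by rewrite z0 eqxx in nz'.
Qed.

Lemma frame_injective (Lambda : choiceType) (Psi : Lambda -> 'cV[R]_n -> R) f :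
  semi_discrete_frame Psi -> L2 mu f ->
  (forall l x, convolution f (Psi l) x = 0) -> {ae mu, forall x, f x = 0}.
Proof.
move=> [A [B [A0 AB H]]] lf f0.
have /andP[+ _] := H f (Lfun_L2 lf).
rewrite esum1 => [|l _]; last first.
  rewrite (_ : convolution f (Psi l) = fun=> 0); last by apply/funext => x; exact: f0.
  rewrite Lnorm2_sqr; last exact: L2_0.
  by under eq_Rintegral do rewrite expr0n/=; rewrite Rintegral_cst// mul0r.
rewrite Lnorm2_sqr// -EFinM lee_fin pmulr_rle0// => le0.
have [_ l2] := lf.
have i0 : \int[mu]_x (f x ^+ 2) = 0.
  by apply/eqP; rewrite eq_le le0 L2_sqr_ge0.
apply: filterS (Rintegral_eq0_ae l2 (fun x => sqr_ge0 (f x)) i0) => x /eqP.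
by rewrite sqrf_eq0 => /eqP.
Qed.

Lemma convolution_linear f h psi (c : R) x : L2 mu f -> L2 mu h -> L2 mu psi ->
  convolution (fun y => h y + c * f y) psi x = convolution h psi x + c * convolution f psi x.
Proof.
move=> lf lh lpsi; have lp := L2_cV_subl x lpsi.
have l1 := L2_mul lf lp; have l2 := L2_mul lh lp.
rewrite /convolution -(RintegralZl _ measurableT l1) -(RintegralD measurableT l2 (L1Z c l1)).
by apply: eq_Rintegral => y _; ring.
Qed.

(** Each coordinate is at most the Euclidean norm, so |x|_1 is at most n times that norm; hence the
    rate alpha / n. *)
Lemma exponential_moment_decay f (alpha : R) : (0 < n)%N -> 0 < alpha ->
  measurable_fun setT f ->
  (\int[mu]_x (`|f x| * expR (alpha * euclidean_norm x))%:E < +oo)%E ->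
  decay (alpha / n%:R) f.
Proof.
move=> n0 a0 mf foo; split => //.
have me : measurable_fun setT (fun x : 'cV[R]_n => expR (alpha * euclidean_norm x)).
  apply: measurableT_comp => //; apply: measurable_funM => //.
  exact: measurable_euclidean_norm.
have l : L1 mu (fun x => f x * expR (alpha * euclidean_norm x)).
  apply/integrableP; split; first by apply/measurable_EFinP; exact: measurable_funM.
  apply: le_lt_trans foo; rewrite le_eqVlt; apply/orP; left; apply/eqP.
  by apply: eq_integral => x _; rewrite /= normrM (ger0_norm (expR_ge0 _)).
apply: (L1_le _ _ l).
  by apply: measurable_funM => //; exact: measurable_expR_norm1.
move=> x; rewrite !normrM ler_wpM2l// !(ger0_norm (expR_ge0 _)) ler_expR.
rewrite -mulrA ler_pM2l// ler_pdivrMl ?ltr0n// mulr_natl /norm1_cV.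
rewrite -[X in _ *+ X](card_ord n) -sumr_const.
by apply: ler_sum => i _; exact: coord_le_euclidean.
Qed.

End channels.

Theorem theorem1 (R : realType) (d : nat) (d_gt0 : (0 < d)%N)
  (Lambda : choiceType)
  (psi : Lambda -> 'cV[R]_d -> R) (psihat : Lambda -> 'cV[R]_d -> R[i])
  (X : Lambda -> 'cV[int]_d -> 'cV[R]_d)
  (f : 'cV[R]_d -> R) (alpha : R) :
  (forall l, psi l \in Lfun (lebesgue_cV d) 2%:E) ->
  (forall l, is_fourier (psi l) (psihat l)) ->
  (forall l, compact (ess_support (psihat l))) ->
  (forall l, regular_support (psihat l)) ->
  semi_discrete_frame psi ->
  good_support_overlap (fun l => ess_support (psihat l)) ->
  (forall l, sign_blind_sampling_set (ess_support (psihat l)) (X l)) ->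
  f \in Lfun (lebesgue_cV d) 2%:E ->
  0 < alpha ->
  (\int[lebesgue_cV d]_x (`|f x| * expR (alpha * euclidean_norm x))%:E < +oo)%E ->
  forall h : 'cV[R]_d -> R, h \in Lfun (lebesgue_cV d) 2%:E ->
    (forall l k, `|convolution f (psi l) (X l k)| =
                 `|convolution h (psi l) (X l k)|) ->
    exists sigma : R, (sigma = 1 \/ sigma = - 1) /\
      {ae lebesgue_cV d, forall x, h x = sigma * f x}.
Proof.
move=> lpsi fpsi _ rpsi frame [U [U0 oU UF Ucov]] spsi lf a0 foo h lh Hk.
have {}lpsi l := L2_Lfun (lpsi l).
move: lf lh => /L2_Lfun lf /L2_Lfun lh.
have df := exponential_moment_decay d_gt0 a0 lf.1 foo.
have a0' : 0 < alpha / d%:R by rewrite divr_gt0// ltr0n.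
have l1f := decay_L1 a0' df.
have pf := plancherel_pair_L1 l1f lf.
have [hc [hs ph]] := plancherel_pair_exists lh.
have sgn l := channel_sign lf lh (lpsi l) (fpsi l) pf ph (spsi l) (Hk l).
pose eqs (sigma : R) l := forall x, convolution f (psi l) x = sigma * convolution h (psi l) x.
(* Since sigma^2 = 1, the channels of h - sigma f are (1 - sigma^2) times those of h, that is 0. *)
have all_sigma (sigma : R) : sigma ^+ 2 = 1 -> (forall l, eqs sigma l) ->
    {ae lebesgue_cV d, forall x, h x = sigma * f x}.
  move=> s2 H.
  have lfh : L2 (lebesgue_cV d) (fun x => h x + - sigma * f x) by apply: L2D => //; exact: L2Z.
  have H0 l x : convolution (fun x => h x + - sigma * f x) (psi l) x = 0.
    by rewrite convolution_linear// H mulrA mulNr -expr2 s2 mulN1r subrr.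
  by apply: filterS (frame_injective frame lfh H0) => x /eqP; rewrite mulNr subr_eq0 => /eqP.
pose A (sigma : R) : set 'cV[R]_d := \bigcup_(l in eqs sigma) U l.
have oA sigma : open (A sigma) by apply: bigcup_open => l _; exact: oU.
have Acov : A 1 `|` A (-1) = setT.
  rewrite -subTset -Ucov => x [l _ Ux].
  by have [Hl|Hl] := sgn l; [left|right]; exists l.
(* As every [U l] is nonempty, an empty [A (- sigma)] means that no channel has the sign - sigma. *)
have one_sided (sigma : R) : sigma ^+ 2 = 1 -> A (- sigma) = set0 ->
   (forall l, eqs sigma l \/ eqs (- sigma) l) -> {ae lebesgue_cV d, forall x, h x = sigma * f x}.
  move=> s2 A0 S; apply: all_sigma => // l; have [//|Hl] := S l.
  have [x Ux] := U0 l; have : A (- sigma) x by exists l.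
  by rewrite A0.
have [A1|/set0P A1] := eqVneq (A (-1)) set0.
  exists 1; split; first by left.
  by apply: one_sided; rewrite ?expr1n.
have [A2|/set0P A2] := eqVneq (A 1) set0.
  exists (-1); split; first by right.
  apply: one_sided; rewrite ?sqrrN ?expr1n ?opprK// => l.
  by have [] := sgn l; [right|left].
have [x [[l1 e1 U1] [l2 e2 U2]]] := open_meet (oA 1) (oA (-1)) Acov A2 A1.
have UI l : U l `<=` (ess_support (psihat l))°.
  by rewrite -open_subsetE; [exact: UF|exact: oU].
(* By regularity of the supports, both channels are almost everywhere
   nonvanishing on some open set; there the transform of [f] agrees with those
   of [h] and of [- h], hence vanishes. *)
have nb1 : nbhs x (U l1 `&` U l2).
  by apply: filterI; apply: open_nbhs_nbhs; split => //; exact: oU.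
have [y [[V1 yV1 ae1] [y1 y2]]] := rpsi l1 x (UI _ _ U1) _ nb1.
(* The point y is still in [U l2], so the density for [l2] can be used at y inside the interior of
   [V1]. *)
have nb2 : nbhs y (V1° `&` U l2).
  apply: filterI; first exact: nbhs_interior.
  by apply: open_nbhs_nbhs; split.
have [z [[V2 zV2 ae2] [z1 z2]]] := rpsi l2 y (UI _ _ y2) _ nb2.
have zV : nbhs z (V1 `&` V2) by apply: filterI.
have ag1 := channel_agreement lf lh (lpsi l1) (fpsi l1) (spsi l1) pf ph e1.
have ag2 := channel_agreement lf lh (lpsi l2) (fpsi l2) (spsi l2) pf ph e2.
have F0 : {ae lebesgue_cV d, forall xi, (V1 `&` V2) xi -> fcos f xi = 0 /\ fsin f xi = 0}.
  have ag : {ae lebesgue_cV d, forall xi, (psihat l1 xi <> 0 -> fcos f xi = 1 * hc xi /\ fsin f xi = 1 * hs xi) /\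
     (psihat l2 xi <> 0 -> fcos f xi = -1 * hc xi /\ fsin f xi = -1 * hs xi)}.
    by apply: filterS2 ag1 ag2 => xi.
  apply: filterS3 ag ae1 ae2 => xi [a1 a2] n1 n2 [v1 v2].
  have [c1 s1] := a1 (n1 v1); have [c2 s2] := a2 (n2 v2).
  by split; lra.
have d0 : @decay R d (alpha / d%:R) (fun=> 0).
  by split => //; apply: eq_L1 (L1_0 _) => xi; rewrite mul0r.
have Fc y' : fcos f y' = 0.
  rewrite fcosE; apply: (phase_transform_ae_eq0 a0' df d0 zV).
  by apply: filterS F0 => xi H /H[]; rewrite fcosE.
have Fs y' : fsin f y' = 0.
  rewrite fsinE; apply: (phase_transform_ae_eq0 a0' d0 df zV).
  by apply: filterS F0 => xi H /H[_]; rewrite fsinE.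
have f0 := fourier_injective l1f Fc Fs.
have cf0 l x' : convolution f (psi l) x' = 0.
  have [ml _] := L2_cV_subl x' (lpsi l).
  rewrite /convolution (@ae_eq_Rintegral _ _ _ _ _ (fun=> 0)) ?Rintegral_cst ?mul0r//.
    by apply: measurable_funM => //; exact: lf.1.
  by apply: filterS f0 => t ->; rewrite mul0r.
(* With f = 0 almost everywhere, both signs say that the channel of h vanishes, so sigma = 1 is
   valid for all channels at once. *)
exists 1; split; first by left.
apply: all_sigma; first by rewrite expr1n.
move=> l x'; have [->//|Hl] := sgn l.
by have := Hl x'; rewrite cf0; lra.
Qed.
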